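(* Let $n\ge 3$, let $\Omega\subseteq\mathbb{R}^n$ be a minimally smooth domain, let $b\in L^\infty(\partial\Omega)$ be real valued, and let $a_1,\dots,a_n:\overline{\Omega}\to(0,\infty)$ belong to $C^1(\overline{\Omega})$ with $m_a>0$, $M_a<\infty$, $M_a'<\infty$. Let $C_S\ge 0$ be a constant such that $\Vert u\Vert_{L^{2n/(n-2)}}\le C_S\Vert u\Vert_{H^1}$ for all $u\in H^1(\Omega)$. Assume that $$m_a^2>D_{a,b}:=C_SM_a'+\Vert\min\{b,0\}\Vert_{L^\infty(\partial\Omega)}\Vert\tau_D\Vert^2.$$ Let $s\in\mathbb{R}^{n+1}$ satisfy $$|s|^2>\frac{M_a^2s_0^2}{m_a^2-D_{a,b}}+D_{a,b}.$$ Then for every $f\in L^2(\Omega)$ there exists a unique $u_f\in H^1(\Omega)$ such that $$q_s^R(u_f,v)=\langle f,v\rangle_{L^2}\qquad\text{for all }v\in H^1(\Omega).$$ Moreover, this solution satisfies the bound $$\Vert u_f\Vert_{H^1}\leq\frac{2\Vert f\Vert_{L^2}}{|s|^2+m_a^2-2D_{a,b}-\sqrt{(|s|^2-m_a^2)^2+4M_a^2s_0^2}}.$$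
   Context: Clifford algebra: $\mathbb{R}_n$ is the real Clifford algebra generated by imaginary units $e_1,\dots,e_n$ with $e_i^2=-1$ and $e_ie_j=-e_je_i$ for $i\neq j$. It has the basis $e_A=e_{i_1}\cdots e_{i_r}$, $A=(i_1,\dots,i_r)$, $1\le i_1<\dots<i_r\le n$, $0\le r\le n$, with $e_\emptyset=1$. For $x=\sum_Ax_Ae_A\in\mathbb{R}_n$: the scalar part is $\operatorname{Sc}(x)=x_\emptyset$; the conjugate is $\overline{x}=\sum_Ax_A\overline{e_A}$ with $\overline{e_A}=\overline{e_{i_r}}\cdots\overline{e_{i_1}}$ and $\overline{e_i}=-e_i$; the norm is $|x|=(\sum_Ax_A^2)^{1/2}$. Paravectors are the elements $s=s_0+s_1e_1+\dots+s_ne_n$ with $s_0,\dots,s_n\in\mathbb{R}$; the set of paravectors is identified with $\mathbb{R}^{n+1}$. Function spaces: $L^2(\Omega)$ and $L^2(\partial\Omega)$ are the spaces of square integrable $\mathbb{R}_n$-valued functions (on $\partial\Omega$ with respect to surface measure), with $\mathbb{R}_n$-valued inner product $\langle f,g\rangle=\int\overline{f}g$ and norm $\Vert f\Vert=(\int|f|^2)^{1/2}$. $H^1(\Omega)$ is the usual Sobolev space of $\mathbb{R}_n$-valued functions (componentwise), $\Vert u\Vert_D:=\big(\sum_{i=1}^n\Vert\frac{\partial u}{\partial x_i}\Vert_{L^2}^2\big)^{1/2}$ and $\Vert u\Vert_{H^1}^2=\Vert u\Vert_{L^2}^2+\Vert u\Vert_D^2$. $\tau_D:H^1(\Omega)\to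 L^2(\partial\Omega)$ is the bounded Dirichlet trace operator and $\Vert\tau_D\Vert$ its operator norm. Minimally smooth domain (Stein): $\Omega$ is a domain for which there exist $\varepsilon>0$, $N\in\mathbb{N}$, $M>0$ and a sequence of open sets $U_1,U_2,\dots$ such that (i) for every $x\in\partial\Omega$ the ball $B(x,\varepsilon)$ is contained in some $U_i$; (ii) no point of $\mathbb{R}^n$ lies in more than $N$ of the $U_i$; (iii) for each $i$ there is a set $D_i$ which is, up to a rotation, of the form $\{(x',x_n):x_n>\varphi_i(x')\}$ with $\varphi_i:\mathbb{R}^{n-1}\to\mathbb{R}$ Lipschitz with constant at most $M$, such that $U_i\cap\Omega=U_i\cap D_i$. On such domains a constant $C_S$ as in the claim exists. Coefficient bounds: $$m_a:=\min_{i}\inf_{x\in\Omega}a_i(x),\qquad M_a:=\Big(\sum_{i=1}^n\Vert a_i\Vert_\infty^2\Big)^{1/2},\qquad M_a':=\Big(\sum_{i,j=1}^n\Big\Vert a_j\frac{\partial a_i}{\partial x_j}\Big\Vert_{L^n(\Omega)}^2\Big)^{1/2}.$$ Robin form: with $B_i:=\sum_{j=1}^ne_ja_j\frac{\partial a_i}{\partial x_j}$ for $i\in\{1,\dots,n\}$, and for $s\in\mathbb{R}^{n+1}$, define for $u,v\in H^1(\Omega)$ $$q_s^R(u,v):=\sum_{i=1}^n\Big\langle\frac{\partial u}{\partial x_i},a_i^2\frac{\partial v}{\partial x_i}+(2s_0a_i-B_i)e_iv\Big\rangle_{L^2}+|s|^2\langle u,v\rangle_{L^2}+\langle b\,\tau_Du,\tau_Dv\rangle_{L^2(\partial\Omega)}.$$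 *)

(* Defs.v *)
From HB Require Import structures.
From mathcomp Require Import all_boot all_order all_algebra.
From mathcomp Require Import all_classical all_reals all_analysis.
Set Implicit Arguments.
Unset Strict Implicit.
Unset Printing Implicit Defensive.
Import Order.TTheory GRing.Theory Num.Theory.
Import numFieldNormedType.Exports.

Local Open Scope classical_set_scope.
Local Open Scope ring_scope.

Section Clifford.
Variables (R : comNzRingType) (n : nat).

(* The coordinate [x A] is the coefficient of e_A. *)
Definition clifford := {ffun {set 'I_n} -> R^o}.
HB.instance Definition _ := GRing.Lmodule.on clifford.

Definition symdiff (A B : {set 'I_n}) : {set 'I_n} := (A :\: B) :|: (B :\: A).

(* The sign in e_A e_B = csign A B *: e_(symdiff A B): each e_i with i in A
   moves past the e_j with j in B and j < i, and e_i ^+ 2 = -1 if i is in both. *)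
Definition csign (A B : {set 'I_n}) : R :=
  \prod_(i in A) \prod_(j in B | (j <= i)%N) -1.

Definition cbasis (A : {set 'I_n}) : clifford := [ffun B => (B == A)%:R].

Definition cmul (x y : clifford) : clifford :=
  \sum_A \sum_B (csign A B * x A * y B) *: cbasis (symdiff A B).

Lemma symdiffE i A B : (i \in symdiff A B) = (i \in A) (+) (i \in B).
Proof. by rewrite !inE; case: (i \in A); case: (i \in B). Qed.

Lemma symdiffA : associative symdiff.
Proof. by move=> A B C; apply/setP => i; rewrite !symdiffE addbA. Qed.

Lemma symdiff0l : left_id finset.set0 symdiff.
Proof. by move=> A; apply/setP => i; rewrite !symdiffE inE. Qed.

Lemma symdiff0r : right_id finset.set0 symdiff.
Proof. by move=> A; apply/setP => i; rewrite !symdiffE inE addbF. Qed.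

Lemma prod_symdiff (F : 'I_n -> R) A B : (forall i, F i * F i = 1) ->
  \prod_(i in symdiff A B) F i = (\prod_(i in A) F i) * \prod_(i in B) F i.
Proof.
move=> F1; rewrite !(big_mkcond (fun i => i \in _)) -big_split /=.
apply: eq_bigr => i _; rewrite symdiffE.
by case: (i \in A); case: (i \in B); rewrite /= ?mulr1 ?mul1r ?F1.
Qed.

Lemma csign_symdiffl A B C : csign (symdiff A B) C = csign A C * csign B C.
Proof.
rewrite /csign prod_symdiff // => i.
by rewrite -big_split big1 // => j _ /=; rewrite mulrNN mulr1.
Qed.

Lemma csign_symdiffr A B C : csign A (symdiff B C) = csign A B * csign A C.
Proof.
rewrite /csign -big_split; apply: eq_bigr => i _ /=.
rewrite !big_mkcondr prod_symdiff // => j.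
by case: ifP; rewrite ?mulrNN mulr1.
Qed.

Lemma csign0l A : csign finset.set0 A = 1.
Proof. by rewrite /csign big_set0. Qed.

Lemma csign0r A : csign A finset.set0 = 1.
Proof. by rewrite /csign big1 // => i _; rewrite big_mkcondr big_set0. Qed.

Lemma cbasis_sum (x : clifford) : x = \sum_A x A *: cbasis A.
Proof.
apply/ffunP => B; rewrite sum_ffunE (bigD1 B) //= big1 => [|A AB].
  by rewrite !ffunE eqxx [_ *: _]mulr1 addr0.
by rewrite !ffunE eq_sym (negbTE AB) [_ *: _]mulr0.
Qed.

Lemma cmul_basis A B :
  cmul (cbasis A) (cbasis B) = csign A B *: cbasis (symdiff A B).
Proof.
rewrite /cmul (bigD1 A) //= [X in _ + X]big1 ?addr0 => [|A' AA'].
  rewrite (bigD1 B) //= big1 ?addr0 => [|B' BB'].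
    by rewrite !ffunE !eqxx !mulr1.
  by rewrite !ffunE (negbTE BB') mulr0 scale0r.
by rewrite big1 // => B' _; rewrite !ffunE (negbTE AA') mulr0 mul0r scale0r.
Qed.

Lemma cmulDl : left_distributive cmul +%R.
Proof.
move=> x y z; rewrite /cmul -big_split; apply: eq_bigr => A _.
rewrite -big_split; apply: eq_bigr => B _ /=.
by rewrite ffunE mulrDr mulrDl scalerDl.
Qed.

Lemma cmulDr : right_distributive cmul +%R.
Proof.
move=> x y z; rewrite /cmul -big_split; apply: eq_bigr => A _.
rewrite -big_split; apply: eq_bigr => B _ /=.
by rewrite ffunE mulrDr scalerDl.
Qed.

Lemma cmulZl (k : R) x y : cmul (k *: x) y = k *: cmul x y.
Proof.
rewrite /cmul scaler_sumr; apply: eq_bigr => A _.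
rewrite scaler_sumr; apply: eq_bigr => B _.
by rewrite ffunE scalerA mulrCA !mulrA.
Qed.

Lemma cmulZr (k : R) x y : cmul x (k *: y) = k *: cmul x y.
Proof.
rewrite /cmul scaler_sumr; apply: eq_bigr => A _.
rewrite scaler_sumr; apply: eq_bigr => B _.
by rewrite ffunE scalerA mulrCA.
Qed.

Lemma cmul_suml (F : {set 'I_n} -> clifford) y :
  cmul (\sum_A F A) y = \sum_A cmul (F A) y.
Proof.
apply: (big_morph (cmul^~ y)) => [u v|]; first exact: cmulDl.
by apply: (addrI (cmul 0 y)); rewrite -cmulDl !addr0.
Qed.

Lemma cmul_sumr (F : {set 'I_n} -> clifford) x :
  cmul x (\sum_A F A) = \sum_A cmul x (F A).
Proof.
apply: (big_morph (cmul x)) => [u v|]; first exact: cmulDr.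
by apply: (addrI (cmul x 0)); rewrite -cmulDr !addr0.
Qed.

Lemma cmul_expandl x y : cmul x y = \sum_A x A *: cmul (cbasis A) y.
Proof.
rewrite {1}(cbasis_sum x) cmul_suml.
by apply: eq_bigr => A _; rewrite cmulZl.
Qed.

Lemma cmul_expandr x y : cmul x y = \sum_A y A *: cmul x (cbasis A).
Proof.
rewrite {1}(cbasis_sum y) cmul_sumr.
by apply: eq_bigr => A _; rewrite cmulZr.
Qed.

Lemma cmulA : associative cmul.
Proof.
move=> x y z.
rewrite [LHS]cmul_expandl [cmul x y]cmul_expandl cmul_suml.
apply: eq_bigr => A _; rewrite cmulZl; congr (_ *: _).
rewrite [cmul y z]cmul_expandl [cmul _ y]cmul_expandr cmul_sumr cmul_suml.
apply: eq_bigr => B _; rewrite cmulZl cmulZr; congr (_ *: _).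
rewrite [cmul (cbasis B) z]cmul_expandr [RHS]cmul_expandr cmul_sumr.
apply: eq_bigr => C _; rewrite cmulZr; congr (_ *: _).
rewrite !cmul_basis cmulZl cmulZr !cmul_basis !scalerA symdiffA.
congr (_ *: _); rewrite csign_symdiffl csign_symdiffr.
by rewrite [LHS]mulrC -!mulrA.
Qed.

Lemma cmul1l : left_id (cbasis finset.set0) cmul.
Proof.
move=> x; rewrite [in LHS](cbasis_sum x) cmul_sumr [RHS]cbasis_sum.
by apply: eq_bigr => A _; rewrite cmulZr cmul_basis csign0l scale1r symdiff0l.
Qed.

Lemma cmul1r : right_id (cbasis finset.set0) cmul.
Proof.
move=> x; rewrite [in LHS](cbasis_sum x) cmul_suml [RHS]cbasis_sum.
by apply: eq_bigr => A _; rewrite cmulZl cmul_basis csign0r scale1r symdiff0r.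
Qed.

Lemma cbasis0_neq0 : cbasis finset.set0 != 0.
Proof.
apply/eqP => /ffunP /(_ finset.set0) /eqP.
by rewrite !ffunE eqxx oner_eq0.
Qed.

HB.instance Definition _ := GRing.Zmodule_isNzRing.Build clifford
  cmulA cmul1l cmul1r cmulDl cmulDr cbasis0_neq0.
HB.instance Definition _ := GRing.Lmodule_isLalgebra.Build R clifford
  (fun k x y => esym (cmulZl k x y)).
HB.instance Definition _ := GRing.Lalgebra_isAlgebra.Build R clifford
  (fun k x y => esym (cmulZr k x y)).

Definition cgen (i : 'I_n) : clifford := cbasis (finset.set1 i).

Lemma cgen_sqr i : cgen i * cgen i = -1.
Proof.
rewrite [LHS]cmul_basis /csign big_set1 big_mkcondr big_set1 leqnn scaleN1r.
by congr (- cbasis _); apply/setP => j; rewrite symdiffE addbb inE.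
Qed.

Lemma cgen_anti i j : i != j -> cgen i * cgen j = - (cgen j * cgen i).
Proof.
move=> ij; rewrite [LHS]cmul_basis [in RHS]/GRing.mul /= cmul_basis.
rewrite /csign !big_set1 !big_mkcondr !big_set1.
have -> : symdiff (finset.set1 j) (finset.set1 i) =
    symdiff (finset.set1 i) (finset.set1 j).
  by apply/setP => k; rewrite !symdiffE addbC.
case: ltngtP => [_|_|/val_inj ji]; last by rewrite ji eqxx in ij.
  by rewrite scaleN1r scale1r.
by rewrite scaleN1r scale1r opprK.
Qed.

Lemma cbasisE A : cbasis A = \prod_(i <- enum A) cgen i.
Proof.
suff H s : sorted (fun i j : 'I_n => (i < j)%N) s ->
    \prod_(i <- s) cgen i = cbasis [set i in s].
  rewrite H ?set_enum //.
  rewrite /enum_mem; apply: sorted_filter => [i j k|]; first exact: ltn_trans.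
  rewrite -enumT -(@sorted_map _ _ val ltn).
  by rewrite val_enum_ord iota_ltn_sorted.
elim: s => [_|i s IH].
  by rewrite big_nil; congr cbasis; apply/setP => i; rewrite !inE.
move=> /= si; rewrite big_cons IH ?(path_sorted si) // [LHS]cmul_basis.
have lt_is j : j \in s -> (i < j)%N.
  move: si; rewrite (path_sortedE (fun x y z => @ltn_trans _ _ _)).
  by case/andP => /allP/(_ j).
rewrite /csign big_set1 big_pred0 ?scale1r => [|j]; last first.
  by rewrite inE; apply/negP => /andP [/lt_is]; rewrite ltnNge => /negP.
congr cbasis; apply/setP => j; rewrite symdiffE !inE.
case: eqVneq => //= ->; apply/negP => /lt_is; by rewrite ltnn.
Qed.

End Clifford.
Section CoverMeasure.
Local Open Scope ereal_scope.
Context (R : realType) (T : pointedType).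

Definition cover_measure (w : set T -> \bar R) (A : set T) : \bar R :=
  ereal_inf [set \sum_(k <oo) w (F k)
            | F in [set F : (set T)^nat | A `<=` \bigcup_k F k]].

Variable w : set T -> \bar R.
Hypotheses (w0 : w set0 = 0) (w_ge0 : forall A, 0 <= w A).

Let cover_measureE A :
  cover_measure w A = mu_ext (w : set (g_sigma_algebraType setT) -> \bar R) A.
Proof.
congr (ereal_inf _); apply/seteqP; split=> _ [F FA <-]; exists F => //.
  by split => // i; exact: sub_gen_smallest.
by case: FA.
Qed.

Lemma cover_measure0 : cover_measure w set0 = 0.
Proof. by rewrite cover_measureE mu_ext0. Qed.

Lemma cover_measure_ge0 A : 0 <= cover_measure w A.
Proof. by rewrite cover_measureE mu_ext_ge0. Qed.

Lemma le_cover_measure :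
  {homo cover_measure w : A B / A `<=` B >-> A <= B}.
Proof. by move=> A B AB; rewrite !cover_measureE le_mu_ext. Qed.

Lemma cover_measure_sigma_subadditive : sigma_subadditive (cover_measure w).
Proof.
move=> F; rewrite cover_measureE.
under eq_eseriesr do rewrite cover_measureE.
exact: mu_ext_sigma_subadditive.
Qed.

End CoverMeasure.

Section Lebesgue.
Context (R : realType) (n : nat).

Definition box (a b : 'rV[R]_n) : set 'rV[R]_n :=
  [set x | forall i, a 0 i < x 0 i <= b 0 i].

Definition box_weight (A : set 'rV[R]_n) : \bar R :=
  if A == set0 then 0%E else
  ereal_inf [set z | exists a b : 'rV[R]_n, [/\ forall i, a 0 i <= b 0 i, A = box a b &
                                     z = (\prod_i (b 0 i - a 0 i))%:E]].

Lemma box_weight0 : box_weight set0 = 0%E.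
Proof. by rewrite /box_weight eqxx. Qed.

Lemma box_weight_ge0 A : (0 <= box_weight A)%E.
Proof.
rewrite /box_weight; case: ifP => // _; apply: le_ereal_inf_tmp.
move=> _ [a [b [ab _ ->]]]; rewrite lee_fin.
by apply: prodr_ge0 => i _; rewrite subr_ge0.
Qed.

Definition lebesgue_outer : set 'rV[R]_n -> \bar R := cover_measure box_weight.

HB.instance Definition _ := isOuterMeasure.Build R 'rV[R]_n lebesgue_outer
  (cover_measure0 box_weight0 box_weight_ge0)
  (cover_measure_ge0 box_weight_ge0) (@le_cover_measure _ _ _)
  (cover_measure_sigma_subadditive box_weight_ge0).

Definition lebesgue_rV :
    {measure set (caratheodory_type lebesgue_outer) -> \bar R} :=
  [the {measure set _ -> \bar R} of
    ([the {outer_measure set _ -> \bar R} of lebesgue_outer]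
      : set (caratheodory_type lebesgue_outer) -> \bar R)].

End Lebesgue.

Section Hausdorff.
Context (R : realType) (n : nat).

Definition enorm (m : nat) (x : 'rV[R]_m) : R :=
  Num.sqrt (\sum_i x 0 i ^+ 2).

Definition ediam (A : set 'rV[R]_n) : \bar R :=
  ereal_sup [set z | exists x y : 'rV[R]_n, [/\ A x, A y &
                                     z = (enorm (x - y))%:E]].

(* Volume of the Euclidean unit ball of dimension k. *)
Fixpoint ball_volume (k : nat) : R :=
  match k with
  | 0 => 1
  | 1 => 2
  | k'.+2 => 2 * pi / k%:R * ball_volume k'
  end.

Variable k : nat.

(* Weights at scale delta of the k-dimensional Hausdorff measure; with the
   factor [ball_volume k / 2 ^ k] it agrees with Lebesgue measure on k-planes. *)
Definition hausdorff_weight (delta : R) (A : set 'rV[R]_n) : \bar R :=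
  if A == set0 then 0%E else
  if (ediam A <= delta%:E)%E
  then ((ball_volume k / 2 ^+ k)%:E * ediam A ^+ k)%E else +oo%E.

Definition hausdorff_outer (A : set 'rV[R]_n) : \bar R :=
  ereal_sup [set cover_measure (hausdorff_weight delta) A
            | delta in [set delta : R | 0 < delta]].

Lemma ball_volume_ge0 j : 0 <= ball_volume j.
Proof.
have [m] := ubnP j; elim: m j => // m IH [|[|j]] //= jm.
by rewrite mulr_ge0 ?divr_ge0 ?mulr_ge0 ?pi_ge0 ?IH // ltnW.
Qed.

Lemma hausdorff_weight0 delta : hausdorff_weight delta set0 = 0%E.
Proof. by rewrite /hausdorff_weight eqxx. Qed.

Lemma hausdorff_weight_ge0 delta A : (0 <= hausdorff_weight delta A)%E.
Proof.
rewrite /hausdorff_weight; case: ifPn => // /set0P[x Ax]; case: ifP => // _.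
rewrite mule_ge0 ?lee_fin ?divr_ge0 ?ball_volume_ge0 ?exprn_ge0 //.
apply: expe_ge0; apply: ereal_sup_ubound; exists x, x; split => //; congr EFin.
by rewrite subrr /enorm big1 ?sqrtr0 // => i _; rewrite mxE expr0n.
Qed.

Let cover_le A (delta : R) : 0 < delta ->
  (cover_measure (hausdorff_weight delta) A <= hausdorff_outer A)%E.
Proof. by move=> d0; apply: ereal_sup_ubound; exists delta. Qed.

Lemma hausdorff_outer0 : hausdorff_outer set0 = 0%E.
Proof.
apply/eqP; rewrite eq_le; apply/andP; split.
  apply: ge_ereal_sup => _ [delta _ <-].
  by rewrite cover_measure0 // => *; [exact: hausdorff_weight0
    | exact: hausdorff_weight_ge0].
apply: le_trans (cover_le _ ltr01).
by rewrite cover_measure_ge0 // => *; exact: hausdorff_weight_ge0.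
Qed.

Lemma hausdorff_outer_ge0 A : (0 <= hausdorff_outer A)%E.
Proof.
apply: le_trans (cover_le _ ltr01).
by rewrite cover_measure_ge0 // => *; exact: hausdorff_weight_ge0.
Qed.

Lemma le_hausdorff_outer :
  {homo hausdorff_outer : A B / A `<=` B >-> (A <= B)%E}.
Proof.
move=> A B AB; apply: ge_ereal_sup => _ [delta d0 <-].
apply: le_trans (cover_le _ d0).
exact: le_cover_measure.
Qed.

Lemma hausdorff_outer_sigma_subadditive : sigma_subadditive hausdorff_outer.
Proof.
move=> F; apply: ge_ereal_sup => _ [delta d0 <-].
apply: le_trans (cover_measure_sigma_subadditive _ F) _ => [A|].
  exact: hausdorff_weight_ge0.
apply: lee_nneseries => i _; last exact: cover_le.
by rewrite cover_measure_ge0 // => *; exact: hausdorff_weight_ge0.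
Qed.

HB.instance Definition _ := isOuterMeasure.Build R 'rV[R]_n hausdorff_outer
  hausdorff_outer0 hausdorff_outer_ge0 le_hausdorff_outer
  hausdorff_outer_sigma_subadditive.

Definition hausdorff :
    {measure set (caratheodory_type hausdorff_outer) -> \bar R} :=
  [the {measure set _ -> \bar R} of
    ([the {outer_measure set _ -> \bar R} of hausdorff_outer]
      : set (caratheodory_type hausdorff_outer) -> \bar R)].

End Hausdorff.

Section CliffordFunctions.
Context (R : realType) (n : nat).
Local Notation Cl := (clifford R n).

Definition Sc (x : Cl) : R := x finset.set0.

Definition cconj (x : Cl) : Cl :=
  \sum_A x A *: \prod_(i <- rev (enum A)) (- cgen R i).

Definition cnorm (x : Cl) : R := Num.sqrt (\sum_A x A ^+ 2).

Definition paravector (x : Cl) : Prop :=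
  exists (s0 : R) (s : 'I_n -> R), x = s0%:A + \sum_i s i *: cgen R i.

Context d (T : measurableType d) (mu : {measure set T -> \bar R}) (D : set T).

Definition Cintegral (f : T -> Cl) : Cl :=
  [ffun A => (\int[mu]_(x in D) f x A)%R].

(* Clifford-valued functions are kept as functions on the whole space, of which
   only the restriction to D matters, up to equality almost everywhere. *)
Definition L2 (f : T -> Cl) : Prop :=
  (forall A, measurable_fun D (fun x => f x A : R)) /\
  (\int[mu]_(x in D) (cnorm (f x) ^+ 2)%:E < +oo)%E.

Definition L2inner (f g : T -> Cl) : Cl :=
  Cintegral (fun x => cconj (f x) * g x).

Definition L2norm (f : T -> Cl) : R :=
  Num.sqrt (\int[mu]_(x in D) (cnorm (f x) ^+ 2))%R.

Definition Lpnorm (p : \bar R) (f : T -> R) : \bar R :=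
  'N[mu]_p[(EFin \o f) \_ D]%E.

Definition Linfty (f : T -> R) : Prop :=
  measurable_fun D f /\ (Lpnorm +oo f < +oo)%E.

End CliffordFunctions.

Section Sobolev.
Context (R : realType) (n : nat).
Local Notation Cl := (clifford R n).
Local Notation V := ('rV[R]_n).

Definition partial (i : 'I_n) (f : V -> R) : V -> R := 'D_(delta_mx 0 i) f.

Definition smooth (phi : V -> R) : Prop :=
  forall (s : seq 'I_n) (x : V), differentiable (foldr partial phi s) x.

Definition support (phi : V -> R) : set V := closure [set x | phi x != 0].

Definition test_function (Omega : set V) (phi : V -> R) : Prop :=
  [/\ smooth phi, compact (support phi) & support phi `<=` Omega].

(* [a], defined on the closure of Omega, and its partial derivatives in Omega
   are continuous up to the boundary. *)
Definition C1_closure (Omega : set V) (a : V -> R) : Prop :=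
  {within closure Omega, continuous a} /\
  forall i, (forall x, Omega x -> derivable a x (delta_mx 0 i)) /\
    exists2 g : V -> R, {within closure Omega, continuous g} &
      forall x, Omega x -> partial i a x = g x.

Variable Omega : set V.
Local Notation leb := (@lebesgue_rV R n).

Definition weak_partial (i : 'I_n) (u g : V -> Cl) : Prop :=
  forall phi, test_function Omega phi ->
    Cintegral leb Omega (fun x => partial i phi x *: u x) =
    - Cintegral leb Omega (fun x => phi x *: g x).

(* The weak gradient is determined almost everywhere by the function. *)
Record H1 := MkH1 {
  H1fun :> V -> Cl ;
  H1grad : 'I_n -> V -> Cl ;
  H1fun_L2 : L2 leb Omega H1fun ;
  H1grad_L2 : forall i, L2 leb Omega (H1grad i) ;
  H1_weak : forall i, weak_partial i H1fun (H1grad i) }.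

Definition Dnorm (u : H1) : R :=
  Num.sqrt (\sum_i L2norm leb Omega (H1grad u i) ^+ 2).

Definition H1norm (u : H1) : R :=
  Num.sqrt (L2norm leb Omega u ^+ 2 + Dnorm u ^+ 2).

Definition boundary (A : set V) : set V := closure A `\` A°.

Definition surface := @hausdorff R n n.-1.

(* Smooth compactly supported functions being dense in H1, these conditions
   characterize the trace up to equality almost everywhere. *)
Record dirichlet_trace (tau : H1 -> V -> Cl) : Prop := {
  trace_L2 : forall u, L2 surface (boundary Omega) (tau u) ;
  trace_linear : forall (u v w : H1) (c : Cl),
    {ae leb, forall x, Omega x -> w x = u x * c + v x} ->
    {ae surface, forall x, boundary Omega x ->
                           tau w x = tau u x * c + tau v x} ;
  trace_bounded : exists K : R, forall u,
    L2norm surface (boundary Omega) (tau u) <= K * H1norm u ;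
  trace_smooth : forall (u : H1) (phi : V -> Cl),
    (forall A, test_function setT (fun x => phi x A)) ->
    {ae leb, forall x, Omega x -> u x = phi x} ->
    {ae surface, forall x, boundary Omega x -> tau u x = phi x} }.

Definition trace_norm (tau : H1 -> V -> Cl) : R :=
  sup [set L2norm surface (boundary Omega) (tau u) | u in
        [set u | H1norm u <= 1]].

End Sobolev.

(* The ambient dimension is n.+1, so that [col' ord_max y] and [y 0 ord_max] are
   y' and the last coordinate of y, and the rotation acts by x |-> x *m Q. *)
Definition minimally_smooth (R : realType) (n : nat) (Omega : set 'rV[R]_n.+1) :=
  [/\ open Omega, connected Omega, Omega !=set0 &
  exists (eps : R) (N : nat) (M : R) (U : nat -> set 'rV[R]_n.+1),
  [/\ 0 < eps, 0 < M, forall i, open (U i) &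
  [/\ forall x, boundary Omega x ->
        exists i, [set y | enorm (y - x) < eps] `<=` U i,
      forall x, ([set i | U i x] #<= `I_N)%card &
      forall i, exists (Q : 'M[R]_n.+1) (phi : 'rV[R]_n -> R),
        [/\ Q *m Q^T = 1%:M, \det Q = 1,
            forall y z, `|phi y - phi z| <= M * enorm (y - z) &
            U i `&` Omega = U i `&`
              [set x | phi (col' ord_max (x *m Q)) < (x *m Q) 0 ord_max]]]]].

Section RobinForm.
Context (R : realType) (n : nat) (Omega : set 'rV[R]_n).
Local Notation V := ('rV[R]_n).
Local Notation Cl := (clifford R n).
Local Notation leb := (@lebesgue_rV R n).
Variables (a : 'I_n -> V -> R) (b : V -> R) (tau : H1 Omega -> V -> Cl).

Definition coef_min : \bar R :=
  \big[Order.min/+oo%E]_(i < n) ereal_inf [set (a i x)%:E | x in Omega].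

Definition coef_max : \bar R :=
  ((\sum_(i < n) Lpnorm leb Omega +oo (a i) ^+ 2) `^ 2^-1)%E.

Definition coef_max' : \bar R :=
  ((\sum_(i < n) \sum_(j < n)
    Lpnorm leb Omega n%:R%:E (fun x => a j x * partial j (a i) x)%R ^+ 2)
   `^ 2^-1)%E.

Definition Dab (CS : R) : R :=
  CS * fine coef_max' +
  fine (Lpnorm (surface R n) (boundary Omega) +oo (fun x => Num.min (b x) 0))
  * trace_norm tau ^+ 2.

Definition Bcoef (i : 'I_n) (x : V) : Cl :=
  \sum_(j < n) (a j x * partial j (a i) x) *: cgen R j.

Definition qR (s : Cl) (u v : H1 Omega) : Cl :=
  \sum_(i < n) L2inner leb Omega (H1grad u i)
    (fun x => (a i x ^+ 2) *: H1grad v i x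
              + ((2 * Sc s * a i x)%:A - Bcoef i x) * cgen R i * v x)
  + (cnorm s ^+ 2) *: L2inner leb Omega u v
  + L2inner (surface R n) (boundary Omega) (fun x => b x *: tau u x) (tau v).

End RobinForm.

(* Main.v *)
Require Import Defs.
From HB Require Import structures.
From mathcomp Require Import all_boot all_order all_algebra.
From mathcomp Require Import all_classical all_reals all_analysis.
From mathcomp Require Import measurable_realfun ess_sup_inf.
From mathcomp Require Import lra ring.
Set Implicit Arguments.
Unset Strict Implicit.
Unset Printing Implicit Defensive.
Import Order.TTheory GRing.Theory Num.Theory.
Import numFieldNormedType.Exports.

(** The Clifford-valued problem is a real one in disguise.  For a basis element
    [e_A], the coordinate of [q(u, v)] along [e_A] is, up to a sign, the scalar
    part of [q(u, v e_A)] ([qR_coef]), and the same holds for [<f, v>].  As [v e_A]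
    runs through H1 together with [v], it is enough to solve
    [Sc q(u, v) = Sc <f, v>] for all [v].  The left-hand side is a real bilinear
    form on H1, which is a complete real inner product space ([H1ip_complete]),
    so the Lax-Milgram theorem ([lax_milgram]) gives [u] once the form is bounded
    and coercive.

    Coercivity ([robin_coercive]) carries the constants.  Put [g = ||u||_D],
    [l = ||u||] and [h^2 = g^2 + l^2].  The principal part is at least
    [m_a^2 g^2].  Since [|e_i u| = |u|], the term with [s_0] is at most
    [2 |s_0| M_a g l], by the Cauchy-Schwarz inequality in [L^2] and in the index [i].
    For the coefficients [B_i], left multiplication by a vector scales the pointwise
    norm by the length of the vector ([cdot_vector_mul]); so Hoelder's inequality
    with exponents n/2 and n/(n-2) and the Sobolev inequality bound that term by
    [C_S M_a' g h <= C_S M_a' h^2] ([L2_sobolev_mul], [singular_L2]).  The boundary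
    term is at least [- ||min(b,0)|| ||tau||^2 h^2].  Altogether, with [D = D_(a,b)],
      [Sc q(u, u) >= (m_a^2 - D) g^2 - 2 |s_0| M_a g l + (|s|^2 - D) l^2],
    and a quadratic form in (g, l) is bounded below by its smaller eigenvalue
    ([min_eigen_le], [garding_inequality]).  That eigenvalue [lambda] is half the
    denominator of the claimed bound, and the condition on [s] says that the
    determinant of the form is positive, hence that [lambda > 0].  Finally
    [lambda h^2 <= Sc q(u, u) = Sc <f, u> <= ||f|| h] is the norm bound, and with
    [f = 0] it is uniqueness.

    Lebesgue and surface measure are obtained by Caratheodory's construction from
    covers by boxes and by sets of small diameter, so measurability of open and
    closed sets is a theorem.  In both cases half-spaces are measurable, because they
    cut a box into two boxes ([lebesgue_halfspace]), respectively because
    Hausdorff measure is additive on sets at positive distance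
    ([hausdorff_halfspace]), and half-spaces generate the Borel sets. *)

Local Open Scope classical_set_scope.
Local Open Scope ring_scope.

(** * Complete inner product spaces and the Lax-Milgram theorem *)

Section LaxMilgram.
Context (R : realType) (H : lmodType R).
Implicit Types (u v w : H) (c : R).

(** Vectors of length zero are allowed: functions that agree almost everywhere are
    not identified, so the inner products below only separate points up to that. *)
Record semi_inner (ip : H -> H -> R) : Prop := {
  ipC : forall u v, ip u v = ip v u;
  ipP : forall c u v w, ip (c *: u + v) w = c * ip u w + ip v w;
  ip_ge0 : forall u, 0 <= ip u u }.

Definition complete_inner (ip : H -> H -> R) : Prop := forall u : nat -> H,
  (forall e, 0 < e -> exists N, forall i j, (N <= i)%N -> (N <= j)%N ->
     ip (u i - u j) (u i - u j) <= e) ->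
  exists l, forall e, 0 < e -> exists N, forall i, (N <= i)%N ->
     ip (l - u i) (l - u i) <= e.

Section Basic.
Variable ip : H -> H -> R.
Hypothesis ipH : semi_inner ip.

Definition hnorm u := Num.sqrt (ip u u).

Lemma ipDl u v w : ip (u + v) w = ip u w + ip v w.
Proof. by rewrite -[u]scale1r (ipP ipH) mul1r scale1r. Qed.

Lemma ip0l w : ip 0 w = 0.
Proof. by apply: (addrI (ip 0 w)); rewrite -ipDl !addr0. Qed.

Lemma ipZl c u w : ip (c *: u) w = c * ip u w.
Proof. by rewrite -[c *: u]addr0 (ipP ipH) ip0l addr0. Qed.

Lemma ipDr u v w : ip w (u + v) = ip w u + ip w v.
Proof. by rewrite ![ip w _](ipC ipH) ipDl. Qed.

Lemma ipZr c u w : ip w (c *: u) = c * ip w u.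
Proof. by rewrite ![ip w _](ipC ipH) ipZl. Qed.

Lemma ipNl u w : ip (- u) w = - ip u w.
Proof. by rewrite -scaleN1r ipZl mulN1r. Qed.

Lemma ipNr u w : ip w (- u) = - ip w u.
Proof. by rewrite -scaleN1r ipZr mulN1r. Qed.

Lemma hnorm_ge0 u : 0 <= hnorm u. Proof. exact: sqrtr_ge0. Qed.

Lemma hnorm_sqr u : hnorm u ^+ 2 = ip u u.
Proof. by rewrite sqr_sqrtr ?(ip_ge0 ipH). Qed.

Lemma quadratic_ge0_discr (p q r : R) : 0 <= p ->
  (forall t, 0 <= p * t ^+ 2 + 2 * q * t + r) -> q ^+ 2 <= p * r.
Proof.
move=> p0 h; have [p_eq|p_neq] := eqVneq p 0.
  have [q_eq|q_neq] := eqVneq q 0.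
    by rewrite q_eq p_eq mul0r expr0n.
  have := h (- (r + 1) / (2 * q)); rewrite p_eq mul0r add0r.
  rewrite (_ : 2 * q * _ = - (r + 1)); first by lra.
  by field.
have pp : 0 < p by rewrite lt_def p_neq.
have := h (- q / p).
rewrite (_ : _ + r = (p * r - q ^+ 2) / p); last by field.
by rewrite pmulr_lge0 ?invr_gt0 // subr_ge0.
Qed.

Lemma ip_sqr_le u v : ip u v ^+ 2 <= ip u u * ip v v.
Proof.
rewrite mulrC; apply: quadratic_ge0_discr => [|t]; first exact: (ip_ge0 ipH).
have := ip_ge0 ipH (u + t *: v).
by rewrite !(ipDl, ipDr, ipZl, ipZr) (ipC ipH v u); lra.
Qed.

Lemma ip_le_hnorm u v : `|ip u v| <= hnorm u * hnorm v.
Proof.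
rewrite -sqrtrM ?(ip_ge0 ipH) // -sqrtr_sqr ler_wsqrtr //; exact: ip_sqr_le.
Qed.

Lemma hnormZ c u : hnorm (c *: u) = `|c| * hnorm u.
Proof.
by rewrite /hnorm ipZl ipZr mulrA -expr2 sqrtrM ?sqr_ge0 // sqrtr_sqr.
Qed.

End Basic.

(** The functional [J v = <v, v> - 2 F v] is bounded below, and the parallelogram
    identity makes every minimising sequence a Cauchy sequence.  At its limit the
    derivative of [J], which is twice [<u, v> - F v], vanishes in every direction [v]. *)
Lemma riesz (ip : H -> H -> R) (ipH : semi_inner ip)
    (ip_complete : complete_inner ip) (F : H -> R) (K : R) :
  (forall c u v, F (c *: u + v) = c * F u + F v) ->
  (forall v, `|F v| <= K * hnorm ip v) ->
  exists u, forall v, ip u v = F v.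
Proof.
move=> Flin Fbd.
have FD u v : F (u + v) = F u + F v.
  by have := Flin 1 u v; rewrite scale1r mul1r.
have F0 : F 0 = 0 by apply: (addrI (F 0)); rewrite -FD !addr0.
have FZ c u : F (c *: u) = c * F u.
  by have := Flin c u 0; rewrite F0 !addr0.
pose J v := ip v v - 2 * F v.
have Jlb v : - K ^+ 2 <= J v.
  have := Fbd v; rewrite ler_norml => /andP[_ Fv].
  have := sqr_ge0 (K - hnorm ip v).
  by rewrite /J sqrrB hnorm_sqr //; lra.
have Jinf : has_inf (range J).
  by split; [exists (J 0), 0 | exists (- K ^+ 2) => _ [v _ <-]].
pose m := inf (range J).
have mJ v : m <= J v by apply: ge_inf; [case: Jinf | exists v].
have /choice [v_ Jv] : forall k, exists v, J v < m + k.+1%:R^-1.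
  move=> k; have /(inf_adherent)/(_ Jinf)[_ [v _ <-] Jv] : 0 < k.+1%:R^-1 :> R.
    by rewrite invr_gt0.
  by exists v.
(* The derivative of J is small where J is close to its infimum. *)
have grad k w : (ip (v_ k) w - F w) ^+ 2 <= ip w w * (J (v_ k) - m).
  apply: quadratic_ge0_discr => [|t]; first exact: (ip_ge0 ipH).
  have := mJ (v_ k + t *: w).
  rewrite /J !(ipDl ipH, ipDr ipH, ipZl ipH, ipZr ipH) (ipC ipH w) FD FZ; lra.
have par i j : ip (v_ i - v_ j) (v_ i - v_ j) <=
    2 * (J (v_ i) - m) + 2 * (J (v_ j) - m).
  have := mJ (2^-1 *: (v_ i + v_ j)).
  rewrite /J !(ipDl ipH, ipDr ipH, ipZl ipH, ipZr ipH, ipNl ipH, ipNr ipH).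
  rewrite (ipC ipH (v_ j) (v_ i)) FZ FD; lra.
have small e : 0 < e -> exists N, forall i, (N <= i)%N -> J (v_ i) - m <= e.
  move=> e0; have [N _ Ne] := near_infty_natSinv_lt (PosNum e0).
  exists N => i Ni; have h1 := Jv i; have h2 : i.+1%:R^-1 < e := Ne i Ni.
  move: h1 h2; move: (i.+1%:R^-1) (J (v_ i)) => x y; lra.
have [|l lim] := ip_complete v_.
  move=> e e0; have [N Ne] := small (e / 4) ltac:(lra).
  exists N => i j /Ne Ji /Ne Jj; have := par i j; lra.
exists l => w; apply/eqP; rewrite -subr_eq0 -sqrf_eq0 eq_le sqr_ge0 andbT.
apply/ler_addgt0Pr => e e0; rewrite add0r.
have W0 : 0 <= ip w w := ip_ge0 ipH w.
pose d := e / (4 * (ip w w + 1)).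
have d0 : 0 < d by rewrite divr_gt0 // mulr_gt0 // ltr_wpDl.
have [N Nd] := small d d0; have [i li] := lim d d0.
pose k := maxn N i.
have h1 := le_trans (grad k w) (ler_wpM2l W0 (Nd k (leq_maxl _ _))).
have h2 := le_trans (ip_sqr_le ipH (l - v_ k) w)
  (ler_wpM2r W0 (li k (leq_maxr _ _))).
move: h1 h2; rewrite ipDl // ipNl //.
have wd : ip w w * d <= e / 4.
  have : (ip w w + 1) * d = e / 4 by rewrite /d; field; rewrite gt_eqF // ltr_wpDl.
  lra.
have := sqr_ge0 ((ip l w - ip (v_ k) w) - (ip (v_ k) w - F w)); nra.
Qed.

(** Let [A] and [g] represent the form and the functional.  The damped iteration
    [u - rho (A u - g)] multiplies the squared length of the residual [A u - g] by at
    most [q < 1], and coercivity turns small residuals at two points into a small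
    distance between the points; so the iterates converge, to a zero of the residual. *)
Theorem lax_milgram (ip : H -> H -> R) (ipH : semi_inner ip)
    (ip_complete : complete_inner ip)
    (B : H -> H -> R) (F : H -> R) (alpha C K : R) :
  (forall c u v w, B (c *: u + v) w = c * B u w + B v w) ->
  (forall c u v w, B w (c *: u + v) = c * B w u + B w v) ->
  (forall u v, `|B u v| <= C * hnorm ip u * hnorm ip v) ->
  0 < alpha -> (forall u, alpha * ip u u <= B u u) ->
  (forall c u v, F (c *: u + v) = c * F u + F v) ->
  (forall v, `|F v| <= K * hnorm ip v) ->
  exists u, forall v, B u v = F v.
Proof.
move=> Bl Br Bbd alpha0 Bco Flin Fbd.
wlog aC : C Bbd / alpha <= C.
  move=> /(_ (Num.max C alpha)); apply; last by rewrite le_max lexx orbT.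
  move=> u v; apply: le_trans (Bbd u v) _.
  by rewrite !ler_wpM2r ?hnorm_ge0 // le_max lexx.
have C0 : 0 < C := lt_le_trans alpha0 aC.
have BD u v w : B (u + v) w = B u w + B v w.
  by have := Bl 1 u v w; rewrite scale1r mul1r.
have B0 w : B 0 w = 0 by apply: (addrI (B 0 w)); rewrite -BD !addr0.
have BZ c u w : B (c *: u) w = c * B u w.
  by have := Bl c u 0 w; rewrite B0 !addr0.
have BN u w : B (- u) w = - B u w by rewrite -scaleN1r BZ mulN1r.
(* The representing vector is only determined up to length zero, so [A] need not be
   linear; its linearity is only used inside inner products, where it holds. *)
have /choice [A A_E] : forall u, exists r, forall v, ip r v = B u v.
  by move=> u; apply: (riesz ipH ip_complete (K := C * hnorm ip u)).
have [g gE] := riesz ipH ip_complete Flin Fbd.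
have A_bd u : ip (A u) (A u) <= C ^+ 2 * ip u u.
  have [->|Au] := eqVneq (ip (A u) (A u)) 0.
    by rewrite mulr_ge0 ?sqr_ge0 ?(ip_ge0 ipH).
  have Au0 : 0 < hnorm ip (A u) by rewrite sqrtr_gt0 lt_def Au (ip_ge0 ipH).
  have := Bbd u (A u); rewrite -A_E ger0_norm ?(ip_ge0 ipH) // -[X in X <= _]hnorm_sqr //.
  rewrite expr2 ler_pM2r // => h.
  rewrite -!hnorm_sqr // -exprMn ler_sqr ?nnegrE ?mulr_ge0 ?hnorm_ge0 //; lra.
(* The step that minimises the bound [1 - 2 rho alpha + rho^2 C^2] on the contraction
   factor. *)
pose rho := alpha / C ^+ 2.
pose q := 1 - alpha * rho.
pose T u := u - rho *: (A u - g).
pose res u := ip (A u - g) (A u - g).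
have C2 : 0 < C ^+ 2 by rewrite exprn_gt0.
have q0 : 0 <= q.
  rewrite /q /rho subr_ge0 mulrA -expr2 ler_pdivrMr // mul1r.
  by rewrite ler_sqr ?nnegrE ?(ltW C0) ?(ltW alpha0).
have q1 : q < 1 by rewrite /q ltrBlDr ltrDl mulr_gt0 // divr_gt0.
have resT u : res (T u) <= q * res u.
  pose r := A u - g.
  have E w : ip (A (T u) - g) w = ip (r - rho *: A r) w.
    rewrite !(ipDl ipH, ipNl ipH, ipZl ipH) !A_E /T.
    by rewrite BD BN BZ addrAC.
  have -> : res (T u) = ip (r - rho *: A r) (r - rho *: A r).
    by rewrite /res E (ipC ipH) E.
  rewrite -[res u]/(ip r r); move: r {E} => r.
  rewrite !(ipDl ipH, ipDr ipH, ipNl ipH, ipNr ipH, ipZl ipH, ipZr ipH).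
  rewrite (ipC ipH r (A r)) A_E.
  have h1 := A_bd r; have h2 := Bco r.
  have rho0 : 0 < rho by rewrite divr_gt0.
  have rhoC : rho * C ^+ 2 = alpha by rewrite /rho mulfVK // gt_eqF.
  have h3 : rho * (rho * ip (A r) (A r)) <= rho * (alpha * ip r r).
    by rewrite ler_pM2l // -rhoC -mulrA ler_pM2l.
  have h4 : rho * (alpha * ip r r) <= rho * B r r by rewrite ler_pM2l.
  rewrite /q; lra.
pose u_ k := iter k T 0.
have resu k : res (u_ k) <= q ^+ k * res 0.
  elim: k => [|k IH]; first by rewrite expr0 mul1r.
  by apply: le_trans (resT _) _; rewrite exprS -mulrA ler_wpM2l.
have res_small e : 0 < e -> exists N, forall k, (N <= k)%N -> res (u_ k) <= e.
  move=> e0; have : (fun k => q ^+ k * res 0) @ \oo --> 0 * res 0.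
    by apply: cvgMl; apply: cvg_expr; rewrite ger0_norm.
  rewrite mul0r => /cvgrPdist_le /(_ e e0)[N _ Ne].
  exists N => k /Ne /=; rewrite sub0r normrN ger0_norm ?mulr_ge0 ?exprn_ge0 ?(ip_ge0 ipH) //.
  exact: le_trans (resu k).
have cau i j : alpha ^+ 2 * ip (u_ i - u_ j) (u_ i - u_ j) <=
    2 * res (u_ i) + 2 * res (u_ j).
  set d := u_ i - u_ j; set r := (A (u_ i) - g) - (A (u_ j) - g).
  have Bd : B d d = ip r d.
    by rewrite /r !(ipDl ipH, ipNl ipH) !A_E /d BD BN; ring.
  have h1 : alpha * ip d d <= ip r d by rewrite -Bd.
  have h2 := ip_sqr_le ipH r d.
  have h3 : ip r r <= 2 * res (u_ i) + 2 * res (u_ j).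
    have := ip_ge0 ipH ((A (u_ i) - g) + (A (u_ j) - g)).
    rewrite /r /res; move: (A (u_ i) - g) (A (u_ j) - g) => x y.
    by rewrite !(ipDl ipH, ipDr ipH, ipNl ipH, ipNr ipH); lra.
  apply: le_trans _ h3.
  have [->|dn] := eqVneq (ip d d) 0; first by rewrite mulr0 (ip_ge0 ipH).
  have d0 : 0 < ip d d by rewrite lt_def dn (ip_ge0 ipH).
  rewrite -(ler_pM2r d0); apply: le_trans h2.
  rewrite -mulrA -expr2 -exprMn ler_sqr ?nnegrE ?mulr_ge0 ?(ltW alpha0) ?(ltW d0) //.
  by apply: le_trans h1; rewrite mulr_ge0 ?(ltW alpha0) ?(ltW d0).
have a2 : 0 < alpha ^+ 2 by rewrite exprn_gt0.
have [|l lim] := ip_complete u_.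
  move=> e e0.
  have [N Ne] := res_small (alpha ^+ 2 * e / 4) ltac:(by rewrite divr_gt0 // mulr_gt0).
  exists N => i j /Ne ri /Ne rj; rewrite -(ler_pM2l a2).
  have := cau i j; lra.
exists l => v; rewrite -A_E -gE; apply/eqP; rewrite -subr_eq0 -ipNl // -ipDl //.
rewrite -sqrf_eq0 eq_le sqr_ge0 andbT.
apply: le_trans (ip_sqr_le ipH _ _) _.
suff -> : ip (A l - g) (A l - g) = 0 by rewrite mul0r.
apply/eqP; rewrite eq_le (ip_ge0 ipH) andbT.
apply/ler_addgt0Pr => e e0; rewrite add0r.
pose e' := e / (4 * C ^+ 2).
have e'0 : 0 < e' by rewrite divr_gt0 // mulr_gt0.
have [N Nd] := res_small (e / 4) ltac:(lra); have [i li] := lim e' e'0.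
pose k := maxn N i.
have h1 := Nd k (leq_maxl _ _).
have h2 := A_bd (l - u_ k).
have h3 : C ^+ 2 * ip (l - u_ k) (l - u_ k) <= e / 4.
  apply: le_trans (ler_wpM2l (ltW C2) (li k (leq_maxr _ _))) _.
  rewrite /e' mulrCA -[X in _ <= X]mulr1 -mulrA ler_pM2l //.
  by rewrite invfM [X in _ * X]mulrC mulVKf // ?gt_eqF // mulr1.
have E w : ip (A l - g) w = ip (A (l - u_ k) + (A (u_ k) - g)) w.
  by rewrite !(ipDl ipH, ipNl ipH) !A_E BD BN; ring.
rewrite E (ipC ipH) E.
have h4 := ip_ge0 ipH (A (l - u_ k) - (A (u_ k) - g)).
move: h1 (le_trans h2 h3) h4; rewrite /res; move: (A (l - u_ k)) (A (u_ k) - g) => x y.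
rewrite !(ipDl ipH, ipDr ipH, ipNl ipH, ipNr ipH); lra.
Qed.

End LaxMilgram.

(** * Square integrable real functions *)

Section SquareIntegrable.
Context (R : realType) d (T : measurableType d).
Variables (mu : {measure set T -> \bar R}) (D : set T).
Hypothesis mD : measurable D.
Implicit Types (f g h : T -> R) (c : R).

Definition sqint f :=
  measurable_fun D f /\ (\int[mu]_(x in D) (f x ^+ 2)%:E < +oo)%E.

(** The [L^2] inner product, to be read on functions satisfying [sqint]. *)
Definition sqip f g : R := \int[mu]_(x in D) (f x * g x).

Lemma sqint_integrable f : sqint f -> mu.-integrable D (EFin \o (fun x => f x ^+ 2)).
Proof.
move=> [mf fi]; apply/integrableP; split.
  by apply/measurable_EFinP; exact: measurable_funX.
by under eq_integral do rewrite /= ger0_norm ?sqr_ge0 //.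
Qed.

Lemma integrable_sqint f : measurable_fun D f ->
  mu.-integrable D (EFin \o (fun x => f x ^+ 2)) -> sqint f.
Proof.
move=> mf /integrableP[_ fi]; split=> //; move: fi.
by under eq_integral do rewrite /= ger0_norm ?sqr_ge0 //.
Qed.

Lemma sqint_bound f g : measurable_fun D f ->
  mu.-integrable D (EFin \o g) -> (forall x, D x -> f x ^+ 2 <= g x) -> sqint f.
Proof.
move=> mf gi fg; apply: integrable_sqint => //.
apply: le_integrable gi => //.
  by apply/measurable_EFinP; exact: measurable_funX.
move=> x Dx; rewrite /= !lee_fin ger0_norm ?sqr_ge0 //.
by apply: le_trans (fg _ Dx) (ler_norm _).
Qed.

Lemma sqint_mul f g : sqint f -> sqint g ->
  mu.-integrable D (EFin \o (fun x => f x * g x)).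
Proof.
move=> f2 g2; have := integrableD mD (sqint_integrable f2) (sqint_integrable g2).
apply: le_integrable => //.
  by apply/measurable_EFinP; apply: measurable_funM; [case: f2|case: g2].
move=> x Dx; rewrite /= lee_fin [leRHS]ger0_norm ?addr_ge0 ?sqr_ge0 //.
rewrite ler_norml; apply/andP; split.
  have := sqr_ge0 (f x + g x); have := sqr_ge0 (f x); have := sqr_ge0 (g x); lra.
have := sqr_ge0 (f x - g x); have := sqr_ge0 (f x); have := sqr_ge0 (g x); lra.
Qed.

Lemma sqintP c f g : sqint f -> sqint g -> sqint (fun x => c * f x + g x).
Proof.
move=> f2 g2.
have := integrableD mD (integrableZl mD (2 * c ^+ 2) (sqint_integrable f2))
  (integrableZl mD 2 (sqint_integrable g2)).
move=> /(@sqint_bound _ (fun x => 2 * c ^+ 2 * f x ^+ 2 + 2 * g x ^+ 2)); apply.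
  apply: measurable_funD; last by case: g2.
  by apply: measurable_funM => //; case: f2.
move=> x _; have := sqr_ge0 (c * f x - g x); rewrite -subr_ge0 => h.
by rewrite -subr_ge0; apply: le_trans h _; lra.
Qed.

Lemma sqint0 : sqint (fun=> 0).
Proof.
split=> //; under eq_integral do rewrite expr0n.
by rewrite integral0.
Qed.

Lemma sqintZ c f : sqint f -> sqint (fun x => c * f x).
Proof.
move=> f2; have := sqintP c f2 sqint0.
by under [X in sqint X]eq_fun do rewrite addr0.
Qed.

Lemma sqintD f g : sqint f -> sqint g -> sqint (fun x => f x + g x).
Proof.
move=> f2 g2; have := sqintP 1 f2 g2.
by under [X in sqint X]eq_fun do rewrite mul1r.
Qed.

Lemma sqintB f g : sqint f -> sqint g -> sqint (fun x => f x - g x).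
Proof.
move=> f2 g2; have := sqintD f2 (sqintZ (-1) g2).
by under [X in sqint X]eq_fun do rewrite mulN1r.
Qed.

Lemma eq_sqint f g : {in D, f =1 g} -> sqint f -> sqint g.
Proof.
move=> fg [mf fi]; split; first exact: eq_measurable_fun mf.
rewrite (eq_integral (fun x => (f x ^+ 2)%:E)) // => x Dx.
by rewrite -fg.
Qed.

Lemma sqipC f g : sqip f g = sqip g f.
Proof. by rewrite /sqip; under eq_fun do rewrite mulrC. Qed.

Lemma sqipP c f g h : sqint f -> sqint g -> sqint h ->
  sqip (fun x => c * f x + g x) h = c * sqip f h + sqip g h.
Proof.
move=> f2 g2 h2; rewrite /sqip -RintegralZl //; last exact: sqint_mul.
rewrite -RintegralD //; [|have := integrableZl mD c (sqint_mul f2 h2)|exact: sqint_mul].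
  by congr Rintegral; apply/funext => x; rewrite mulrDl mulrA.
by apply: eq_integrable.
Qed.

Lemma sqipPr c f g h : sqint f -> sqint g -> sqint h ->
  sqip h (fun x => c * f x + g x) = c * sqip h f + sqip h g.
Proof. by move=> f2 g2 h2; rewrite ![sqip h _]sqipC sqipP. Qed.

Lemma sqip_ge0 f : 0 <= sqip f f.
Proof. by apply: Rintegral_ge0 => x _; rewrite -expr2 sqr_ge0. Qed.

Lemma sqipE f : sqint f -> ((sqip f f)%:E = \int[mu]_(x in D) (f x ^+ 2)%:E)%E.
Proof.
move=> f2; rewrite /sqip /Rintegral fineK; last exact: integrable_fin_num (sqint_mul f2 f2).
by apply: eq_integral => x _; rewrite expr2.
Qed.

Lemma sqip_sqr_le f g : sqint f -> sqint g -> sqip f g ^+ 2 <= sqip f f * sqip g g.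
Proof.
move=> f2 g2; rewrite mulrC; apply: quadratic_ge0_discr => [|t].
  exact: sqip_ge0.
have := sqip_ge0 (fun x => t * g x + f x).
rewrite sqipP //; last exact: sqintP.
rewrite [X in t * X + _]sqipC [X in _ + X]sqipC !sqipP // (sqipC f g); lra.
Qed.

Lemma ae_eq_sqip f f' g g' : measurable_fun D f -> measurable_fun D f' ->
    measurable_fun D g -> measurable_fun D g' ->
  {ae mu, forall x, D x -> f x = f' x} -> {ae mu, forall x, D x -> g x = g' x} ->
  sqip f g = sqip f' g'.
Proof.
move=> mf mf' mg mg' ff gg; rewrite /sqip /Rintegral; congr fine.
apply: ae_eq_integral => //.
- by apply/measurable_EFinP; exact: measurable_funM.
- by apply/measurable_EFinP; exact: measurable_funM.
by apply: filterS2 ff gg => x fx gx Dx; rewrite fx // gx.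
Qed.

Lemma sqip_eq0 f : sqint f -> sqip f f = 0 -> {ae mu, forall x, D x -> f x = 0}.
Proof.
move=> f2 f0; have [mf _] := f2.
have : (\int[mu]_(x in D) `|(f x ^+ 2)%:E| = 0)%E.
  rewrite -[RHS]/(0%:E) -f0 sqipE //; apply: eq_integral => x _.
  by rewrite gee0_abs // lee_fin sqr_ge0.
move/ae_eq_integral_abs => /(_ mD) h.
have {h} : ae_eq mu D (fun x => (f x ^+ 2)%:E) (cst 0%E).
  by apply: h; apply/measurable_EFinP; exact: measurable_funX.
by apply: filterS => x /= h /h [] /eqP; rewrite sqrf_eq0 => /eqP.
Qed.

Lemma sqint_bounded_mul (K : R) (m f : T -> R) :
  measurable_fun D m -> sqint f -> {ae mu, forall x, D x -> `|m x| <= K} ->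
  sqint (fun x => m x * f x) /\
  sqip (fun x => m x * f x) (fun x => m x * f x) <= K ^+ 2 * sqip f f.
Proof.
move=> mm f2 mK; have [mf fi] := f2.
have mmf : measurable_fun D (fun x => m x * f x) by exact: measurable_funM.
have h : (\int[mu]_(x in D) ((m x * f x) ^+ 2)%:E <=
    (K ^+ 2)%:E * \int[mu]_(x in D) (f x ^+ 2)%:E)%E.
  rewrite -ge0_integralZl_EFin ?sqr_ge0 //; last 2 first.
  - by move=> x _; rewrite lee_fin sqr_ge0.
  - by apply/measurable_EFinP; exact: measurable_funX.
  apply: ae_ge0_le_integral => //.
  - by move=> x _; rewrite lee_fin sqr_ge0.
  - by apply/measurable_EFinP; exact: measurable_funX.
  - by move=> x _; rewrite -EFinM lee_fin mulr_ge0 ?sqr_ge0.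
  - apply/measurable_EFinP; apply: measurable_funM => //.
    exact: measurable_funX.
  apply: filterS mK => x mx Dx; rewrite -EFinM lee_fin exprMn ler_wpM2r ?sqr_ge0 //.
  by rewrite -real_normK ?num_real // ler_sqr ?nnegrE ?mx // (le_trans _ (mx Dx)).
have mf2 : sqint (fun x => m x * f x).
  split=> //; apply: le_lt_trans h _.
  by rewrite -sqipE // -EFinM ltry.
by split=> //; rewrite -lee_fin EFinM !sqipE.
Qed.

End SquareIntegrable.

(** * Completeness of the space of square integrable functions *)

Section RieszFischer.
Context (R : realType) d (T : measurableType d).
Variables (mu : {measure set T -> \bar R}) (D : set T).
Hypothesis mD : measurable D.
Local Notation sqint := (sqint mu D).
Local Notation sqip := (sqip mu D).

(** The increments are at most a constant times 2^-j, so they sum absolutely. *)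
Lemma cvgn_fast_increments (u : R^nat) (C : R) :
  (forall j, 4 ^+ j * (u j.+1 - u j) ^+ 2 <= C) -> cvgn u.
Proof.
move=> uC.
have C0 : 0 <= C by apply: le_trans (uC 0%N); rewrite mul1r sqr_ge0.
have uE : u = (fun j => u 0%N + series (telescope u) j).
  by apply/funext => j; rewrite -eq_sum_telescope.
rewrite uE; apply: is_cvgD; first exact: is_cvg_cst.
apply: normed_cvg.
apply: (@series_le_cvg _ _ (geometric (Num.sqrt C) 2^-1)).
- by move=> j /=; rewrite normr_ge0.
- by move=> j; apply: geometric_ge0; rewrite ?sqrtr_ge0 ?invr_ge0.
- move=> j /=; rewrite /telescope /=.
  rewrite -ler_pdivrMr ?exprn_gt0 ?invr_gt0 // -[leLHS]ger0_norm; last first.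
    by rewrite mulr_ge0 // invr_ge0 exprn_ge0 // invr_ge0.
  rewrite -sqrtr_sqr ler_wsqrtr //; apply: le_trans (uC j).
  by rewrite exprMn real_normK ?num_real // mulrC -exprVn invrK -exprM mulnC exprM expr2 -natrM.
- by apply: is_cvg_geometric_series; rewrite ger0_norm ?invr_ge0 // invf_lt1 ?ltr1n.
Qed.

Lemma limn_einf_le_near (u : (\bar R)^nat) (e : \bar R) :
  (\forall j \near \oo, (u j <= e)%E) -> (limn_einf u <= e)%E.
Proof.
move=> [N _ Ne]; rewrite limn_einf_lim; apply: lime_le; first exact: is_cvg_einfs.
exists N => // j /= Nj; apply: le_trans (Ne j Nj).
by apply: ereal_inf_lbound; exists j => //=.
Qed.

(** The Riesz-Fischer theorem.  Along a subsequence with squared increments at most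
    8^-j the sum of the squared increments weighted by 4^j is integrable, hence finite
    almost everywhere, and there the subsequence converges.  Weighting squares in this
    way replaces the use of Minkowski's inequality for infinite sums.  By Fatou's lemma
    the limit is close in [L^2] to every late member of the sequence. *)
Theorem sqint_complete (f_ : nat -> T -> R) :
  (forall i, sqint (f_ i)) ->
  (forall e, 0 < e -> exists N, forall i j, (N <= i)%N -> (N <= j)%N ->
    sqip (fun x => f_ i x - f_ j x) (fun x => f_ i x - f_ j x) <= e) ->
  exists l, sqint l /\ forall e, 0 < e -> exists N, forall i, (N <= i)%N ->
    sqip (fun x => l x - f_ i x) (fun x => l x - f_ i x) <= e.
Proof.
move=> f2 cau.
have mf i : measurable_fun D (f_ i) by case: (f2 i).
have /choice [N_ N_P] : forall j, exists N, forall i i', (N <= i)%N -> (N <= i')%N ->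
    sqip (fun x => f_ i x - f_ i' x) (fun x => f_ i x - f_ i' x) <= (8 ^+ j)^-1.
  by move=> j; apply: cau; rewrite invr_gt0 exprn_gt0.
(* A sum instead of [N_ j] makes the indices increase, and [.+1] makes them unbounded. *)
pose k j := (\sum_(i < j.+1) (N_ i).+1)%N.
have Nk j : (N_ j <= k j)%N by rewrite /k big_ord_recr /= addnS leqW // leq_addl.
have jk j : (j <= k j)%N.
  elim: j => // j IH; rewrite /k big_ord_recr /= addnS ltnS.
  exact: leq_trans (leq_addr _ _).
have kS j : (k j <= k j.+1)%N by rewrite [k j.+1]big_ord_recr leq_addr.
have k_nd i j : (i <= j)%N -> (k i <= k j)%N.
  elim: j => [|j IH]; first by rewrite leqn0 => /eqP ->.
  rewrite leq_eqVlt => /orP[/eqP -> //|]; rewrite ltnS => /IH ij.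
  exact: leq_trans (kS j).
pose dif j x := 4 ^+ j * (f_ (k j.+1) x - f_ (k j) x) ^+ 2.
have mdif j : measurable_fun D (fun x => (dif j x)%:E).
  apply/measurable_EFinP; apply: measurable_funM => //; apply: measurable_funX.
  exact: measurable_funB.
have dif0 j x : 0 <= dif j x by rewrite mulr_ge0 ?sqr_ge0 ?exprn_ge0.
pose S x := (\sum_(j <oo) (dif j x)%:E)%E.
have mS : measurable_fun D S.
  by apply: ge0_emeasurable_sum => // j x _; rewrite lee_fin.
have S0 x : (0 <= S x)%E by apply: nneseries_ge0 => j _ _; rewrite lee_fin.
have Sfin : (\int[mu]_(x in D) S x < +oo)%E.
  rewrite integral_nneseries //; last by move=> j x _; rewrite lee_fin.
  apply: (@le_lt_trans _ _ (\sum_(j <oo) ((2^-1) ^+ j)%:E)%E).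
    apply: lee_nneseries => [j _ _|j _].
      by apply: integral_ge0 => x _; rewrite lee_fin.
    rewrite /dif; under eq_integral do rewrite EFinM.
    rewrite ge0_integralZl_EFin ?exprn_ge0 //; last 2 first.
    - by move=> x _; rewrite lee_fin sqr_ge0.
    - by apply/measurable_EFinP; apply: measurable_funX; exact: measurable_funB.
    rewrite -sqipE //; last exact: sqintB.
    rewrite -EFinM lee_fin; apply: le_trans (ler_wpM2l _ (N_P j _ _ _ _)) _ => //.
      exact: leq_trans (Nk j) (kS j).
    by rewrite -exprVn -exprMn (_ : 4 * 8^-1 = 2^-1) //; field.
  have : series (geometric 1 2^-1) @ \oo --> (1 * (1 - 2^-1)^-1 : R).
    by apply: cvg_geometric_series; rewrite ger0_norm ?invr_ge0 // invf_lt1 ?ltr1n.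
  set g := (X in _ --> X) => gc.
  rewrite (_ : limn _ = g%:E) ?ltry //; apply/cvg_lim => //.
  apply: cvg_EFin; first by apply: nearW => j; rewrite sumEFin.
  move: gc; apply: cvg_trans; apply: near_eq_cvg; apply: nearW => j.
  rewrite /= sumEFin /= seriesEnat /=.
  by apply: eq_bigr => i _; rewrite mul1r.
have Sint : mu.-integrable D S.
  by apply/integrableP; split=> //; under eq_integral do rewrite gee0_abs //.
(* An upper limit is measurable without any convergence. *)
pose l x := fine (limn_esup (fun j => (f_ (k j) x)%:E)).
have ml : measurable_fun D l.
  apply: (measurableT_comp (@fine_measurable _ setT measurableT)).
  by apply: measurable_fun_limn_esup => j; exact/measurable_EFinP.
have lim_ae : {ae mu, forall x, D x -> (fun j => f_ (k j) x) @ \oo --> l x}.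
  apply: filterS (integrable_ae mD Sint) => x Sx Dx.
  have cx : cvgn (fun j => f_ (k j) x).
    apply: (@cvgn_fast_increments _ (fine (S x))) => j.
    rewrite -lee_fin fineK ?Sx // /S.
    rewrite (@nneseriesD1 _ (fun j => (dif j x)%:E) j) //; last by move=> i; rewrite lee_fin.
    by rewrite leeDl // nneseries_ge0 // => i _ _; rewrite lee_fin.
  have lx : l x = limn (fun j => f_ (k j) x).
    have h : (fun j => (f_ (k j) x)%:E) @ \oo --> (limn (fun j => f_ (k j) x))%:E.
      by apply: cvg_EFin; [exact: nearW|exact: cx].
    by rewrite /l; have [_ ->] := cvg_limn_einf_sup h.
  by rewrite lx.
have close e : 0 < e -> exists N, forall i, (N <= i)%N ->
    (\int[mu]_(x in D) ((l x - f_ i x) ^+ 2)%:E <= e%:E)%E.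
  move=> e0; have [N NP] := cau e e0; exists N => i Ni.
  have := @fatou _ _ _ mu D mD (fun j x => ((f_ (k j) x - f_ i x) ^+ 2)%:E).
  move=> /(_ _ _) fat.
  apply: (@le_trans _ _ (\int[mu]_(x in D) limn_einf (fun j => ((f_ (k j) x - f_ i x) ^+ 2)%:E))%E).
    rewrite le_eqVlt; apply/orP; left; apply/eqP; apply: ae_eq_integral => //.
    - by apply/measurable_EFinP; apply: measurable_funX; exact: measurable_funB.
    - apply: measurableT_comp; last first.
        apply: measurable_fun_limn_esup => j.
        apply: measurableT_comp => //; apply/measurable_EFinP.
        by apply: measurable_funX; exact: measurable_funB.
      exact: oppe_measurable.
    apply: filterS lim_ae => x lx /lx cx; apply/esym.
    have h : (fun j => ((f_ (k j) x - f_ i x) ^+ 2)%:E) @ \oo -->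
        ((l x - f_ i x) ^+ 2)%:E.
      apply: cvg_EFin; first exact: nearW.
      rewrite /= expr2; under eq_fun do rewrite /= expr2.
      by apply: cvgM; apply: cvgB => //; exact: cvg_cst.
    by have [] := cvg_limn_einf_sup h.
  apply: le_trans (fat _ _) _.
  - by move=> j; apply/measurable_EFinP; apply: measurable_funX; exact: measurable_funB.
  - by move=> j x _; rewrite lee_fin sqr_ge0.
  apply: limn_einf_le_near; exists N => // j /= Nj.
  rewrite -sqipE //; last exact: sqintB.
  by rewrite lee_fin; apply: NP => //; apply: leq_trans Nj (jk j).
have lf2 i : (exists e, (\int[mu]_(x in D) ((l x - f_ i x) ^+ 2)%:E <= e%:E)%E) ->
    sqint (fun x => l x - f_ i x).
  move=> [e le]; split; first exact: measurable_funB.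
  exact: le_lt_trans le (ltry _).
have [N1 N1P] := close 1 ltr01; exists l; split.
  apply: (@eq_sqint _ _ _ _ _ (fun x => (l x - f_ N1 x) + f_ N1 x)).
    by move=> x _; rewrite subrK.
  by apply: (sqintD mD (lf2 N1 _) (f2 N1)); exists 1; exact: N1P.
move=> e e0; have [N NP] := close e e0; exists N => i Ni.
by rewrite -lee_fin sqipE //; [exact: NP|apply: lf2; exists e; exact: NP].
Qed.
End RieszFischer.

(** * Borel sets are measurable for Lebesgue and Hausdorff measure *)

Section CoverSplit.
Context (R : realType) (T : pointedType).
Local Open Scope ereal_scope.

(** If no covering set loses weight when it is cut along [A] and [B], neither does an
    optimal cover.  For Lebesgue measure [A] and [B] are complementary half-spaces, for
    Hausdorff measure two separated sets. *)
Lemma cover_measure_split (w : set T -> \bar R) (A B X : set T) :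
  (forall F, 0 <= w F) ->
  (forall F, w (F `&` A) + w (F `&` B) <= w F) ->
  cover_measure w (X `&` A) + cover_measure w (X `&` B) <= cover_measure w X.
Proof.
move=> w0 wAB; apply: le_ereal_inf_tmp => _ [F XF <-].
apply: (@le_trans _ _ (\sum_(k <oo) (w (F k `&` A) + w (F k `&` B)))).
  rewrite nneseriesD //; apply: leeD.
  - apply: ereal_inf_lbound; exists (fun k => F k `&` A) => //.
    by move=> x [/XF[k _ Fx] ?]; exists k.
  - apply: ereal_inf_lbound; exists (fun k => F k `&` B) => //.
    by move=> x [/XF[k _ Fx] ?]; exists k.
by apply: lee_nneseries => // k _ _; rewrite adde_ge0.
Qed.

End CoverSplit.

Section LebesgueHalfspace.
Context (R : realType) (n : nat).
Implicit Types (a b : 'rV[R]_n) (i : 'I_n) (c : R).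

Lemma box_weight_box a b : (forall i, a 0 i <= b 0 i) ->
  (box_weight (box a b) <= (\prod_i (b 0 i - a 0 i))%:E)%E.
Proof.
move=> ab; rewrite /box_weight; case: ifP => _.
  by rewrite lee_fin prodr_ge0 // => i _; rewrite subr_ge0.
by apply: ereal_inf_lbound; exists a, b.
Qed.

(** The plane [x_i = c], with [c] clamped to the side [i] of the box, cuts the box into
    two boxes, one of them possibly empty, whose volumes add up. *)
Lemma box_weight_halfspace i c (F : set 'rV[R]_n) :
  (box_weight (F `&` [set x | (x 0 i <= c)%R]) +
   box_weight (F `&` ~` [set x | (x 0 i <= c)%R]) <= box_weight F)%E.
Proof.
rewrite [leRHS]/box_weight; case: ifPn => [/eqP ->|_].
  by rewrite !set0I box_weight0 adde0.
apply: le_ereal_inf_tmp => _ [a [b [ab -> ->]]].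
(* Clamping keeps the sides of both boxes nonnegative when the plane misses the box. *)
pose m := Num.max (a 0 i) (Num.min (b 0 i) c).
pose upd (x : 'rV[R]_n) := \row_j (if j == i then m else x 0 j).
have aim : a 0 i <= m by rewrite le_max lexx.
have mbi : m <= b 0 i by rewrite ge_max ab ge_min lexx.
have -> : box a b `&` [set x | x 0 i <= c] = box a (upd b).
  apply/seteqP; split => x /= => [[xab xc] j|xab].
    rewrite mxE; case: eqP => [->|//]; have /andP[-> xb] := xab i.
    by rewrite le_max le_min xb xc orbT.
  have := xab i; rewrite mxE eqxx le_max => /andP[ax]; rewrite leNgt ax /= le_min.
  move=> /andP[xb xc]; split => // j; have := xab j; rewrite mxE.
  by case: eqP => // -> _; rewrite ax xb.
have -> : box a b `&` ~` [set x | x 0 i <= c] = box (upd a) b.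
  apply/seteqP; split => x /= => [[xab /negP]|xab].
    rewrite -ltNge => cx j; rewrite mxE; case: eqP => [->|//].
    have /andP[ax xb] := xab i; rewrite xb andbT gt_max ax /=.
    by rewrite gt_min cx orbT.
  have := xab i; rewrite mxE eqxx => /andP[]; rewrite gt_max gt_min => /andP[ax].
  move=> mx xb; split => [j|].
    by have := xab j; rewrite mxE; case: eqP => // -> _; rewrite ax xb.
  by apply/negP; rewrite -ltNge; move: mx; rewrite ltNge xb.
apply: le_trans (leeD (box_weight_box _) (box_weight_box _)) _.
- by move=> j; rewrite mxE; case: eqP => // ->.
- by move=> j; rewrite mxE; case: eqP => // ->.
rewrite -EFinD lee_fin (bigD1 i) //= [X in _ + X <= _](bigD1 i) //=.
rewrite [leRHS](bigD1 i) //= !mxE eqxx.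
have E1 : \prod_(j < n | j != i) (upd b 0 j - a 0 j) = \prod_(j < n | j != i) (b 0 j - a 0 j).
  by apply: eq_bigr => j ji; rewrite mxE (negbTE ji).
have E2 : \prod_(j < n | j != i) (b 0 j - upd a 0 j) = \prod_(j < n | j != i) (b 0 j - a 0 j).
  by apply: eq_bigr => j ji; rewrite mxE (negbTE ji).
by rewrite E1 E2 -mulrDl addrC subrKA lexx.
Qed.

Lemma lebesgue_halfspace i c :
  (@lebesgue_outer R n).-caratheodory [set x | x 0 i <= c].
Proof.
apply: (@le_caratheodory_measurable _ _ (@lebesgue_outer R n)) => X.
apply: cover_measure_split; first exact: box_weight_ge0.
exact: box_weight_halfspace.
Qed.

Lemma lebesgue_outer_box_lty a b : (@lebesgue_outer R n (box a b) < +oo)%E.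
Proof.
have [ab|] := pselect (forall i, a 0 i <= b 0 i); last first.
  move/existsNP => [i /negP]; rewrite -ltNge => ba.
  rewrite (_ : box a b = set0) ?outer_measure0 //.
  by apply/seteqP; split => // x /(_ i) /andP[/lt_le_trans h /h]; rewrite (lt_gtF ba).
apply: (@le_lt_trans _ _ (\prod_i (b 0 i - a 0 i))%:E); last exact: ltry.
apply: le_trans (box_weight_box ab).
apply: ereal_inf_lbound; exists (fun k : nat => if k == 0%N then box a b else set0).
  by move=> x bx; exists 0%N.
rewrite (nneseriesD1 (n := 0%N)) // => [|k _]; last exact: box_weight_ge0.
rewrite eseries0 ?adde0 // => -[//|k] _ _; exact: box_weight0.
Qed.

End LebesgueHalfspace.

Section MetricOuterMeasure.
Context (R : realType) (T : Type) (mu : {outer_measure set T -> \bar R}).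
Local Open Scope ereal_scope.

(** Caratheodory's criterion, for the sublevel sets of one function [g] instead of a
    distance.  The part [U k] of [X] where [g > c + 1/(k+1)] is separated from the part
    where [g <= c], so only the rings [U (k+1) \ U k] can cause a defect.  The
    ring [U (k+2) \ U (k+1)] is separated from [U k], so the measures of the rings
    form a convergent series, whose tails tend to zero. *)
Lemma separated_caratheodory (g : T -> R) (c : R) :
  (forall (A B : set T) (delta : R), (0 < delta)%R ->
     (forall x y, A x -> B y -> (g x + delta <= g y)%R) ->
     mu A + mu B <= mu (A `|` B)) ->
  mu.-caratheodory [set x | (g x <= c)%R].
Proof.
move=> sep; apply: le_caratheodory_measurable => X.
set H := [set x | (g x <= c)%R].
have [Xoo|Xfin] := eqVneq (mu X) +oo; first by rewrite Xoo leey.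
pose e (k : nat) : R := (k.+1%:R^-1)%R.
have e0 k : (0 < e k)%R by rewrite invr_gt0.
have eS k : (e k.+1 < e k)%R by rewrite ltf_pV2 ?posrE // ltr_nat.
pose U k := X `&` [set x | (c + e k < g x)%R].
pose ring k := U k.+1 `\` U k.
have US k : U k.+1 = U k `|` ring k.
  apply/seteqP; split => x [].
    move=> Xx Ux; have [?|nUx] := pselect (U k x); first by left.
    by right; split.
  - by case=> Xx /= Ux; split=> //=; apply: lt_trans Ux; rewrite ltrD2l.
  - by case.
have UX k : mu (U k) <= mu X by apply: le_outer_measure; exact: subIsetl.
have sum2 N : \sum_(0 <= j < N) mu (ring j.+1) <= mu (U N) + mu (U N.+1).
  elim: N => [|N IH]; first by rewrite big_geq // adde_ge0 ?outer_measure_ge0.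
  rewrite big_nat_recr //=; apply: le_trans (leeD2r _ IH) _.
  rewrite addeAC [leRHS]addeC leeD2r // addeC.
  apply: le_trans (sep _ _ (e N - e N.+1)%R _ _) _.
  - by rewrite subr_gt0.
  - move=> x y [[Xx _]] /= nUx [_ /=]; have : (g x <= c + e N.+1)%R.
      by rewrite leNgt; apply/negP => h; apply: nUx.
    move: (e N) (e N.+1) (g x) (g y) => *; lra.
  - by apply: le_outer_measure => x [[]//|]; rewrite !US; left; left.
have XU k : mu (X `&` H) + mu (U k) <= mu X.
  apply: le_trans (sep _ _ (e k) _ _) _ => //.
  - move=> x y [_ Hx] [_ /=]; have {Hx} : (g x <= c)%R := Hx.
    move: (e k) (g x) (g y) => *; lra.
  - by apply: le_outer_measure => x [[]|[]].
have Umono j k : (j <= k)%N -> U j `<=` U k.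
  elim: k => [|k IH]; first by rewrite leqn0 => /eqP ->.
  rewrite leq_eqVlt => /orP[/eqP -> //|]; rewrite ltnS => /IH jk.
  by rewrite US => x /jk; left.
have cover N : X `&` ~` H `<=` U N.+1 `|` \bigcup_(k in ~` `I_N) ring k.+1.
  move=> x [Xx /= /negP]; rewrite -ltNge -subr_gt0 => gx.
  have [j0 _ j0P] := near_infty_natSinv_lt (PosNum gx).
  have exU : exists j, `[< U j x >].
    exists j0; apply/asboolP; split => //=.
    by have /= := j0P j0 (leqnn _); rewrite -/(e j0) ltrBrDl.
  case: (ex_minnP exU) => j /asboolP Ujx jmin.
  have [jN|Nj] := leqP j N.+1; first by left; exact: Umono Ujx.
  right; case: j => [//|[//|j]] in Ujx jmin Nj *.
  exists j; [by apply/negP; rewrite -leqNgt|split=> // Ux].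
  by have := jmin _ (asboolT Ux); rewrite ltnn.
pose tail N := \sum_(N <= k <oo) mu (ring k.+1).
have bound N : mu (X `&` H) + mu (X `&` ~` H) <= mu X + tail N.
  apply: (@le_trans _ _ (mu (X `&` H) + (mu (U N.+1) + tail N))); last first.
    by rewrite addeA leeD2r.
  apply: leeD2l; apply: le_trans (le_outer_measure _ _ _ (cover N)) _.
  apply: le_trans (outer_measureU2 _ _ _) _; apply: leeD2l.
  exact: outer_measure_sigma_subadditive_tail.
have tail0 : tail @ \oo --> 0.
  apply: nneseries_tail_cvg => [|k _]; last exact: outer_measure_ge0.
  apply: (@le_lt_trans _ _ (mu X + mu X)); last by rewrite lte_add_pinfty // ltey.
  apply: lime_le; first by apply: is_cvg_nneseries => *; exact: outer_measure_ge0.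
  by apply: nearW => N; apply: le_trans (sum2 N) _; exact: leeD.
have h : (fun N => mu X + tail N) @ \oo --> mu X + 0.
  apply: cvgeD => //; last exact: cvg_cst.
  by rewrite fin_num_adde_defl.
rewrite adde0 in h.
rewrite -(cvg_lim _ h) //; apply: lime_ge; first by apply/cvg_ex; exists (mu X).
exact: nearW.
Qed.
End MetricOuterMeasure.

Section HausdorffHalfspace.
Context (R : realType) (n k : nat).
Implicit Types (A B F : set 'rV[R]_n).

Lemma coord_le_enorm (x : 'rV[R]_n) i : `|x 0 i| <= enorm x.
Proof.
rewrite -sqrtr_sqr ler_wsqrtr // (bigD1 i) //= lerDl sumr_ge0 // => j _.
exact: sqr_ge0.
Qed.

Lemma enorm_ge0 (x : 'rV[R]_n) : 0 <= enorm x.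
Proof. exact: sqrtr_ge0. Qed.

Lemma le_ediam A B : A `<=` B -> (ediam A <= ediam B)%E.
Proof.
move=> AB; apply: ereal_sup_le => _ [x [y [Ax Ay ->]]].
by exists x, y; split=> //; exact: AB.
Qed.

Lemma ediam_ge0 A : A !=set0 -> (0 <= ediam A)%E.
Proof.
move=> [x Ax]; apply: (@le_trans _ _ (enorm (x - x))%:E).
  by rewrite lee_fin enorm_ge0.
by apply: ereal_sup_ubound; exists x, x.
Qed.

Lemma le_hausdorff_weight (delta : R) A B : A `<=` B ->
  (hausdorff_weight k delta A <= hausdorff_weight k delta B)%E.
Proof.
move=> AB; have dAB := le_ediam AB.
have [A0|/set0P[x Ax]] := eqVneq A set0.
  by rewrite A0 hausdorff_weight0 hausdorff_weight_ge0.
rewrite /hausdorff_weight ifN; last by apply/set0P; exists x.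
rewrite [X in (_ <= X)%E]ifN; last by apply/set0P; exists x; exact: AB.
case: (leP (ediam B)) => [Bd|_]; last exact: leey.
rewrite (le_trans dAB Bd); apply: lee_pmul => //.
- by rewrite lee_fin divr_ge0 ?ball_volume_ge0 // exprn_ge0.
- by apply: expe_ge0; apply: ediam_ge0; exists x.
elim: k => [|j IH]; first exact: lexx.
rewrite !expeS; apply: lee_pmul => //; first by apply: ediam_ge0; exists x.
by apply: expe_ge0; apply: ediam_ge0; exists x.
Qed.

(** A set of diameter less than [delta] cannot meet two sets whose [i]-th coordinates
    differ by at least [delta], so at fine scales a cover of the union splits into covers of the
    two parts. *)
Lemma hausdorff_halfspace (i : 'I_n) (c : R) :
  (@hausdorff_outer R n k).-caratheodory [set x | x 0 i <= c].
Proof.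
apply: (@separated_caratheodory _ _ (@hausdorff_outer R n k) (fun x => x 0 i)).
move=> A B delta delta0 AB.
pose H eta X := cover_measure (@hausdorff_weight R n k eta) X.
have Hsup eta X : 0 < eta -> (H eta X <= hausdorff_outer k X)%E.
  by move=> eta0; apply: ereal_sup_ubound; exists eta.
have Hanti eta eta' X : eta' <= eta -> (H eta X <= H eta' X)%E.
  move=> le; apply: le_ereal_inf_tmp => _ [F XF <-].
  apply: le_trans (ereal_inf_lbound _) _; first by exists F.
  apply: lee_nneseries => [j _ _|j _]; first exact: hausdorff_weight_ge0.
  rewrite /hausdorff_weight; case: ifP => // _.
  case: (leP (ediam (F j)) eta'%:E) => [h|_]; last exact: leey.
  by rewrite (le_trans h) // lee_fin.
have Hsplit eta : 0 < eta -> eta < delta ->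
    (H eta A + H eta B <= H eta (A `|` B))%E.
  move=> eta0 eta_delta.
  have := @cover_measure_split _ _ (hausdorff_weight k eta) A B (A `|` B).
  rewrite (setIidr (@subsetUl _ A B)) (setIidr (@subsetUr _ A B)); apply.
    by move=> F; exact: hausdorff_weight_ge0.
  move=> F.
  have [->|/set0P[x [Fx Ax]]] := eqVneq (F `&` A) set0.
    by rewrite hausdorff_weight0 add0e le_hausdorff_weight //; exact: subIsetl.
  have [->|/set0P[y [Fy By]]] := eqVneq (F `&` B) set0.
    by rewrite hausdorff_weight0 adde0 le_hausdorff_weight //; exact: subIsetl.
  rewrite [leRHS]/hausdorff_weight ifN; last by apply/set0P; exists x.
  rewrite ifN ?leey // -ltNge.
  apply: (@lt_le_trans _ _ (enorm (y - x))%:E); last first.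
    by apply: ereal_sup_ubound; exists y, x.
  rewrite lte_fin; apply: lt_le_trans eta_delta _.
  apply: le_trans (coord_le_enorm _ i); apply: le_trans _ (ler_norm _).
  by rewrite !mxE; have := AB x y Ax By; lra.
have Hpair e1 e2 : 0 < e1 -> 0 < e2 ->
    (H e1 A + H e2 B <= hausdorff_outer k (A `|` B))%E.
  move=> e10 e20; pose e := Num.min (Num.min e1 e2) (delta / 2).
  have e0 : 0 < e by rewrite !lt_min e10 e20 divr_gt0.
  have ed : e < delta by rewrite gt_min orbC ltr_pdivrMr // ltr_pMr // ltr1n.
  apply: le_trans (Hsup e _ e0); apply: le_trans _ (Hsplit e e0 ed).
  by apply: leeD; apply: Hanti; rewrite !ge_min lexx ?orbT.
change (hausdorff_outer k A + hausdorff_outer k B <= hausdorff_outer k (A `|` B))%E.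
have [->|ABfin] := eqVneq (hausdorff_outer k (A `|` B)) +oo%E; first exact: leey.
have fin X : X `<=` A `|` B -> hausdorff_outer k X \is a fin_num.
  move=> XAB; rewrite ge0_fin_numE; last exact: hausdorff_outer_ge0.
  by apply: le_lt_trans (le_hausdorff_outer k XAB) _; rewrite ltey.
have finH eta X : 0 < eta -> X `<=` A `|` B -> H eta X \is a fin_num.
  move=> eta0 XAB; rewrite ge0_fin_numE; last first.
    by apply: cover_measure_ge0 => ?; exact: hausdorff_weight_ge0.
  apply: le_lt_trans (Hsup _ _ eta0) _.
  by rewrite ltey_eq fin.
have AU := @subsetUl _ A B; have BU := @subsetUr _ A B.
rewrite -leeBrDr ?fin //; apply: ge_ereal_sup => _ [e1 e10 <-].
rewrite leeBrDr ?fin // addeC -leeBrDr ?finH //.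
apply: ge_ereal_sup => _ [e2 e20 <-].
by rewrite leeBrDr ?finH // addeC Hpair.
Qed.

End HausdorffHalfspace.

Section BorelSets.
Context (R : realType) (n : nat) (mu : {outer_measure set 'rV[R]_n -> \bar R}).
Hypothesis halfspace : forall i c, mu.-caratheodory [set x : 'rV[R]_n | x 0 i <= c].
Local Notation T := (caratheodory_type mu).

Lemma caratheodory_box (p q : 'rV[R]_n) : measurable (box p q : set T).
Proof.
have -> : box p q = \bigcap_(i in [set: 'I_n])
    (~` [set x : 'rV[R]_n | x 0 i <= p 0 i] `&` [set x : 'rV[R]_n | x 0 i <= q 0 i]).
  apply/seteqP; split => x /= h.
    by move=> i _; have /andP[pi qi] := h i; split => //=; apply/negP; rewrite -ltNge.
  by move=> i; have [/= /negP] := h i I; rewrite -ltNge => -> ->.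
apply: fin_bigcap_measurable => [|i _]; first exact: finite_finset.
by apply: measurableI; [apply: measurableC|]; exact: halfspace.
Qed.

(** An open set is the union of the boxes with rational corners that it contains. *)
Lemma caratheodory_open (U : set 'rV[R]_n) : open U -> measurable (U : set T).
Proof.
move=> oU.
pose box_of (pq : 'rV[rat]_n * 'rV[rat]_n) : set 'rV[R]_n :=
  box (map_mx ratr pq.1) (map_mx ratr pq.2).
have -> : U = \bigcup_pq (if `[< box_of pq `<=` U >] then box_of pq else set0).
  apply/seteqP; split => [x Ux|x [pq _]]; last by case: asboolP => // h /h.
  have /nbhs_ballP[e /= e0 xeU] := open_nbhs_nbhs (conj oU Ux).
  have /choice[p pP] : forall i, exists q : rat, x 0 i - e / 2 < ratr q < x 0 i.
    move=> i; have [|q] := @rat_in_itvoo R (x 0 i - e / 2) (x 0 i).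
      by rewrite ltrBlDr ltrDl divr_gt0.
    by rewrite in_itv /= => h; exists q.
  have /choice[q qP] : forall i, exists q : rat, x 0 i < ratr q < x 0 i + e / 2.
    move=> i; have [|q] := @rat_in_itvoo R (x 0 i) (x 0 i + e / 2).
      by rewrite ltrDl divr_gt0.
    by rewrite in_itv /= => h; exists q.
  exists (\row_i p i, \row_i q i) => //; rewrite asboolT; last first.
    move=> y yb; apply: xeU; split=> // i j; rewrite !ord1 /ball /=.
    have := yb j; rewrite !mxE => /andP[py yq].
    have /andP[xp _] := pP j; have /andP[_ qx] := qP j.
    by rewrite ltr_norml; move: py yq xp qx; lra.
  move=> i; rewrite !mxE.
  have /andP[_ ->] := pP i; have /andP[xq _] := qP i; exact: ltW.
apply: countable_bigcupT_measurable; first exact: countableP.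
by move=> pq; case: ifP => // _; exact: caratheodory_box.
Qed.

Lemma caratheodory_closed (F : set 'rV[R]_n) : closed F -> measurable (F : set T).
Proof.
by move=> cF; rewrite -[F]setCK; apply: measurableC; apply: caratheodory_open; exact: closed_openC.
Qed.

Lemma caratheodory_continuous (U : set 'rV[R]_n) (f : 'rV[R]_n -> R) :
  open U -> {in U, continuous f} -> measurable_fun (U : set T) (f : T -> R).
Proof.
move=> oU cf.
apply: (measurability _ (RGenOpens.measurableE R)) => _ [_ [a [b ->] <-]].
apply: caratheodory_open; rewrite openE => x [Ux fx].
have : \forall y \near x, `]a, b[%classic (f y).
  by apply: cf; [rewrite inE|apply: open_nbhs_nbhs; split=> //; exact: interval_open].
have : \forall y \near x, U y by apply: open_nbhs_nbhs.
by apply: filterS2.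
Qed.
End BorelSets.

Lemma compact_lebesgue_lty (R : realType) (n : nat) (K : set 'rV[R]_n) :
  compact K -> (@lebesgue_outer R n K < +oo)%E.
Proof.
move=> /compact_bounded[M [_ KM]].
pose c := `|M| + 1; pose q : 'rV[R]_n := const_mx c.
apply: le_lt_trans (lebesgue_outer_box_lty (- (q + q)) q).
apply: le_outer_measure => x Kx i; rewrite !mxE.
have xc : `|x 0 i| <= c.
  apply: le_trans (KM c _ x Kx); last by rewrite (le_lt_trans (ler_norm _)) // ltrDl.
  rewrite [leRHS]mx_normrE.
  exact: (@le_bigmax _ _ _ 0 (fun ij => `|x ij.1 ij.2|) (0, i)).
have c0 : 0 < c by rewrite ltr_wpDl.
by move: xc; rewrite ler_norml => /andP[]; lra.
Qed.

(** * The scalar product of the Clifford algebra *)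

Section CliffordAlgebra.
Context (R : realType) (n : nat).
Local Notation Cl := (clifford R n).
Implicit Types (x y z : Cl) (A B C : {set 'I_n}) (c : R).

Definition cdot x y : R := \sum_A x A * y A.

Lemma cnorm_sqr x : cnorm x ^+ 2 = cdot x x.
Proof.
by rewrite sqr_sqrtr ?sumr_ge0 // => *; rewrite ?sqr_ge0 //; under eq_bigr do rewrite expr2.
Qed.

Lemma cdotC x y : cdot x y = cdot y x.
Proof. by apply: eq_bigr => A _; rewrite mulrC. Qed.

Lemma cdotP c x y z : cdot z (c *: x + y) = c * cdot z x + cdot z y.
Proof.
rewrite /cdot mulr_sumr -big_split; apply: eq_bigr => A _ /=.
by rewrite !ffunE mulrDr mulrCA.
Qed.

Lemma cdotNr x z : cdot z (- x) = - cdot z x.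
Proof. by rewrite -sumrN; apply: eq_bigr => A _; rewrite ffunE mulrN. Qed.

Lemma cdot_sumr I (r : seq I) (F : I -> Cl) z :
  cdot z (\sum_(i <- r) F i) = \sum_(i <- r) cdot z (F i).
Proof.
apply: (big_morph (cdot z)) => [u v|].
  by have := cdotP 1 u v z; rewrite scale1r mul1r.
by rewrite /cdot big1 // => A _; rewrite ffunE mulr0.
Qed.

Lemma cdotZr c x z : cdot z (c *: x) = c * cdot z x.
Proof. by rewrite mulr_sumr; apply: eq_bigr => A _; rewrite ffunE mulrCA. Qed.

Lemma csign_sqr A B : csign R A B * csign R A B = 1.
Proof.
rewrite /csign -big_split big1 // => i _ /=.
by rewrite -big_split big1 // => j _ /=; rewrite mulrNN mulr1.
Qed.

Lemma mul_cbasis A B : cbasis R A * cbasis R B = csign R A B *: cbasis R (symdiff A B).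
Proof. exact: cmul_basis. Qed.

Lemma symdiffC A B : symdiff A B = symdiff B A.
Proof. by apply/setP => i; rewrite !symdiffE addbC. Qed.

Lemma symdiffK A : involutive (symdiff A).
Proof. by move=> B; apply/setP => i; rewrite !symdiffE addbA addbb addFb. Qed.

Lemma symdiffxx A : symdiff A A = finset.set0.
Proof. by apply/setP => i; rewrite !symdiffE addbb inE. Qed.

Lemma cbasisl_coef A x B : (cbasis R A * x) B = csign R A (symdiff A B) * x (symdiff A B).
Proof.
have -> : cbasis R A * x = \sum_C (x C * csign R A C) *: cbasis R (symdiff A C).
  rewrite {1}(cbasis_sum x) mulr_sumr; apply: eq_bigr => C _.
  by rewrite -scalerAr mul_cbasis scalerA.
rewrite sum_ffunE (bigD1 (symdiff A B)) //= big1 => [|C CB].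
  by rewrite !ffunE symdiffK eqxx addr0 [_ *: _]mulr1 mulrC.
rewrite !ffunE; case: eqP => [BE|_]; last exact: mulr0.
by rewrite BE symdiffK eqxx in CB.
Qed.

Lemma cbasisr_coef A x B : (x * cbasis R A) B = csign R (symdiff A B) A * x (symdiff A B).
Proof.
have -> : x * cbasis R A = \sum_C (x C * csign R C A) *: cbasis R (symdiff A C).
  rewrite {1}(cbasis_sum x) mulr_suml; apply: eq_bigr => C _.
  by rewrite -scalerAl mul_cbasis scalerA symdiffC.
rewrite sum_ffunE (bigD1 (symdiff A B)) //= big1 => [|C CB].
  by rewrite !ffunE symdiffK eqxx addr0 [_ *: _]mulr1 mulrC.
rewrite !ffunE; case: eqP => [BE|_]; last exact: mulr0.
by rewrite BE symdiffK eqxx in CB.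
Qed.

Lemma mul_coef x y B : (x * y) B = \sum_A csign R A (symdiff A B) * x A * y (symdiff A B).
Proof.
rewrite {1}(cbasis_sum x) mulr_suml sum_ffunE; apply: eq_bigr => A _.
by rewrite -scalerAl ffunE cbasisl_coef [_ *: _]mulrCA mulrA.
Qed.

(** The left-hand side is the inverse of [e_A], and [e_A] squares to [csign A A]. *)
Lemma cconj_cbasis A :
  \prod_(i <- rev (enum A)) (- cgen R i) = csign R A A *: cbasis R A.
Proof.
have inv (s : seq 'I_n) : (\prod_(i <- rev s) (- cgen R i)) * \prod_(i <- s) cgen R i = 1.
  elim: s => [|i s IH]; first by rewrite !big_nil mulr1.
  rewrite rev_cons -cats1 big_cat big_seq1 big_cons mulrA.
  rewrite -[_ * cgen R i]mulrA mulNr cgen_sqr opprK mulr1.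
  exact: IH.
have := inv (enum A); rewrite -cbasisE => /(congr1 ( *%R^~ (csign R A A *: cbasis R A))).
rewrite mul1r -mulrA -scalerAr mul_cbasis symdiffxx scalerA csign_sqr scale1r.
by rewrite mulr1.
Qed.

Lemma cconjE x : cconj x = \sum_A (csign R A A * x A) *: cbasis R A.
Proof. by apply: eq_bigr => A _; rewrite cconj_cbasis scalerA mulrC. Qed.

Lemma cconj_coef x A : cconj x A = csign R A A * x A.
Proof.
rewrite cconjE [in LHS](_ : \sum_A _ = [ffun A => csign R A A * x A]); first by rewrite ffunE.
rewrite [RHS]cbasis_sum; by apply: eq_bigr => B _; rewrite ffunE.
Qed.

Lemma Sc_cconj_mul x y : Sc (cconj x * y) = cdot x y.
Proof.
rewrite /Sc mul_coef; apply: eq_bigr => A _.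
by rewrite symdiff0r cconj_coef mulrA csign_sqr mul1r.
Qed.

(** Generators square to [-1] and change basis elements by signs only, so they act by
    skew-symmetric matrices. *)
Lemma cdot_cgenl i x y : cdot (cgen R i * x) y = - cdot x (cgen R i * y).
Proof.
rewrite /cdot (reindex_inj (can_inj (symdiffK (finset.set1 i)))) -sumrN /=.
apply: eq_bigr => A _; rewrite !cbasisl_coef symdiffK csign_symdiffr.
have -> : csign R (finset.set1 i) (finset.set1 i) = -1.
  by rewrite /csign big_set1 big_mkcondr big_set1 leqnn.
by ring.
Qed.

Lemma cdot_cgen_cgen i j y :
  cdot (cgen R i * y) (cgen R j * y) + cdot (cgen R j * y) (cgen R i * y) =
  2 * (i == j)%:R * cdot y y.
Proof.
rewrite !cdot_cgenl !mulrA; case: eqP => [->|/eqP ij].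
  by rewrite cgen_sqr mulN1r cdotNr /=; ring.
by rewrite cgen_anti // mulNr cdotNr /=; ring.
Qed.

(** The mixed terms cancel in pairs because distinct generators anticommute: a vector
    multiplies norms by its length. *)
Lemma cdot_vector_mul (beta : 'I_n -> R) y :
  cdot ((\sum_i beta i *: cgen R i) * y) ((\sum_i beta i *: cgen R i) * y) =
  \sum_i beta i ^+ 2 * cdot y y.
Proof.
set v := \sum_i _.
pose s i j := cdot (cgen R i * y) (cgen R j * y).
have vE : v * y = \sum_i beta i *: (cgen R i * y).
  by rewrite mulr_suml; apply: eq_bigr => i _; rewrite scalerAl.
have E : cdot (v * y) (v * y) = \sum_i \sum_j beta i * beta j * s i j.
  rewrite {2}vE cdot_sumr; apply: eq_bigr => i _.
  rewrite cdotZr cdotC vE cdot_sumr mulr_sumr; apply: eq_bigr => j _.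
  by rewrite cdotZr mulrA.
have E' : cdot (v * y) (v * y) = \sum_i \sum_j beta i * beta j * s j i.
  by rewrite E exchange_big; apply: eq_bigr => i _; apply: eq_bigr => j _; rewrite [beta i * _]mulrC.
have : cdot (v * y) (v * y) + cdot (v * y) (v * y) = 2 * \sum_i beta i ^+ 2 * cdot y y.
  rewrite {1}E E' -big_split mulr_sumr; apply: eq_bigr => i _.
  rewrite -big_split (bigD1 i) //= big1 ?addr0 => [|j ji].
    by rewrite -mulrDr [s i i + _]cdot_cgen_cgen eqxx /=; ring.
  by rewrite -mulrDr cdot_cgen_cgen eq_sym (negbTE ji) /= mulr0 mul0r mulr0.
lra.
Qed.

Lemma cdot_cgen_mul i y : cdot (cgen R i * y) (cgen R i * y) = cdot y y.
Proof. have := cdot_cgen_cgen i i y; rewrite eqxx /= mulr1; lra. Qed.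

End CliffordAlgebra.

(** * Square integrable Clifford-valued functions *)

Lemma ae_mono (R : realType) d (T : measurableType d) (mu : {measure set T -> \bar R})
    (P Q : T -> Prop) :
  {ae mu, forall x, P x} -> (forall x, P x -> Q x) -> {ae mu, forall x, Q x}.
Proof. by move=> h PQ; apply: filterS h. Qed.

Lemma ae_mono2 (R : realType) d (T : measurableType d) (mu : {measure set T -> \bar R})
    (P P' Q : T -> Prop) :
  {ae mu, forall x, P x} -> {ae mu, forall x, P' x} ->
  (forall x, P x -> P' x -> Q x) -> {ae mu, forall x, Q x}.
Proof. by move=> h h' PQ; apply: filterS2 h h'. Qed.

Section CliffordL2.
Context (R : realType) (n : nat).
Local Notation Cl := (clifford R n).
Context d (T : measurableType d) (mu : {measure set T -> \bar R}) (D : set T).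
Hypothesis mD : measurable D.
Implicit Types (f g h : T -> Cl) (m : T -> R) (c : R).
Local Notation L2 := (L2 mu D).
Local Notation coef f A := (fun x => f x A : R).

Lemma sqint_sum (I : Type) (r : seq I) (c : I -> R) (F : I -> T -> R) :
  (forall i, sqint mu D (F i)) ->
  sqint mu D (fun x => \sum_(i <- r) c i * F i x).
Proof.
move=> F2; elim: r => [|i r IH].
  by under eq_fun do rewrite big_nil; exact: sqint0.
by under eq_fun do rewrite big_cons; exact: sqintP.
Qed.

Lemma L2P f : L2 f <-> forall A, sqint mu D (coef f A).
Proof.
have cn x : cnorm (f x) ^+ 2 = \sum_A f x A ^+ 2.
  by rewrite cnorm_sqr; apply: eq_bigr => A _; rewrite expr2.
split=> [[mf fi] A|f2].
  have mc : measurable_fun D (fun x => cnorm (f x) ^+ 2).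
    under eq_fun do rewrite cn.
    by apply: measurable_sum => B; exact: measurable_funX.
  apply: (@sqint_bound _ _ _ _ _ _ _ (fun x => cnorm (f x) ^+ 2)) => //.
    apply/integrableP; split; first exact/measurable_EFinP.
    by under eq_integral do rewrite /= ger0_norm ?sqr_ge0 //.
  move=> x _; rewrite cn (bigD1 A) //= lerDl sumr_ge0 // => B _; exact: sqr_ge0.
split=> [A|]; first by case: (f2 A).
under eq_integral do rewrite cn -sumEFin.
rewrite ge0_integral_sum //; first by apply: lte_sum_pinfty => A _; case: (f2 A).
- by move=> A; apply/measurable_EFinP; apply: measurable_funX; case: (f2 A).
- by move=> A x _; rewrite lee_fin sqr_ge0.
Qed.

(** The scalar part of the Clifford-valued inner product, a real inner product whose
    norm is the [L^2] norm. *)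
Definition cl2 f g : R := \sum_A sqip mu D (coef f A) (coef g A).

Lemma L2_coef f A : L2 f -> sqint mu D (coef f A).
Proof. by move/L2P. Qed.

Lemma L2_lin c f g : L2 f -> L2 g -> L2 (fun x => c *: f x + g x).
Proof.
move=> /L2P f2 /L2P g2; apply/L2P => A.
by under eq_fun do rewrite !ffunE; exact: sqintP.
Qed.

Lemma L2_0 : L2 (fun=> 0 : Cl).
Proof. by apply/L2P => A; under eq_fun do rewrite ffunE; exact: sqint0. Qed.

Lemma L2D f g : L2 f -> L2 g -> L2 (fun x => f x + g x).
Proof.
move=> f2 g2; have := L2_lin 1 f2 g2.
by under [X in L2 X]eq_fun do rewrite scale1r.
Qed.

Lemma L2Z c f : L2 f -> L2 (fun x => c *: f x).
Proof.
move=> f2; have := L2_lin c f2 L2_0.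
by under [X in L2 X]eq_fun do rewrite addr0.
Qed.

Lemma L2_sum (I : Type) (r : seq I) (F : I -> T -> Cl) :
  (forall i, L2 (F i)) -> L2 (fun x => \sum_(i <- r) F i x).
Proof.
move=> F2; elim: r => [|i r IH].
  by under eq_fun do rewrite big_nil; exact: L2_0.
by under eq_fun do rewrite big_cons; exact: L2D.
Qed.

Lemma L2_mulr f (z : Cl) : L2 f -> L2 (fun x => f x * z).
Proof.
move=> /L2P f2; apply/L2P => A.
have -> : coef (fun x => f x * z) A = fun x =>
    \sum_B (csign R B (symdiff B A) * z (symdiff B A)) * f x B.
  by apply/funext => x; rewrite mul_coef; apply: eq_bigr => B _; rewrite mulrAC.
exact: sqint_sum.
Qed.

Lemma L2_mull f (z : Cl) : L2 f -> L2 (fun x => z * f x).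
Proof.
move=> /L2P f2; apply/L2P => A.
have -> : coef (fun x => z * f x) A = fun x =>
    \sum_B (csign R B (symdiff B A) * z B) * f x (symdiff B A).
  by apply/funext => x; rewrite mul_coef; apply: eq_bigr => B _; rewrite mulrAC.
by apply: (sqint_sum _ _ (F := fun B x => f x (symdiff B A))).
Qed.

Lemma cl2C f g : cl2 f g = cl2 g f.
Proof. by apply: eq_bigr => A _; rewrite sqipC. Qed.

Lemma cl2P c f g h : L2 f -> L2 g -> L2 h ->
  cl2 (fun x => c *: f x + g x) h = c * cl2 f h + cl2 g h.
Proof.
move=> /L2P f2 /L2P g2 /L2P h2; rewrite /cl2 mulr_sumr -big_split.
apply: eq_bigr => A _ /=; rewrite -sqipP //; congr sqip.
by apply/funext => x; rewrite !ffunE.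
Qed.

Lemma cl2Pr c f g h : L2 f -> L2 g -> L2 h ->
  cl2 h (fun x => c *: f x + g x) = c * cl2 h f + cl2 h g.
Proof. by move=> f2 g2 h2; rewrite ![cl2 h _]cl2C cl2P. Qed.

Lemma cl2Zl c f h : L2 f -> L2 h -> cl2 (fun x => c *: f x) h = c * cl2 f h.
Proof.
move=> /L2P f2 /L2P h2; rewrite /cl2 mulr_sumr; apply: eq_bigr => A _.
rewrite /sqip -RintegralZl //; last exact: sqint_mul.
by apply: eq_Rintegral => x _; rewrite ffunE mulrA.
Qed.

Lemma cl2Zr c f h : L2 f -> L2 h -> cl2 h (fun x => c *: f x) = c * cl2 h f.
Proof. by move=> f2 h2; rewrite cl2C cl2Zl // cl2C. Qed.

Lemma cl2_ge0 f : 0 <= cl2 f f.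
Proof. by apply: sumr_ge0 => A _; exact: sqip_ge0. Qed.

Lemma cl2_sqr_le f g : L2 f -> L2 g -> cl2 f g ^+ 2 <= cl2 f f * cl2 g g.
Proof.
move=> f2 g2; rewrite mulrC; apply: quadratic_ge0_discr => [|t].
  exact: cl2_ge0.
have := cl2_ge0 (fun x => t *: g x + f x).
rewrite cl2P //; last exact: L2_lin.
rewrite [X in t * X + _]cl2C [X in _ + X]cl2C !cl2P // (cl2C f g); lra.
Qed.

Lemma integrable_coefM f g A : L2 f -> L2 g ->
  mu.-integrable D (EFin \o (fun x => f x A * g x A)).
Proof. by move=> /L2P f2 /L2P g2; exact: sqint_mul. Qed.

Lemma Rintegral_sum (I : Type) (r : seq I) (F : I -> T -> R) :
  (forall i, mu.-integrable D (EFin \o F i)) ->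
  \int[mu]_(x in D) (\sum_(i <- r) F i x) = \sum_(i <- r) \int[mu]_(x in D) F i x.
Proof.
move=> Fi.
have int s : mu.-integrable D (EFin \o (fun x => \sum_(i <- s) F i x)).
  have := integrable_sum mD s (fun i (_ : xpredT i) => Fi i); apply: eq_integrable => // x _.
  by rewrite /= -sumEFin.
elim: r => [|i r IH].
  by under eq_Rintegral do rewrite big_nil; rewrite Rintegral_cst // mul0r big_nil.
rewrite big_cons -IH -RintegralD //.
by apply: eq_Rintegral => x _; rewrite big_cons.
Qed.

Lemma cl2E f g : L2 f -> L2 g ->
  cl2 f g = \int[mu]_(x in D) cdot (f x) (g x).
Proof.
by move=> f2 g2; rewrite Rintegral_sum // => A; exact: integrable_coefM.
Qed.

(** Right multiplication by [e_A] moves the coordinate along [e_A] to the scalar part;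
    this is how real-valued information recovers the Clifford-valued inner product. *)
Lemma L2inner_coef f g A : L2 f -> L2 g ->
  L2inner mu D f g A = csign R A A * cl2 f (fun x => g x * cbasis R A).
Proof.
move=> f2 g2; have gA2 := L2_mulr (cbasis R A) g2.
rewrite cl2E // -RintegralZl //; last first.
  have := integrable_sum mD (index_enum _) (fun B (_ : xpredT B) => integrable_coefM B f2 gA2).
  by apply: eq_integrable => // x _; rewrite /= -sumEFin.
rewrite ffunE; apply: eq_Rintegral => x _.
rewrite -Sc_cconj_mul mulrA /Sc cbasisr_coef symdiff0r mulrA csign_sqr.
by rewrite mul1r.
Qed.

Lemma L2norm_sqr f : L2 f -> L2norm mu D f ^+ 2 = cl2 f f.
Proof.
move=> f2; rewrite sqr_sqrtr; last first.
  by apply: Rintegral_ge0 => x _; exact: sqr_ge0.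
by rewrite cl2E //; apply: eq_Rintegral => x _; rewrite cnorm_sqr.
Qed.

Lemma EFin_cl2 f : L2 f ->
  ((cl2 f f)%:E = \int[mu]_(x in D) (cnorm (f x) ^+ 2)%:E)%E.
Proof.
move=> f2; rewrite cl2E // (_ : \int[mu]_(x in D) cdot (f x) (f x) =
    \int[mu]_(x in D) cnorm (f x) ^+ 2); last first.
  by apply: eq_Rintegral => x _; rewrite cnorm_sqr.
rewrite /Rintegral fineK // ge0_fin_numE; first by case: f2.
by apply: integral_ge0 => x _; rewrite lee_fin sqr_ge0.
Qed.

Lemma ae_eq_cl2 f f' g g' : L2 f -> L2 f' -> L2 g -> L2 g' ->
  {ae mu, forall x, D x -> f x = f' x} -> {ae mu, forall x, D x -> g x = g' x} ->
  cl2 f g = cl2 f' g'.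
Proof.
move=> [mf _] [mf' _] [mg _] [mg' _] ff gg; apply: eq_bigr => A _.
apply: ae_eq_sqip => //.
  by apply: filterS ff => x h /h ->.
by apply: filterS gg => x h /h ->.
Qed.

Lemma cl2_eq0 f : L2 f -> cl2 f f = 0 -> {ae mu, forall x, D x -> f x = 0}.
Proof.
move=> /L2P f2 /eqP; rewrite psumr_eq0; last by move=> A _; exact: sqip_ge0.
move=> /allP f0.
have : {ae mu, forall x, forall A, D x -> f x A = 0}.
  apply: filter_forall => A; apply: sqip_eq0 => //.
  by apply/eqP/f0; rewrite mem_index_enum.
by apply: filterS => x h Dx; apply/ffunP => A; rewrite h // ffunE.
Qed.

Lemma L2_bounded_mul (K : R) m f :
  measurable_fun D m -> L2 f -> {ae mu, forall x, D x -> `|m x| <= K} ->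
  L2 (fun x => m x *: f x) /\
  cl2 (fun x => m x *: f x) (fun x => m x *: f x) <= K ^+ 2 * cl2 f f.
Proof.
move=> mm /L2P f2 mK; have h A := sqint_bounded_mul mD mm (f2 A) mK.
have coefE A : coef (fun x => m x *: f x) A = fun x => m x * f x A.
  by apply/funext => x; rewrite ffunE.
split; first by apply/L2P => A; rewrite coefE; case: (h A).
by rewrite /cl2 mulr_sumr; apply: ler_sum => A _; rewrite coefE; case: (h A).
Qed.

(** The bound [k <= m] holds almost everywhere only, so [m] is first replaced by the
    maximum of [k] and [m], which does not change the integrals. *)
Lemma cl2_weight_ge (k K : R) m f : measurable_fun D m -> L2 f ->
  {ae mu, forall x, D x -> `|m x| <= K} ->
  {ae mu, forall x, D x -> k <= m x} -> k * cl2 f f <= cl2 f (fun x => m x *: f x).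
Proof.
move=> mm /L2P f2 mK km; rewrite /cl2 mulr_sumr; apply: ler_sum => A _.
pose m' x := Num.max k (m x).
have mm' : measurable_fun D m' by exact: measurable_maxr.
have mm'E : {ae mu, forall x, D x -> m x = m' x}.
  by apply: filterS km => x km Dx; rewrite /m' max_r // km.
have [mf2 _] := sqint_bounded_mul mD mm (f2 A) mK.
have m'K : {ae mu, forall x, D x -> `|m' x| <= K}.
  by apply: filterS2 mK mm'E => x mx mE Dx; rewrite -mE // mx.
have [m'f2 _] := sqint_bounded_mul mD mm' (f2 A) m'K.
have [mf _] := f2 A; have [mmf _] := mf2; have [mm'f _] := m'f2.
rewrite (_ : coef (fun x => m x *: f x) A = fun x => m x * f x A); last first.
  by apply/funext => x; rewrite ffunE.
rewrite [leRHS](@ae_eq_sqip _ _ _ _ _ mD _ (coef f A) _ (fun x => m' x * f x A)) //; last 2 first.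
- exact: aeW.
- by apply: filterS mm'E => x h Dx; rewrite /= h.
rewrite /sqip -RintegralZl //; last exact: sqint_mul.
apply: le_Rintegral => //.
- by have := integrableZl mD k (sqint_mul mD (f2 A) (f2 A)); apply: eq_integrable.
- exact: sqint_mul.
move=> x _; rewrite [leRHS]mulrCA ler_wpM2r -?expr2 ?sqr_ge0 //.
by rewrite le_max lexx.
Qed.

End CliffordL2.

(** * Multiplication by functions in the critical Lebesgue space *)

Section Hoelder.
Context (R : realType) d (T : measurableType d) (mu : {measure set T -> \bar R}).
Variable D : set T.
Hypothesis mD : measurable D.
Implicit Types (f g h m : T -> R).

Lemma Lpnorm_ge0 p f : (0 <= Lpnorm mu D p f)%E.
Proof. exact: Lnorm_ge0. Qed.

Lemma LpnormE p f : Lpnorm mu D p f = 'N[mu]_p[EFin \o (f \_ D)]%E.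
Proof. by rewrite /Lpnorm -restrict_EFin. Qed.

Lemma Lpnorm_infty_ae f : (Lpnorm mu D +oo f < +oo)%E ->
  {ae mu, forall x, D x -> `|f x| <= fine (Lpnorm mu D +oo f)}.
Proof.
move=> ffin; have f0 := Lpnorm_ge0 +oo f.
have : {ae mu, forall x, (abse ((EFin \o f) \_ D x) <= Lpnorm mu D +oo f)%E}.
  rewrite /Lpnorm unlock; case: ifPn => [_|mu0]; first exact: ess_sup_ge.
  exists setT; split=> //; apply/eqP; rewrite eq_le measure_ge0 andbT leNgt.
  exact: mu0.
apply: filterS => x + Dx; rewrite /patch mem_set //= => h.
by rewrite -lee_fin fineK ?ge0_fin_numE.
Qed.

Lemma Lnorm_sqr (p : R) h : 0 < p ->
  ('N[mu]_p%:E[EFin \o (fun x => (h x ^+ 2)%R)] = 'N[mu]_(2 * p)%:E[EFin \o h] `^ 2)%E.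
Proof.
move=> p0; rewrite unlock /Lnorm -poweRrM; congr poweR; last first.
  by field; rewrite gt_eqF.
apply: eq_integral => x _ /=.
by rewrite normrX -powR_mulrn // -powRrM.
Qed.

(** Hoelder's inequality for the squares of the two functions. *)
Lemma hoelder_sqr (p q : R) m h : 0 < p -> 0 < q -> p^-1 + q^-1 = 1 ->
  measurable_fun D m -> measurable_fun D h ->
  (\int[mu]_(x in D) ((m x * h x) ^+ 2)%:E <=
   Lpnorm mu D (2 * p)%:E m `^ 2 * Lpnorm mu D (2 * q)%:E h `^ 2)%E.
Proof.
move=> p0 q0 pq mm mh; rewrite !LpnormE -!Lnorm_sqr //.
have mf f : measurable_fun D f -> measurable_fun setT (fun x => (f \_ D) x ^+ 2).
  by move=> mf; apply: measurable_funX; apply/(measurable_restrictT _ mD).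
apply: le_trans (hoelder mu (mf _ mm) (mf _ mh) p0 q0 pq).
rewrite Lnorm1 integral_mkcond; apply: ge0_le_integral => //=.
- by move=> x _; rewrite /patch; case: ifP => // _; rewrite lee_fin sqr_ge0.
- apply/(measurable_restrictT _ mD); apply/measurable_EFinP; apply: measurable_funX.
  exact: measurable_funM.
- apply/measurable_EFinP; apply: measurableT_comp => //.
  by apply: measurable_funM; exact: mf.
move=> x _; rewrite /patch; case: ifP => _; rewrite lee_fin.
  by rewrite exprMn ler_norm.
by rewrite expr0n mul0r normr0.
Qed.

End Hoelder.

Section SobolevMultiplier.
Context (R : realType) (n : nat) d (T : measurableType d) (mu : {measure set T -> \bar R}).
Variable D : set T.
Hypothesis mD : measurable D.

Lemma measurable_cnorm (v : T -> clifford R n) :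
  (forall A, measurable_fun D (fun x => v x A : R)) ->
  measurable_fun D (fun x => cnorm (v x)).
Proof.
move=> mv; apply: (measurableT_comp (continuous_measurable_fun (@sqrt_continuous R))).
apply: measurable_sum => A; exact: measurable_funX.
Qed.

(** Hoelder's inequality for [m^2] and [|v|^2] with exponents N/2 and N/(N-2), which are
    conjugate; the norms of the squares are the squares of the norms with doubled
    exponents. *)
Lemma L2_sobolev_mul (N : nat) (K : R) (m : T -> R) (v : T -> clifford R n) :
  (3 <= N)%N -> measurable_fun D m -> L2 mu D v ->
  (Lpnorm mu D N%:R%:E m < +oo)%E ->
  (Lpnorm mu D (2 * N%:R / (N%:R - 2))%:E (fun x => cnorm (v x)) <= K%:E)%E ->
  L2 mu D (fun x => m x *: v x) /\
  cl2 mu D (fun x => m x *: v x) (fun x => m x *: v x) <=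
    (fine (Lpnorm mu D N%:R%:E m) * K) ^+ 2.
Proof.
move=> N3 mm v2 mfin vK; have [mv _] := v2.
have N2 : 2 < N%:R :> R by rewrite ltr_nat.
have K0 : 0 <= K by rewrite -lee_fin (le_trans _ vK) // Lpnorm_ge0.
set L := fine _.
have L0 : 0 <= L by rewrite fine_ge0 // Lpnorm_ge0.
have LE : Lpnorm mu D N%:R%:E m = L%:E.
  by rewrite /L fineK // ge0_fin_numE // Lpnorm_ge0.
have bound : (\int[mu]_(x in D) (cnorm (m x *: v x) ^+ 2)%:E <= ((L * K) ^+ 2)%:E)%E.
  under eq_integral => x _ do
    rewrite cnorm_sqr cdotZr cdotC cdotZr -cnorm_sqr mulrA -expr2 -exprMn.
  apply: le_trans (@hoelder_sqr _ _ _ mu _ mD (N%:R / 2) (N%:R / (N%:R - 2)) _ _ _ _ _ mm _) _.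
  - by rewrite divr_gt0 // (lt_trans _ N2).
  - by rewrite divr_gt0 ?subr_gt0 // (lt_trans _ N2).
  - by field; rewrite !gt_eqF ?subr_gt0 // (lt_trans _ N2).
  - exact: measurable_cnorm.
  rewrite (_ : 2 * (N%:R / 2) = N%:R); last by field.
  rewrite mulrA LE exprMn [leRHS]EFinM.
  apply: lee_pmul; [exact: poweR_ge0|exact: poweR_ge0| |].
    by rewrite poweR_EFin lee_fin powR_mulrn.
  have -> : (K ^+ 2)%:E = (K%:E `^ 2)%E by rewrite poweR_EFin powR_mulrn.
  by apply: gt0_ler_poweR => //; rewrite in_itv /= leey ?andbT ?lee_fin ?Lpnorm_ge0.
have mv2 : L2 mu D (fun x => m x *: v x).
  split; last by apply: le_lt_trans bound _; exact: ltry.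
  by move=> A; under eq_fun do rewrite ffunE; exact: measurable_funM.
split=> //; rewrite -lee_fin; by rewrite EFin_cl2.
Qed.

End SobolevMultiplier.

(** * Completeness and test functions *)

Lemma finite_eventually (I : finType) (P : I -> nat -> Prop) :
  (forall i, exists N, forall k, (N <= k)%N -> P i k) ->
  exists N, forall k, (N <= k)%N -> forall i, P i k.
Proof.
move=> /choice[N NP]; exists (\max_i N i)%N => k Nk i; apply: NP.
by apply: leq_trans Nk; exact: leq_bigmax.
Qed.

Section CliffordL2Complete.
Context (R : realType) (n : nat) d (T : measurableType d).
Context (mu : {measure set T -> \bar R}) (D : set T).
Hypothesis mD : measurable D.

Lemma cl2_complete (f_ : nat -> T -> clifford R n) :
  (forall i, L2 mu D (f_ i)) ->
  (forall e, 0 < e -> exists N, forall i j, (N <= i)%N -> (N <= j)%N ->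
    cl2 mu D (fun x => f_ i x - f_ j x) (fun x => f_ i x - f_ j x) <= e) ->
  exists l, L2 mu D l /\ forall e, 0 < e -> exists N, forall i, (N <= i)%N ->
    cl2 mu D (fun x => l x - f_ i x) (fun x => l x - f_ i x) <= e.
Proof.
move=> f2 cau.
have coefB (g h : T -> clifford R n) A :
    (fun x => (g x - h x) A : R) = fun x => g x A - h x A.
  by apply/funext => x; rewrite !ffunE.
have /choice[l lP] : forall A, exists l, sqint mu D l /\
    forall e, 0 < e -> exists N, forall i, (N <= i)%N ->
    sqip mu D (fun x => l x - f_ i x A) (fun x => l x - f_ i x A) <= e.
  move=> A; apply: sqint_complete => // [i|e e0]; first exact: L2_coef.
  have [N NP] := cau e e0; exists N => i j Ni Nj.
  apply: le_trans (NP i j Ni Nj); rewrite /cl2 (bigD1 A) //= coefB lerDl.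
  by apply: sumr_ge0 => B _; exact: sqip_ge0.
exists (fun x => [ffun A => l A x]); split.
  by apply/(L2P _ mD) => A; under eq_fun do rewrite ffunE; case: (lP A).
move=> e e0; pose K : R := #|{set 'I_n}|%:R.
have K0 : 0 < K by rewrite ltr0n; apply/card_gt0P; exists finset.set0.
have [|N NP] := finite_eventually (P := fun A k =>
    sqip mu D (fun x => l A x - f_ k x A) (fun x => l A x - f_ k x A) <= e / K).
  by move=> A; case: (lP A) => _; apply; rewrite divr_gt0.
exists N => k Nk; apply: le_trans (_ : \sum_(A : {set 'I_n}) e / K <= _).
  apply: ler_sum => A _; apply: le_trans (NP k Nk A).
  rewrite coefB (_ : (fun x => _ - _) = fun x => l A x - f_ k x A) //.
  by apply/funext => x; rewrite ffunE.
by rewrite sumr_const -mulr_natr mulfVK // gt_eqF.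
Qed.

End CliffordL2Complete.

Section TestFunctions.
Context (R : realType) (n : nat) (Omega : set 'rV[R]_n).
Local Notation leb := (@lebesgue_rV R n).
Hypothesis oOmega : open Omega.

Lemma measurable_domain :
  measurable (Omega : set (caratheodory_type (@lebesgue_outer R n))).
Proof. by apply: caratheodory_open => // i c; exact: lebesgue_halfspace. Qed.

(** The function is bounded on [K], and a compact set lies in a box of finite volume. *)
Lemma sqint_compact_support (f : 'rV[R]_n -> R) (K : set 'rV[R]_n) :
  continuous f -> compact K -> closed K -> (forall x, ~ K x -> f x = 0) ->
  sqint leb Omega f.
Proof.
move=> cf Kc Kcl fK; have mO := measurable_domain.
have mf : measurable_fun [set: caratheodory_type (@lebesgue_outer R n)] f.
  by apply: caratheodory_continuous => [i c||x _];
    [exact: lebesgue_halfspace|exact: openT|exact: cf].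
have mK : measurable (K : set (caratheodory_type (@lebesgue_outer R n))).
  by apply: caratheodory_closed => // i c; exact: lebesgue_halfspace.
split; first exact: measurable_funTS.
have [M fM] : exists M, forall x, f x ^+ 2 <= M ^+ 2.
  have : compact (f @` K) by apply: continuous_compact => //; exact: continuous_subspaceT.
  move=> /compact_bounded[M [_ fM]]; exists (`|M| + 1) => x.
  have [Kx|nKx] := pselect (K x); last by rewrite fK // expr0n sqr_ge0.
  rewrite -(real_normK (num_real (f x))) ler_sqr ?nnegrE ?addr_ge0 //.
  by apply: fM; [rewrite (le_lt_trans (ler_norm _)) // ltrDl|exists x].
have msq : measurable_fun [set: caratheodory_type (@lebesgue_outer R n)] (fun x => (f x ^+ 2)%:E).
  by apply/measurable_EFinP; exact: measurable_funX.
have f0 : forall x, (0 <= (f x ^+ 2)%:E)%E by move=> x; rewrite lee_fin sqr_ge0.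
apply: (@le_lt_trans _ _ (\int[leb]_x (f x ^+ 2)%:E)%E).
  by apply: ge0_subset_integral.
apply: (@le_lt_trans _ _ (\int[leb]_x ((M ^+ 2)%:E * (\1_K x)%:E))%E).
  apply: ge0_le_integral => //.
    by apply: measurable_funeM; apply/measurable_EFinP.
  move=> x _; rewrite -EFinM lee_fin indicE; case: (boolP (x \in K)) => [_|].
    by rewrite mulr1.
  by move/negP; rewrite inE => /fK ->; rewrite expr0n mulr0.
rewrite ge0_integralZl_EFin ?sqr_ge0 //; last by apply/measurable_EFinP.
rewrite integral_indic // setIT.
have Kfin : (leb K < +oo)%E by exact: compact_lebesgue_lty.
have : leb K \is a fin_num by rewrite ge0_fin_numE.
by move/fineK => <-; rewrite -EFinM ltry.
Qed.

Lemma test_sqint (phi : 'rV[R]_n -> R) :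
  test_function Omega phi -> sqint leb Omega phi.
Proof.
move=> [sphi cphi _]; apply: (sqint_compact_support _ cphi) => [x||x nx].
- exact: differentiable_continuous (sphi [::] x).
- exact: closed_closure.
by apply: contrapT => /eqP px; apply: nx; exact: subset_closure.
Qed.

Lemma test_partial_sqint i (phi : 'rV[R]_n -> R) :
  test_function Omega phi -> sqint leb Omega (partial i phi).
Proof.
move=> [sphi cphi _]; apply: (sqint_compact_support _ cphi) => [x||x nx].
- exact: differentiable_continuous (sphi [:: i] x).
- exact: closed_closure.
rewrite /partial (@near_eq_derive _ _ _ phi (cst 0)) ?derive_cst //.
have : nbhs x (~` Defs.support phi).
  by apply: open_nbhs_nbhs; split => //; apply: closed_openC; exact: closed_closure.
apply: filterS => y ny; apply: contrapT => /eqP py; apply: ny.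
exact: subset_closure.
Qed.

(** In coordinates the weak derivative is an identity between real inner products, which
    makes it stable under linear combinations, right multiplication and [L^2] limits. *)
Lemma weak_partialP i (u g : 'rV[R]_n -> clifford R n) :
  weak_partial Omega i u g <-> forall phi, test_function Omega phi -> forall A,
    sqip leb Omega (partial i phi) (fun x => u x A : R) =
    - sqip leb Omega phi (fun x => g x A : R).
Proof.
have E (psi : 'rV[R]_n -> R) (w : 'rV[R]_n -> clifford R n) A :
    Cintegral leb Omega (fun x => psi x *: w x) A =
    sqip leb Omega psi (fun x => w x A : R).
  by rewrite ffunE; apply: eq_Rintegral => x _; rewrite ffunE.
split=> h phi phiT => [A|]; first by rewrite -E h // ffunE E.
by apply/ffunP => A; rewrite E h // ffunE E.
Qed.

End TestFunctions.

(** * The Sobolev space as a complete inner product space *)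

Section SobolevSpace.
Context (R : realType) (n : nat) (Omega : set 'rV[R]_n).
Hypothesis oOmega : open Omega.
Local Notation leb := (@lebesgue_rV R n).
Local Notation Cl := (clifford R n).
Let mO := measurable_domain oOmega.

Lemma weak_partial_lin i (c : R) (u u' g g' : 'rV[R]_n -> Cl) :
  L2 leb Omega u -> L2 leb Omega u' -> L2 leb Omega g -> L2 leb Omega g' ->
  weak_partial Omega i u g -> weak_partial Omega i u' g' ->
  weak_partial Omega i (fun x => c *: u x + u' x) (fun x => c *: g x + g' x).
Proof.
move=> /(L2P _ mO) u2 /(L2P _ mO) u'2 /(L2P _ mO) g2 /(L2P _ mO) g'2.
move=> /weak_partialP ug /weak_partialP ug'; apply/weak_partialP => phi phiT A.
have coefE (f f' : 'rV[R]_n -> Cl) :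
    (fun x => (c *: f x + f' x) A : R) = fun x => c * f x A + f' x A.
  by apply/funext => x; rewrite !ffunE.
have phi2 := test_sqint oOmega phiT.
have dphi2 := test_partial_sqint oOmega i phiT.
by rewrite !coefE !sqipPr // ug // ug' //; ring.
Qed.

Lemma weak_partial0 i : weak_partial Omega i (fun=> 0) (fun=> 0).
Proof.
apply/weak_partialP => phi _ A.
have E f : sqip leb Omega f (fun x => (0 : Cl) A : R) = 0.
  rewrite /sqip; under eq_Rintegral do rewrite ffunE mulr0.
  by rewrite Rintegral_cst // mul0r.
by rewrite !E oppr0.
Qed.

Definition H1comb (c : R) (u v : H1 Omega) : H1 Omega :=
  @MkH1 _ _ _ (fun x => c *: u x + v x)
    (fun i x => c *: H1grad u i x + H1grad v i x)
    (L2_lin mO c (H1fun_L2 u) (H1fun_L2 v))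
    (fun i => L2_lin mO c (H1grad_L2 u i) (H1grad_L2 v i))
    (fun i => weak_partial_lin c (H1fun_L2 u) (H1fun_L2 v)
       (H1grad_L2 u i) (H1grad_L2 v i) (@H1_weak _ _ _ u i) (@H1_weak _ _ _ v i)).

Definition H1zero : H1 Omega :=
  @MkH1 _ _ _ (fun=> 0) (fun _ _ => 0) (L2_0 _ _ mO) (fun=> L2_0 _ _ mO) weak_partial0.

Lemma H1_ext (u v : H1 Omega) :
  (forall x, u x = v x) -> (forall i x, H1grad u i x = H1grad v i x) -> u = v.
Proof.
case: u v => [u gu u2 gu2 wu] [v gv v2 gv2 wv] /= /funext uv guv.
have {}guv : gu = gv by apply/funext => i; apply/funext.
by subst v gv; congr MkH1; exact: Prop_irrelevance.
Qed.

End SobolevSpace.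

Section SobolevLmodule.
Context (R : realType) (n : nat) (Omega : set 'rV[R]_n).

(** The vector space operations of H1 rest on the linearity of integrals over [Omega],
    hence on its measurability; the type records the proof that [Omega] is open, on
    which its instances depend. *)
Definition sobolev (oOmega : open Omega) : Type := H1 Omega.

Variable oOmega : open Omega.
Local Notation H := (sobolev oOmega).

HB.instance Definition _ := gen_eqMixin H.
HB.instance Definition _ := gen_choiceMixin H.

Let add (u v : H) : H := H1comb oOmega 1 u v.
Let opp (u : H) : H := H1comb oOmega (-1) u (H1zero oOmega).
Let scale (c : R) (u : H) : H := H1comb oOmega c u (H1zero oOmega).

Let addA : associative add.
Proof. by move=> u v w; apply: H1_ext => *; rewrite /= !scale1r addrA. Qed.
Let addC : commutative add.
Proof. by move=> u v; apply: H1_ext => *; rewrite /= !scale1r addrC. Qed.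
Let add0 : left_id (H1zero oOmega : H) add.
Proof. by move=> u; apply: H1_ext => *; rewrite /= scale1r add0r. Qed.
Let addN : left_inverse (H1zero oOmega : H) opp add.
Proof.
by move=> u; apply: H1_ext => *; rewrite /= scale1r addr0 scaleN1r addNr.
Qed.
HB.instance Definition _ := GRing.isZmodule.Build H addA addC add0 addN.

Let scaleA c d (u : H) : scale c (scale d u) = scale (c * d) u.
Proof. by apply: H1_ext => *; rewrite /= !addr0 scalerA. Qed.
Let scale1 : left_id 1 scale.
Proof. by move=> u; apply: H1_ext => *; rewrite /= addr0 scale1r. Qed.
Let scaleDr : right_distributive scale +%R.
Proof. by move=> c u v; apply: H1_ext => *; rewrite /= !addr0 !scale1r scalerDr. Qed.
Let scaleDl (u : H) : {morph scale^~ u : c d / c + d}.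
Proof. by move=> c d; apply: H1_ext => *; rewrite /= !addr0 !scale1r scalerDl. Qed.
HB.instance Definition _ :=
  GRing.Zmodule_isLmodule.Build R H scaleA scale1 scaleDr scaleDl.

Lemma sobolev_lin_fun c (u v : H) :
  H1fun (c *: u + v : H) = fun x => c *: u x + v x.
Proof. by apply/funext => x; rewrite /= addr0 scale1r. Qed.

Lemma sobolev_lin_grad c (u v : H) i :
  H1grad (c *: u + v : H) i = fun x => c *: H1grad u i x + H1grad v i x.
Proof. by apply/funext => x; rewrite /= addr0 scale1r. Qed.

Lemma sobolev_sub_fun (u v : H) : H1fun (u - v : H) = fun x => u x - v x.
Proof. by apply/funext => x; rewrite /= scale1r addr0 scaleN1r. Qed.

Lemma sobolev_sub_grad (u v : H) i :
  H1grad (u - v : H) i = fun x => H1grad u i x - H1grad v i x.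
Proof. by apply/funext => x; rewrite /= scale1r addr0 scaleN1r. Qed.

End SobolevLmodule.

Section SobolevHilbert.
Context (R : realType) (n : nat) (Omega : set 'rV[R]_n) (oOmega : open Omega).
Local Notation leb := (@lebesgue_rV R n).
Local Notation Cl := (clifford R n).
Local Notation H := (sobolev oOmega).
Let mO := measurable_domain oOmega.
Implicit Types (u v w : H).

Definition L2ip u v : R := cl2 leb Omega u v.

Definition gradip u v : R := \sum_i cl2 leb Omega (H1grad u i) (H1grad v i).

Definition H1ip u v : R := L2ip u v + gradip u v.

Lemma L2ip_semi_inner : semi_inner L2ip.
Proof.
split=> [u v|c u v w|u]; [exact: cl2C| |exact: cl2_ge0].
rewrite /L2ip -(cl2P mO c (H1fun_L2 u) (H1fun_L2 v) (H1fun_L2 w)).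
exact: (congr1 (fun f => cl2 leb Omega f w) (sobolev_lin_fun c u v)).
Qed.

Lemma gradip_semi_inner : semi_inner gradip.
Proof.
split=> [u v|c u v w|u].
- by apply: eq_bigr => i _; rewrite cl2C.
- rewrite mulr_sumr -big_split; apply: eq_bigr => i _ /=.
  rewrite -(cl2P mO c (H1grad_L2 u i) (H1grad_L2 v i) (H1grad_L2 w i)).
  exact: (congr1 (fun f => cl2 leb Omega f (H1grad w i)) (sobolev_lin_grad c u v i)).
- by apply: sumr_ge0 => i _; exact: cl2_ge0.
Qed.

Lemma H1ip_semi_inner : semi_inner H1ip.
Proof.
split=> [u v|c u v w|u]; rewrite /H1ip.
- by rewrite (ipC L2ip_semi_inner) (ipC gradip_semi_inner).
- by rewrite (ipP L2ip_semi_inner) (ipP gradip_semi_inner); ring.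
- by rewrite addr_ge0 ?(ip_ge0 L2ip_semi_inner) ?(ip_ge0 gradip_semi_inner).
Qed.

Lemma L2norm_hnorm u : L2norm leb Omega u = hnorm L2ip u.
Proof.
rewrite -[LHS]ger0_norm ?sqrtr_ge0 // -sqrtr_sqr.
by rewrite (L2norm_sqr mO (H1fun_L2 u)).
Qed.

Lemma Dnorm_hnorm u : Dnorm u = hnorm gradip u.
Proof.
congr Num.sqrt; apply: eq_bigr => i _; exact: (L2norm_sqr mO (H1grad_L2 u i)).
Qed.

Lemma H1norm_hnorm u : H1norm u = hnorm H1ip u.
Proof.
rewrite /H1norm L2norm_hnorm Dnorm_hnorm !hnorm_sqr //.
  exact: gradip_semi_inner.
exact: L2ip_semi_inner.
Qed.

(** Functions and gradients converge separately in [L^2]; pairing with a test function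
    and with its derivative is continuous in [L^2], so the limit of the gradients is the
    weak gradient of the limit. *)
Lemma H1ip_complete : complete_inner H1ip.
Proof.
move=> u cau.
have u2 k := H1fun_L2 (u k); have g2 i k := H1grad_L2 (u k) i.
have [|l [l2 lcv]] := cl2_complete mO u2.
  move=> e e0; have [N NP] := cau e e0; exists N => k k' Nk Nk'.
  apply: le_trans (NP k k' Nk Nk'); rewrite /H1ip /L2ip sobolev_sub_fun lerDl.
  exact: (ip_ge0 gradip_semi_inner).
have /choice[g gP] : forall i, exists g, L2 leb Omega g /\
    forall e, 0 < e -> exists N, forall k, (N <= k)%N ->
      cl2 leb Omega (fun x => g x - H1grad (u k) i x) (fun x => g x - H1grad (u k) i x) <= e.
  move=> i; apply: (cl2_complete mO (g2 i)) => e e0.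
  have [N NP] := cau e e0; exists N => k k' Nk Nk'.
  apply: le_trans (NP k k' Nk Nk'); rewrite /H1ip /gradip (bigD1 i) // sobolev_sub_grad.
  rewrite addrCA lerDl addr_ge0 ?(ip_ge0 L2ip_semi_inner) //.
  by apply: sumr_ge0 => j _; exact: cl2_ge0.
have weak i : weak_partial Omega i l (g i).
  apply/weak_partialP => phi phiT A.
  have phi2 := test_sqint oOmega phiT.
  have dphi2 := test_partial_sqint oOmega i phiT.
  have [gi2 gicv] := gP i.
  have lA := L2_coef mO A l2; have giA := L2_coef mO A gi2.
  set a := sqip leb Omega _ _; set b := sqip leb Omega _ _.
  apply/eqP; rewrite -subr_eq0 opprK -sqrf_eq0 eq_le sqr_ge0 andbT.
  apply/ler_addgt0Pr => e e0; rewrite add0r.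
  pose P := sqip leb Omega (partial i phi) (partial i phi).
  pose Q := sqip leb Omega phi phi.
  have P0 : 0 <= P := sqip_ge0 leb Omega (partial i phi).
  have Q0 : 0 <= Q := sqip_ge0 leb Omega phi.
  pose C := P + Q + 1.
  have C0 : 0 < C by rewrite ltr_wpDl ?addr_ge0.
  pose d := e / (2 * C).
  have d0 : 0 < d by rewrite divr_gt0 // mulr_gt0.
  have [N1 N1P] := lcv _ d0; have [N2 N2P] := gicv _ d0.
  pose k := maxn N1 N2.
  have ukA := L2_coef mO A (u2 k); have gkA := L2_coef mO A (g2 i k).
  have split_sqip f1 f2 h : sqint leb Omega f1 -> sqint leb Omega f2 -> sqint leb Omega h ->
      sqip leb Omega h f1 - sqip leb Omega h f2 = sqip leb Omega h (fun x => f1 x - f2 x).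
    move=> f12 f22 h2; rewrite (_ : (fun x => _ - _) = fun x => (-1) * f2 x + f1 x); last first.
      by apply/funext => x; rewrite mulN1r addrC.
    by rewrite sqipPr // mulN1r addrC.
  have coef_le (f : 'rV[R]_n -> Cl) (f1 : 'rV[R]_n -> Cl) :
      sqip leb Omega (fun x => f x A - f1 x A) (fun x => f x A - f1 x A) <=
      cl2 leb Omega (fun x => f x - f1 x) (fun x => f x - f1 x).
    rewrite /cl2 (bigD1 A) //= (_ : (fun x => (f x - f1 x) A) = fun x => f x A - f1 x A).
      by rewrite lerDl sumr_ge0 // => B _; exact: sqip_ge0.
    by apply/funext => x; rewrite !ffunE.
  have /weak_partialP/(_ phi phiT A) wk := @H1_weak _ _ _ (u k) i.
  have -> : a + b = sqip leb Omega (partial i phi) (fun x => l x A - u k x A) +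
      sqip leb Omega phi (fun x => g i x A - H1grad (u k) i x A).
    by rewrite -!split_sqip // wk /a /b; ring.
  have h1 := le_trans (coef_le l (H1fun (u k))) (N1P k (leq_maxl _ _)).
  have h2 := le_trans (coef_le (g i) (H1grad (u k) i)) (N2P k (leq_maxr _ _)).
  have s1 := le_trans (sqip_sqr_le mO dphi2 (sqintB mO lA ukA)) (ler_wpM2l P0 h1).
  have s2 := le_trans (sqip_sqr_le mO phi2 (sqintB mO giA gkA)) (ler_wpM2l Q0 h2).
  set x := sqip _ _ _ _ in s1 *; set y := sqip _ _ _ _ in s2 *.
  have dC : d * C = e / 2 by rewrite /d; field; rewrite gt_eqF.
  have := sqr_ge0 (x - y).
  rewrite -/P in s1; rewrite -/Q in s2.
  move: s1 s2 dC d0; clearbody d x y P Q; rewrite /C; lra.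
pose L : H := @MkH1 _ _ _ l g l2 (fun i => (gP i).1) weak.
exists L => e e0; pose K : R := n.+1%:R.
have K0 : 0 < K by rewrite ltr0n.
have eK : 0 < e / K by rewrite divr_gt0.
have [N1 N1P] := lcv _ eK.
have [|N2 N2P] := finite_eventually (P := fun i k => cl2 leb Omega
    (fun x => g i x - H1grad (u k) i x) (fun x => g i x - H1grad (u k) i x) <= e / K).
  by move=> i; exact: (gP i).2.
exists (maxn N1 N2) => k; rewrite geq_max => /andP[Nk1 Nk2].
have -> : e = e / K + \sum_(i < n) e / K.
  by rewrite sumr_const card_ord -mulrS -mulr_natr mulfVK // gt_eqF.
apply: lerD.
  by apply: le_trans (N1P k Nk1); rewrite /L2ip sobolev_sub_fun.
apply: ler_sum => i _; apply: le_trans (N2P k Nk2 i).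
by rewrite sobolev_sub_grad.
Qed.

End SobolevHilbert.

(** * Right multiplication and the trace *)

Lemma sqip_sumr (R : realType) d (T : measurableType d) (mu : {measure set T -> \bar R})
    (D : set T) (mD : measurable D) (I : Type) (r : seq I) (c : I -> R)
    (F : I -> T -> R) (h : T -> R) :
  (forall i, sqint mu D (F i)) -> sqint mu D h ->
  sqip mu D h (fun x => \sum_(i <- r) c i * F i x) =
  \sum_(i <- r) c i * sqip mu D h (F i).
Proof.
move=> F2 h2; elim: r => [|i r IH].
  rewrite big_nil /sqip; under eq_Rintegral do rewrite big_nil mulr0.
  by rewrite Rintegral_cst // mul0r.
rewrite big_cons -IH -sqipPr //; last exact: sqint_sum.
by congr sqip; apply/funext => x; rewrite big_cons.
Qed.

Section RightMultiplication.
Context (R : realType) (n : nat) (Omega : set 'rV[R]_n) (oOmega : open Omega).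
Local Notation leb := (@lebesgue_rV R n).
Local Notation Cl := (clifford R n).
Let mO := measurable_domain oOmega.

Lemma weak_partial_mulr i (u g : 'rV[R]_n -> Cl) (z : Cl) :
  L2 leb Omega u -> L2 leb Omega g -> weak_partial Omega i u g ->
  weak_partial Omega i (fun x => u x * z) (fun x => g x * z).
Proof.
move=> /(L2P _ mO) u2 /(L2P _ mO) g2 /weak_partialP ug; apply/weak_partialP => phi phiT A.
have coefE (f : 'rV[R]_n -> Cl) : (fun x => (f x * z) A : R) = fun x =>
    \sum_B (csign R B (symdiff B A) * z (symdiff B A)) * f x B.
  by apply/funext => x; rewrite mul_coef; apply: eq_bigr => B _; rewrite mulrAC.
have phi2 := test_sqint oOmega phiT.
have dphi2 := test_partial_sqint oOmega i phiT.
rewrite !coefE (sqip_sumr mO _ _ u2 dphi2) (sqip_sumr mO _ _ g2 phi2) -sumrN.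
by apply: eq_bigr => B _; rewrite ug // mulrN.
Qed.

Definition H1mulr (u : sobolev oOmega) (z : Cl) : sobolev oOmega :=
  @MkH1 _ _ _ (fun x => u x * z) (fun i x => H1grad u i x * z)
    (L2_mulr mO z (H1fun_L2 u)) (fun i => L2_mulr mO z (H1grad_L2 u i))
    (fun i => weak_partial_mulr z (H1fun_L2 u) (H1grad_L2 u i) (@H1_weak _ _ _ u i)).

Lemma H1mulr1 u : H1mulr u 1 = u.
Proof. by apply: H1_ext => *; rewrite /= mulr1. Qed.

End RightMultiplication.

Section Trace.
Context (R : realType) (n : nat) (Omega : set 'rV[R]_n) (oOmega : open Omega).
Local Notation leb := (@lebesgue_rV R n).
Local Notation surf := (surface R n).
Local Notation bd := (boundary Omega).
Local Notation Cl := (clifford R n).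
Local Notation H := (sobolev oOmega).
Variable tau : H1 Omega -> 'rV[R]_n -> Cl.
Hypothesis tauP : dirichlet_trace tau.

Lemma measurable_boundary :
  measurable (bd : set (caratheodory_type (@hausdorff_outer R n n.-1))).
Proof.
apply: caratheodory_closed; first exact: hausdorff_halfspace.
apply: closedI; first exact: closed_closure.
by apply: open_closedC; exact: open_interior.
Qed.

Let mB := measurable_boundary.

Lemma trace_comb (c : Cl) (u v w : H1 Omega) :
  (forall x, w x = u x * c + v x) ->
  {ae surf, forall x, bd x -> tau w x = tau u x * c + tau v x}.
Proof. by move=> E; apply: (trace_linear tauP); apply: aeW => x _. Qed.

(** Linearity applied to [0 = 0 * 1 + 0]. *)
Lemma trace0 : {ae surf, forall x, bd x -> tau (0 : H) x = 0}.
Proof.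
have h : forall x, (0 : H) x = (0 : H) x * 1 + (0 : H) x by move=> x; rewrite /= mul0r add0r.
apply: (ae_mono (trace_comb h)) => x E bx; apply: (addrI (tau (0 : H) x)).
by rewrite addr0 [RHS]E // mulr1.
Qed.

Lemma trace_lin (c : R) (u v : H) :
  {ae surf, forall x, bd x -> tau (c *: u + v : H) x = c *: tau u x + tau v x}.
Proof.
have h : forall x, (c *: u + v : H) x = u x * c%:A + v x.
  by move=> x; rewrite sobolev_lin_fun -scalerAr mulr1.
by apply: (ae_mono (trace_comb h)) => x + bx => -> //; rewrite -scalerAr mulr1.
Qed.

Lemma trace_mulr (u : H) (z : Cl) :
  {ae surf, forall x, bd x -> tau (H1mulr u z) x = tau u x * z}.
Proof.
have h : forall x, H1mulr u z x = u x * z + (0 : H) x by move=> x; rewrite /= addr0.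
by apply: (ae_mono2 (trace_comb h) trace0) => x h1 h0 bx; rewrite h1 // h0 // addr0.
Qed.

Let normset := [set L2norm surf bd (tau u) | u in [set u : H1 Omega | H1norm u <= 1]].

Lemma H1norm_ge0 (u : H1 Omega) : 0 <= H1norm u. Proof. exact: sqrtr_ge0. Qed.

Lemma H1norm0 : H1norm (0 : H) = 0.
Proof.
rewrite (H1norm_hnorm (0 : H)) /hnorm (ip0l (H1ip_semi_inner oOmega)).
by rewrite sqrtr0.
Qed.

Let normset_sup : has_sup normset.
Proof.
split; first by exists (L2norm surf bd (tau (0 : H))), (0 : H) => //=; rewrite H1norm0.
have [K KP] := trace_bounded tauP; exists `|K| => _ [u /= u1 <-].
apply: le_trans (KP u) _; apply: le_trans (ler_wpM2r (H1norm_ge0 u) (ler_norm K)) _.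
by rewrite -[leRHS]mulr1 ler_wpM2l.
Qed.

Lemma trace_norm_ge0 : 0 <= trace_norm tau.
Proof.
apply: (@le_trans _ _ (L2norm surf bd (tau (0 : H)))); first exact: sqrtr_ge0.
apply: ub_le_sup; first by case: normset_sup.
by exists (0 : H) => //=; rewrite H1norm0.
Qed.

(** The norm is a supremum over the unit ball, so the bound follows by scaling.  When
    [H1norm u = 0], which does not force [u] to vanish everywhere, some multiple of
    [H1norm u] still bounds the trace. *)
Lemma trace_norm_bound (u : H) :
  cl2 surf bd (tau u) (tau u) <= trace_norm tau ^+ 2 * H1norm u ^+ 2.
Proof.
have tu2 := trace_L2 tauP u.
have [u0|u0] := eqVneq (H1norm u) 0.
  have [K KP] := trace_bounded tauP; have := KP u; rewrite u0 mulr0 => tu0.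
  rewrite -L2norm_sqr // expr0n mulr0 /=.
  by rewrite (_ : L2norm _ _ _ = 0) ?expr0n //; apply/eqP; rewrite eq_le tu0 sqrtr_ge0.
have u_gt0 : 0 < H1norm u by rewrite lt_def u0 H1norm_ge0.
set t := H1norm u in u_gt0 u0 *.
pose w : H := t^-1 *: u + 0.
have w1 : H1norm w = 1.
  rewrite (H1norm_hnorm w) /w addr0 (hnormZ (H1ip_semi_inner oOmega)) -(H1norm_hnorm u) -/t.
  by rewrite ger0_norm ?invr_ge0 ?(ltW u_gt0) // mulVf.
have tw2 := trace_L2 tauP w.
have Ew : cl2 surf bd (tau w) (tau w) = t^-1 ^+ 2 * cl2 surf bd (tau u) (tau u).
  have h : {ae surf, forall x, bd x -> tau w x = t^-1 *: tau u x}.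
    apply: (ae_mono2 trace0 (trace_lin t^-1 u (0 : H))) => x h0 h bx.
    by rewrite h // h0 // addr0.
  have tu2' := L2Z mB t^-1 tu2.
  rewrite (ae_eq_cl2 mB tw2 tu2' tw2 tu2' h h).
  by rewrite cl2Zl // cl2Zr // mulrA expr2.
have : L2norm surf bd (tau w) <= trace_norm tau.
  apply: ub_le_sup; first by case: normset_sup.
  by exists w => //=; rewrite w1.
rewrite -(@ler_sqr _ (L2norm _ _ _)) ?nnegrE ?sqrtr_ge0 ?trace_norm_ge0 //.
by rewrite L2norm_sqr // Ew exprVn mulrC ler_pdivrMr // exprn_gt0.
Qed.

End Trace.

(** * Inequalities between real numbers *)

Section RealInequalities.
Context (R : realType).

Lemma sum_mul_sqr_le (I : finType) (x y : I -> R) :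
  (\sum_i x i * y i) ^+ 2 <= (\sum_i x i ^+ 2) * \sum_i y i ^+ 2.
Proof.
rewrite mulrC; apply: quadratic_ge0_discr => [|t].
  by apply: sumr_ge0 => i _; exact: sqr_ge0.
have -> : (\sum_i y i ^+ 2) * t ^+ 2 + 2 * (\sum_i x i * y i) * t + \sum_i x i ^+ 2 =
    \sum_i (x i + t * y i) ^+ 2.
  rewrite mulr_suml mulr_sumr mulr_suml -!big_split; apply: eq_bigr => i _ /=.
  by ring.
by apply: sumr_ge0 => i _; exact: sqr_ge0.
Qed.

(** The smaller eigenvalue of the symmetric matrix with diagonal [p], [r] and off-diagonal
    entries of square [q2]. *)
Definition min_eigen (p r q2 : R) : R :=
  (p + r - Num.sqrt ((p - r) ^+ 2 + 4 * q2)) / 2.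

Lemma min_eigen_gt0 (p r q2 : R) : 0 < p -> 0 <= q2 -> q2 / p < r ->
  0 < min_eigen p r q2.
Proof.
move=> p0 q0 qr; have r0 : 0 < r by apply: le_lt_trans qr; rewrite divr_ge0 // ltW.
rewrite /min_eigen divr_gt0 // subr_gt0 -(@ltr_sqr _ (Num.sqrt _)) ?nnegrE ?sqrtr_ge0 //; last first.
  by rewrite addr_ge0 // ltW.
rewrite sqr_sqrtr; last by rewrite addr_ge0 ?sqr_ge0 // mulr_ge0.
move: qr; rewrite ltr_pdivrMr //; lra.
Qed.

(** Subtracting the eigenvalue [l] from the diagonal leaves a matrix of determinant zero
    with nonnegative diagonal, which is positive semidefinite. *)
Lemma min_eigen_le (p r q x y : R) : 0 <= x -> 0 <= y ->
  min_eigen p r (q ^+ 2) * (x ^+ 2 + y ^+ 2) <= p * x ^+ 2 - 2 * q * x * y + r * y ^+ 2.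
Proof.
move=> x0 y0; set l := min_eigen _ _ _.
set S := Num.sqrt ((p - r) ^+ 2 + 4 * q ^+ 2).
have S2 : S ^+ 2 = (p - r) ^+ 2 + 4 * q ^+ 2.
  by rewrite sqr_sqrtr // addr_ge0 ?sqr_ge0 // mulr_ge0 ?sqr_ge0.
have S0 : 0 <= S := sqrtr_ge0 _.
have Spr : `|p - r| <= S.
  by rewrite -(@ler_sqr _ `|_|) ?nnegrE // real_normK ?num_real // S2 lerDl mulr_ge0 ?sqr_ge0.
move: Spr; rewrite ler_norml => /andP[S1 S3].
have lE : l = (p + r - S) / 2 by [].
pose a := p - l; pose c := r - l.
have a0 : 0 <= a by rewrite /a lE; lra.
have c0 : 0 <= c by rewrite /c lE; lra.
have ac : a * c = q ^+ 2.
  rewrite /a /c lE; move: S2; move: S {S0 S1 S3 lE a0 c0} => S S2.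
  have -> : (p - (p + r - S) / 2) * (r - (p + r - S) / 2) = (S ^+ 2 - (p - r) ^+ 2) / 4 by field.
  by rewrite S2; field.
suff : 0 <= a * x ^+ 2 - 2 * q * x * y + c * y ^+ 2 by rewrite /a /c; lra.
have [a_eq|a_neq] := eqVneq a 0.
  have : q ^+ 2 = 0 by rewrite -ac a_eq mul0r.
  move/eqP; rewrite sqrf_eq0 => /eqP ->.
  by rewrite a_eq mulr0 !mul0r subr0 add0r mulr_ge0 ?sqr_ge0.
have ap : 0 < a by rewrite lt_def a_neq.
rewrite -(pmulr_rge0 _ ap).
have -> : a * (a * x ^+ 2 - 2 * q * x * y + c * y ^+ 2) = (a * x - q * y) ^+ 2 + (a * c - q ^+ 2) * y ^+ 2.
  by ring.
by rewrite ac subrr mul0r addr0 sqr_ge0.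
Qed.

(** The estimate behind the boundedness of the form: [gu], [gv] and [lv] are norms of a
    partial derivative of [u], of one of [v] and of [v] itself, and [U], [V] the H1 norms. *)
Lemma lower_order_bound (x y gu gv lv A B C S U V : R) :
  0 <= gu -> 0 <= gv -> 0 <= lv -> 0 <= A -> 0 <= B -> 0 <= C -> 0 <= S ->
  gu <= U -> gv <= V -> lv <= V ->
  `|x - y| <= 2 * S * (gu * A) * lv + gu * B * (C * V) ->
  `|y| <= gu * (A ^+ 2 * gv) ->
  `|x| <= (A ^+ 2 + 2 * S * A + B * C) * U * V.
Proof.
move=> gu0 gv0 lv0 A0 B0 C0 S0 guU gvV lvV h1 h2.
have V0 := le_trans lv0 lvV.
have : `|x| <= `|x - y| + `|y| by rewrite -{1}(subrK y x) ler_normD.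
move=> /le_trans; apply; apply: le_trans (lerD h1 h2) _.
have e1 : A ^+ 2 * (gu * gv) <= A ^+ 2 * (U * V).
  by rewrite ler_wpM2l ?sqr_ge0 // ler_pM.
have e2 : S * A * (gu * lv) <= S * A * (U * V).
  by apply: ler_wpM2l; [exact: mulr_ge0|exact: ler_pM].
have e3 : B * C * (gu * V) <= B * C * (U * V).
  by apply: ler_wpM2l; [exact: mulr_ge0|exact: ler_wpM2r].
lra.
Qed.

(** The estimates of the single terms, summed over the index [i] with the Cauchy-Schwarz
    inequality.  Here [G i] is the norm of the [i]-th partial derivative, [x i] the [i]-th
    summand of the form and [p i] its principal part, [A i] and [B i] bound the
    coefficients of the drift and of the singular term, and [z] is the boundary term. *)
Lemma garding_inequality (I : finType) (G A B x p : I -> R)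
    (gd l h M M' C S0 S e m2 z : R) :
  (forall i, 0 <= G i) -> (forall i, 0 <= A i) -> (forall i, 0 <= B i) ->
  \sum_i G i ^+ 2 = gd ^+ 2 -> \sum_i A i ^+ 2 = M ^+ 2 ->
  \sum_i B i ^+ 2 = M' ^+ 2 ->
  0 <= gd -> 0 <= l -> 0 <= h -> 0 <= M -> 0 <= M' -> 0 <= C -> 0 <= S0 ->
  h ^+ 2 = gd ^+ 2 + l ^+ 2 ->
  (forall i, m2 * G i ^+ 2 <= p i) ->
  (forall i, `|x i - p i| <= 2 * S0 * (G i * A i) * l + G i * B i * (C * h)) ->
  - (e * h ^+ 2) <= z ->
  min_eigen (m2 - (C * M' + e)) (S - (C * M' + e)) ((M * S0) ^+ 2) *
    (gd ^+ 2 + l ^+ 2) <= \sum_i x i + S * l ^+ 2 + z.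
Proof.
move=> G0 A0 B0 GE AE BE gd0 l0 h0 M0 M'0 C0 S00 hE pG xp ez.
have gdh : gd <= h by rewrite -(@ler_sqr _ gd) ?nnegrE // hE lerDl sqr_ge0.
have sum_le (Y : I -> R) K : (forall i, 0 <= Y i) -> 0 <= K ->
    \sum_i Y i ^+ 2 = K ^+ 2 -> \sum_i G i * Y i <= gd * K.
  move=> Y0 K0 YE; rewrite -(@ler_sqr _ (\sum_i _)) ?nnegrE ?mulr_ge0 //; last first.
    by apply: sumr_ge0 => i _; rewrite mulr_ge0.
  by apply: le_trans (sum_mul_sqr_le _ _) _; rewrite GE YE exprMn.
have drift := sum_le A M A0 M0 AE; have sing := sum_le B M' B0 M'0 BE.
have low : m2 * gd ^+ 2 - 2 * S0 * (gd * M) * l - gd * M' * (C * h) <= \sum_i x i.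
  apply: (@le_trans _ _ (\sum_i (m2 * G i ^+ 2 - 2 * S0 * (G i * A i) * l
      - G i * B i * (C * h)))); last first.
    by apply: ler_sum => i _; have := xp i; have := pG i; rewrite ler_norml => ? /andP[? _]; lra.
  rewrite !sumrB -mulr_sumr GE -!mulr_suml -mulr_sumr.
  have d1 : 2 * S0 * (\sum_i G i * A i) * l <= 2 * S0 * (gd * M) * l.
    by apply: ler_wpM2r => //; apply: ler_wpM2l => //; rewrite mulr_ge0.
  have d2 : (\sum_i G i * B i) * (C * h) <= gd * M' * (C * h).
    by apply: ler_wpM2r => //; rewrite mulr_ge0.
  lra.
have sing_le : C * M' * (gd * h) <= C * M' * h ^+ 2.
  by apply: ler_wpM2l; [exact: mulr_ge0|rewrite expr2 ler_wpM2r].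
apply: le_trans (min_eigen_le _ _ _ gd0 l0) _.
move: low ez sing_le; rewrite hE; move: (\sum_i x i) => X; lra.
Qed.

(** A finite l^2 norm of extended reals has finite entries, and then it is the Euclidean
    norm of their real values. *)
Lemma ell2_finite (I : finType) (F : I -> \bar R) : (forall i, (0 <= F i)%E) ->
  ((\sum_i F i ^+ 2) `^ 2^-1 < +oo)%E ->
  [/\ forall i, (F i < +oo)%E,
      0 <= fine ((\sum_i F i ^+ 2) `^ 2^-1)%E &
      fine ((\sum_i F i ^+ 2) `^ 2^-1)%E ^+ 2 = \sum_i fine (F i) ^+ 2].
Proof.
move=> F0 fin; have sfin : (\sum_i F i ^+ 2 < +oo)%E.
  by apply: (@lty_poweRy _ _ 2^-1).
have Fi i : (F i < +oo)%E.
  have : (F i ^+ 2 < +oo)%E.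
    apply: le_lt_trans sfin; rewrite (bigD1 i) //= leeDl // sume_ge0 // => j _.
    exact: mule_ge0.
  by rewrite !ltey; apply: contraNN => /eqP ->.
have FE i : F i = (fine (F i))%:E by rewrite fineK // ge0_fin_numE.
have E : ((\sum_i F i ^+ 2) `^ 2^-1)%E = (Num.sqrt (\sum_i fine (F i) ^+ 2))%:E.
  under eq_bigr do rewrite FE -EFin_expe.
  rewrite sumEFin poweR_EFin powR12_sqrt // sumr_ge0 // => i _; exact: sqr_ge0.
rewrite E; split=> //=.
by rewrite sqr_sqrtr // sumr_ge0 // => i _; exact: sqr_ge0.
Qed.

End RealInequalities.

(** * The coefficients *)

Section Coefficients.
Context (R : realType) (n : nat) (Omega : set 'rV[R]_n).
Hypothesis oOmega : open Omega.
Local Notation leb := (@lebesgue_rV R n).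
Local Notation V := ('rV[R]_n).

Lemma Lpnorm_infty_le d (T : measurableType d) (mu : {measure set T -> \bar R})
    (D : set T) (f g : T -> R) : (forall x, `|f x| <= `|g x|) ->
  (Lpnorm mu D +oo f <= Lpnorm mu D +oo g)%E.
Proof.
move=> fg; rewrite /Lpnorm unlock; case: ifP => // _.
apply: le_ess_sup; apply: nearW => x /=; rewrite /patch; case: ifP => // _ /=.
by rewrite lee_fin.
Qed.

Lemma coef_min_le (a : 'I_n -> V -> R) i x : Omega x ->
  (0 < coef_min Omega a)%E -> fine (coef_min Omega a) <= a i x.
Proof.
move=> Ox m0; have le : (coef_min Omega a <= (a i x)%:E)%E.
  rewrite /coef_min; apply: le_trans (bigmin_le _ i _) _ => //.
  by apply: ereal_inf_lbound; exists x.
by rewrite -lee_fin fineK // gt0_fin_numE // (le_lt_trans le) // ltry.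
Qed.

Lemma within_closure_measurable (g : V -> R) :
  {within closure Omega, continuous g} ->
  measurable_fun (Omega : set (caratheodory_type (@lebesgue_outer R n))) g.
Proof.
move=> cg; apply: caratheodory_continuous => // [i c|].
  exact: lebesgue_halfspace.
rewrite -continuous_open_subspace //.
exact: continuous_subspaceW (@subset_closure _ _) cg.
Qed.

Lemma C1_measurable (a : V -> R) : C1_closure Omega a ->
  measurable_fun (Omega : set (caratheodory_type (@lebesgue_outer R n))) a.
Proof. by case=> ca _; exact: within_closure_measurable. Qed.

Lemma C1_partial_measurable (a : V -> R) j : C1_closure Omega a ->
  measurable_fun (Omega : set (caratheodory_type (@lebesgue_outer R n))) (partial j a).
Proof.
case=> _ /(_ j)[_ [g cg ag]].
apply: eq_measurable_fun (within_closure_measurable cg) => x.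
by rewrite inE => /ag.
Qed.

End Coefficients.

(** * The Robin form *)

Section CliffordL2Bounds.
Context (R : realType) (n : nat) d (T : measurableType d).
Context (mu : {measure set T -> \bar R}) (D : set T).
Hypothesis mD : measurable D.
Implicit Types f g : T -> clifford R n.

Lemma cl2_le (x y : R) f g : L2 mu D f -> L2 mu D g -> 0 <= x -> 0 <= y ->
  cl2 mu D f f <= x ^+ 2 -> cl2 mu D g g <= y ^+ 2 -> `|cl2 mu D f g| <= x * y.
Proof.
move=> f2 g2 x0 y0 fx gy.
rewrite -(@ler_sqr _ `|_|) ?nnegrE ?mulr_ge0 // real_normK ?num_real //.
apply: le_trans (cl2_sqr_le mD f2 g2) _; rewrite exprMn.
by apply: ler_pM => //; exact: cl2_ge0.
Qed.

Lemma integrable_cdot f g : L2 mu D f -> L2 mu D g ->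
  mu.-integrable D (EFin \o (fun x => cdot (f x) (g x))).
Proof.
move=> f2 g2.
have := integrable_sum mD (index_enum _) (fun B (_ : xpredT B) => integrable_coefM mD B f2 g2).
by apply: eq_integrable => // x _; rewrite /= -sumEFin.
Qed.

Lemma cl2_cgen_mul i f : L2 mu D f ->
  cl2 mu D (fun x => cgen R i * f x) (fun x => cgen R i * f x) = cl2 mu D f f.
Proof.
move=> f2; have ef2 := L2_mull mD (cgen R i) f2.
by rewrite !cl2E //; apply: eq_Rintegral => x _; rewrite cdot_cgen_mul.
Qed.

(** The pointwise identity for vectors, integrated: no triangle inequality is needed to
    pass from the entries of the vector to its length. *)
Lemma cl2_vector_mul (beta : 'I_n -> T -> R) f :
  (forall j, L2 mu D (fun x => beta j x *: f x)) ->
  L2 mu D (fun x => (\sum_j beta j x *: cgen R j) * f x) /\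
  cl2 mu D (fun x => (\sum_j beta j x *: cgen R j) * f x)
           (fun x => (\sum_j beta j x *: cgen R j) * f x) =
  \sum_j cl2 mu D (fun x => beta j x *: f x) (fun x => beta j x *: f x).
Proof.
move=> bf2.
have vE : (fun x => (\sum_j beta j x *: cgen R j) * f x) =
    fun x => \sum_j cgen R j * (beta j x *: f x).
  apply/funext => x; rewrite mulr_suml; apply: eq_bigr => j _.
  by rewrite -scalerAl -scalerAr.
have vf2 : L2 mu D (fun x => (\sum_j beta j x *: cgen R j) * f x).
  rewrite vE; apply: (@L2_sum _ _ _ _ _ _ mD _ _ (fun j x => cgen R j * (beta j x *: f x))) => j.
  exact: L2_mull.
split=> //; rewrite cl2E //.
under [RHS]eq_bigr do rewrite cl2E //.
rewrite -Rintegral_sum //; last by move=> j; exact: integrable_cdot.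
apply: eq_Rintegral => x _; rewrite cdot_vector_mul; apply: eq_bigr => j _.
by rewrite cdotZr cdotC cdotZr mulrA expr2.
Qed.

End CliffordL2Bounds.

(** The common shape of the two linearity proofs: a principal, a mass and a boundary term. *)
Lemma sum3_linear (R : comRingType) (c p X x x' Y y y' Z z z' : R) :
  X = c * x + x' -> Y = c * y + y' -> Z = c * z + z' ->
  X + p * Y + Z = c * (x + p * y + z) + (x' + p * y' + z').
Proof. by move=> -> -> ->; ring. Qed.

Section RobinForm.
Context (R : realType) (n : nat) (Omega : set 'rV[R]_n) (oOmega : open Omega).
Local Notation leb := (@lebesgue_rV R n).
Local Notation surf := (surface R n).
Local Notation bd := (boundary Omega).
Local Notation Cl := (clifford R n).
Local Notation V := 'rV[R]_n.
Local Notation H := (sobolev oOmega).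
Variables (tau : H1 Omega -> V -> Cl) (a : 'I_n -> V -> R) (b : V -> R) (CS : R) (s : Cl).
Hypotheses (n3 : (3 <= n)%N) (tauP : dirichlet_trace tau).
Hypothesis b_Linfty : Linfty surf bd b.
Hypothesis a_C1 : forall i, C1_closure Omega (a i).
Hypothesis a_gt0 : forall i x, Omega x -> 0 < a i x.
Hypothesis ma_gt0 : (0 < coef_min Omega a)%E.
Hypothesis Ma_fin : (coef_max Omega a < +oo)%E.
Hypothesis Ma'_fin : (coef_max' Omega a < +oo)%E.
Hypothesis CS_ge0 : 0 <= CS.
Hypothesis CS_sobolev : forall u : H1 Omega,
  (Lpnorm leb Omega (2 * n%:R / (n%:R - 2))%:E (fun x => cnorm (u x))
    <= (CS * H1norm u)%:E)%E.
Implicit Types (u v w : H).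

Let mO := measurable_domain oOmega.
Let mB := measurable_boundary Omega.

Local Notation asup i := (fine (Lpnorm leb Omega +oo (a i))).
Local Notation bcoef i j := (fun x => a j x * partial j (a i) x).
Local Notation bnorm i j := (fine (Lpnorm leb Omega n%:R%:E (bcoef i j))).
Local Notation Brow i := (Num.sqrt (\sum_j bnorm i j ^+ 2)).
Local Notation ma := (fine (coef_min Omega a)).
Local Notation Ma := (fine (coef_max Omega a)).
Local Notation Ma' := (fine (coef_max' Omega a)).
Local Notation bneg := (fine (Lpnorm surf bd +oo (fun x => Num.min (b x) 0))).
Local Notation bsup := (fine (Lpnorm surf bd +oo b)).
Local Notation N f := (Num.sqrt (cl2 leb Omega f f)).

Lemma asup_ge0 i : 0 <= asup i.
Proof. by rewrite fine_ge0 // Lpnorm_ge0. Qed.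

Lemma a_measurable i :
  measurable_fun (Omega : set (caratheodory_type (@lebesgue_outer R n))) (a i).
Proof. exact: C1_measurable (a_C1 i). Qed.

Lemma bcoef_measurable i j :
  measurable_fun (Omega : set (caratheodory_type (@lebesgue_outer R n))) (bcoef i j).
Proof.
by apply: measurable_funM; [exact: a_measurable|exact: C1_partial_measurable (a_C1 i)].
Qed.

Lemma a_bounded i : {ae leb, forall x, Omega x -> `|a i x| <= asup i}.
Proof.
apply: Lpnorm_infty_ae; have [h _ _] := ell2_finite (fun i => Lpnorm_ge0 leb Omega +oo (a i)) Ma_fin.
exact: h.
Qed.

Lemma a_sqr_bounded i : {ae leb, forall x, Omega x -> `|a i x ^+ 2| <= asup i ^+ 2}.
Proof.
apply: ae_mono (a_bounded i) _ => x h Ox.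
by rewrite normrX ler_sqr ?nnegrE ?asup_ge0 // h.
Qed.

Lemma Ma_ge0 : 0 <= Ma.
Proof. by have [] := ell2_finite (fun i => Lpnorm_ge0 leb Omega +oo (a i)) Ma_fin. Qed.

Lemma Ma_sqr : Ma ^+ 2 = \sum_i asup i ^+ 2.
Proof. by have [] := ell2_finite (fun i => Lpnorm_ge0 leb Omega +oo (a i)) Ma_fin. Qed.

Let Ma'_facts : [/\ forall i j, (Lpnorm leb Omega n%:R%:E (bcoef i j) < +oo)%E,
  0 <= Ma' & Ma' ^+ 2 = \sum_i \sum_j bnorm i j ^+ 2].
Proof.
have E : coef_max' Omega a = ((\sum_(p : 'I_n * 'I_n)
    Lpnorm leb Omega n%:R%:E (bcoef p.1 p.2) ^+ 2) `^ 2^-1)%E.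
  by rewrite /coef_max' pair_bigA.
have fin := Ma'_fin; rewrite E in fin.
have [h1 h2 h3] := ell2_finite (fun p : 'I_n * 'I_n =>
  Lpnorm_ge0 leb Omega n%:R%:E (bcoef p.1 p.2)) fin.
by rewrite E; split=> // [i j|]; [exact: (h1 (i, j))|rewrite h3 pair_bigA].
Qed.

Lemma Ma'_ge0 : 0 <= Ma'. Proof. by case: Ma'_facts. Qed.

Lemma Ma'_sqr : Ma' ^+ 2 = \sum_i Brow i ^+ 2.
Proof.
case: Ma'_facts => _ _ ->; apply: eq_bigr => i _.
by rewrite sqr_sqrtr // sumr_ge0 // => j _; exact: sqr_ge0.
Qed.

Lemma bsup_ge0 : 0 <= bsup. Proof. by rewrite fine_ge0 // Lpnorm_ge0. Qed.
Lemma bneg_ge0 : 0 <= bneg. Proof. by rewrite fine_ge0 // Lpnorm_ge0. Qed.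

Lemma b_bounded : {ae surf, forall x, bd x -> `|b x| <= bsup}.
Proof. by apply: Lpnorm_infty_ae; case: b_Linfty. Qed.

Lemma b_lower : {ae surf, forall x, bd x -> - bneg <= b x}.
Proof.
have fin : (Lpnorm surf bd +oo (fun x => Num.min (b x) 0%R) < +oo)%E.
  case: b_Linfty => _; apply: le_lt_trans; apply: Lpnorm_infty_le => x.
  by case: (leP (b x) 0) => _; rewrite ?normr0 ?lexx ?normr_ge0.
apply: ae_mono (Lpnorm_infty_ae fin) _ => x h /h.
rewrite ler_norml => /andP[+ _] => /le_trans; apply.
by rewrite ge_min lexx.
Qed.

(** The second argument of the [i]-th inner product in the form, which splits into a
    principal, a drift and a singular part ([fluxE]). *)
Definition flux i v x : Cl :=
  a i x ^+ 2 *: H1grad v i x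
  + ((2 * Sc s * a i x)%:A - Bcoef a i x) * cgen R i * v x.

Lemma fluxE i v x : flux i v x =
  1 *: (a i x ^+ 2 *: H1grad v i x) +
  ((2 * Sc s) *: (a i x *: (cgen R i * v x)) +
   (-1) *: (Bcoef a i x * (cgen R i * v x))).
Proof.
rewrite /flux scale1r scaleN1r -mulrA mulrBl; congr (_ + (_ - _)).
by rewrite -scalerAl mul1r scalerA.
Qed.

Lemma flux_lin c i u v : flux i (c *: u + v : H) = fun x => c *: flux i u x + flux i v x.
Proof.
apply/funext => x; rewrite /flux sobolev_lin_grad sobolev_lin_fun.
rewrite scalerDr scalerA mulrDr -scalerAr scalerDr scalerA [_ * c]mulrC.
by rewrite addrACA.
Qed.

Lemma flux_mulr i v z : flux i (H1mulr v z) = fun x => flux i v x * z.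
Proof.
apply/funext => x; rewrite /flux /= [RHS]mulrDl mulrA; congr (_ + _).
exact: scalerAl.
Qed.

Lemma principal_L2 i v : L2 leb Omega (fun x => a i x ^+ 2 *: H1grad v i x) /\
  cl2 leb Omega (fun x => a i x ^+ 2 *: H1grad v i x)
    (fun x => a i x ^+ 2 *: H1grad v i x) <= (asup i ^+ 2 * N (H1grad v i)) ^+ 2.
Proof.
rewrite exprMn (sqr_sqrtr (cl2_ge0 leb Omega _)).
apply: (L2_bounded_mul mO _ (H1grad_L2 v i) (a_sqr_bounded i)).
by apply: measurable_funX; exact: a_measurable.
Qed.

Lemma drift_L2 i v : L2 leb Omega (fun x => a i x *: (cgen R i * v x)) /\
  cl2 leb Omega (fun x => a i x *: (cgen R i * v x))
    (fun x => a i x *: (cgen R i * v x)) <= (asup i * N v) ^+ 2.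
Proof.
rewrite exprMn (sqr_sqrtr (cl2_ge0 leb Omega _)).
rewrite -(cl2_cgen_mul mO i (H1fun_L2 v)).
exact: (L2_bounded_mul mO (a_measurable i) (L2_mull mO (cgen R i) (H1fun_L2 v)) (a_bounded i)).
Qed.

(** The only place where the Sobolev inequality enters; the components of [B_i] are merely
    in [L^n]. *)
Lemma singular_L2 i v : L2 leb Omega (fun x => Bcoef a i x * (cgen R i * v x)) /\
  cl2 leb Omega (fun x => Bcoef a i x * (cgen R i * v x))
    (fun x => Bcoef a i x * (cgen R i * v x)) <= (Brow i * (CS * H1norm v)) ^+ 2.
Proof.
have [bfin _ _] := Ma'_facts.
have h j := L2_sobolev_mul mO n3 (bcoef_measurable i j) (H1fun_L2 v) (bfin i j) (CS_sobolev v).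
have eE j : (fun x => bcoef i j x *: (cgen R i * v x)) =
    fun x => cgen R i * (bcoef i j x *: v x).
  by apply/funext => x; rewrite scalerAr.
have be2 j : L2 leb Omega (fun x => bcoef i j x *: (cgen R i * v x)).
  by rewrite eE; exact: (L2_mull mO (cgen R i) (h j).1).
have [B2 BE] := cl2_vector_mul mO be2; split; first exact: B2.
rewrite [leLHS]BE exprMn sqr_sqrtr; last by apply: sumr_ge0 => j _; exact: sqr_ge0.
rewrite mulr_suml; apply: ler_sum => j _; have [bv2 le] := h j.
by rewrite eE (cl2_cgen_mul mO i bv2) -exprMn.
Qed.

Lemma flux_L2 i v : L2 leb Omega (flux i v).
Proof.
have -> : flux i v = fun x => 1 *: (a i x ^+ 2 *: H1grad v i x) +
  ((2 * Sc s) *: (a i x *: (cgen R i * v x)) +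
   (-1) *: (Bcoef a i x * (cgen R i * v x))).
  by apply/funext => x; exact: fluxE.
have [p2 _] := principal_L2 i v; have [d2 _] := drift_L2 i v.
have [s2 _] := singular_L2 i v.
by apply: (L2_lin mO 1 p2 (L2_lin mO _ d2 (L2Z mO _ s2))).
Qed.

Lemma cl2_flux i u v : cl2 leb Omega (H1grad u i) (flux i v) =
  cl2 leb Omega (H1grad u i) (fun x => a i x ^+ 2 *: H1grad v i x) +
  2 * Sc s * cl2 leb Omega (H1grad u i) (fun x => a i x *: (cgen R i * v x)) -
  cl2 leb Omega (H1grad u i) (fun x => Bcoef a i x * (cgen R i * v x)).
Proof.
have -> : flux i v = fun x => 1 *: (a i x ^+ 2 *: H1grad v i x) +
  ((2 * Sc s) *: (a i x *: (cgen R i * v x)) +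
   (-1) *: (Bcoef a i x * (cgen R i * v x))).
  by apply/funext => x; exact: fluxE.
have [p2 _] := principal_L2 i v; have [d2 _] := drift_L2 i v.
have [s2 _] := singular_L2 i v; have g2 := H1grad_L2 u i.
rewrite (cl2Pr mO 1 p2 (L2_lin mO _ d2 (L2Z mO _ s2)) g2).
rewrite (cl2Pr mO _ d2 (L2Z mO _ s2) g2) (cl2Zr mO _ s2 g2).
ring.
Qed.

(** The scalar part of the Clifford-valued form. *)
Definition robin u v : R :=
  \sum_i cl2 leb Omega (H1grad u i) (flux i v)
  + cnorm s ^+ 2 * L2ip u v
  + cl2 surf bd (fun x => b x *: tau u x) (tau v).

Let btau_L2 u := L2_bounded_mul mB (b_Linfty.1) (trace_L2 tauP u) b_bounded.

Lemma qR_coef u v A :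
  qR a b tau s u v A = csign R A A * robin u (H1mulr v (cbasis R A)).
Proof.
have [bt2 _] := btau_L2 u; have tv2 := trace_L2 tauP v.
have addE (x y : Cl) : (x + y) A = x A + y A by rewrite ffunE.
have scaleE (c : R) (x : Cl) : (c *: x) A = c * x A by rewrite ffunE.
rewrite /qR /robin !addE scaleE sum_ffunE !mulrDr mulr_sumr; congr (_ + _ + _).
- apply: eq_bigr => i _; rewrite flux_mulr.
  exact: (L2inner_coef mO A (H1grad_L2 u i) (flux_L2 i v)).
- rewrite (L2inner_coef mO A (H1fun_L2 u) (H1fun_L2 v)).
  exact: mulrCA.
rewrite (L2inner_coef mB A bt2 tv2); congr (_ * _).
apply: (ae_eq_cl2 mB bt2 bt2 (L2_mulr mB _ tv2) (trace_L2 tauP _)); first exact: aeW.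
by apply: ae_mono (trace_mulr tauP v (cbasis R A)) _ => x h /h ->.
Qed.

Lemma robin_linl c u v w : robin (c *: u + v) w = c * robin u w + robin v w.
Proof.
have [bu2 _] := btau_L2 u; have [bv2 _] := btau_L2 v; have [buv2 _] := btau_L2 (c *: u + v).
have tw2 := trace_L2 tauP w.
rewrite /robin; apply: sum3_linear.
- rewrite mulr_sumr -big_split; apply: eq_bigr => i _.
  by rewrite sobolev_lin_grad; exact: (cl2P mO c (H1grad_L2 u i) (H1grad_L2 v i) (flux_L2 i w)).
- exact: (ipP (L2ip_semi_inner oOmega)).
- rewrite -(cl2P mB c bu2 bv2 tw2).
  apply: (ae_eq_cl2 mB buv2 (L2_lin mB c bu2 bv2) tw2 tw2); last exact: aeW.
  apply: ae_mono (trace_lin tauP c u v) _ => x h /h ->.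
  by rewrite scalerDr !scalerA mulrC.
Qed.

Lemma robin_linr c u v w : robin w (c *: u + v) = c * robin w u + robin w v.
Proof.
have [bw2 _] := btau_L2 w.
have tu2 := trace_L2 tauP u; have tv2 := trace_L2 tauP v.
have tuv2 := trace_L2 tauP (c *: u + v : H).
rewrite /robin; apply: sum3_linear.
- rewrite mulr_sumr -big_split; apply: eq_bigr => i _.
  by rewrite flux_lin; exact: (cl2Pr mO c (flux_L2 i u) (flux_L2 i v) (H1grad_L2 w i)).
- by rewrite (ipDr (L2ip_semi_inner oOmega)) (ipZr (L2ip_semi_inner oOmega)).
- rewrite -(cl2Pr mB c tu2 tv2 bw2).
  apply: (ae_eq_cl2 mB bw2 bw2 tuv2 (L2_lin mB c tu2 tv2)); first exact: aeW.
  exact: trace_lin.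
Qed.

Lemma L2ip_le_H1ip u : L2ip u u <= H1ip u u.
Proof. by rewrite /H1ip lerDl (ip_ge0 (gradip_semi_inner oOmega)). Qed.

Lemma gradip_le_H1ip u : gradip u u <= H1ip u u.
Proof. by rewrite /H1ip lerDr (ip_ge0 (L2ip_semi_inner oOmega)). Qed.

Let L2_le_H1 u : hnorm (@L2ip _ _ _ oOmega) u <= H1norm u.
Proof. by rewrite (H1norm_hnorm u) ler_wsqrtr // L2ip_le_H1ip. Qed.

Let grad_le_H1 u i : N (H1grad u i) <= H1norm u.
Proof.
rewrite (H1norm_hnorm u) ler_wsqrtr //; apply: le_trans (gradip_le_H1ip u).
rewrite /gradip (bigD1 i) // lerDl; apply: sumr_ge0 => j _; exact: cl2_ge0.
Qed.

Let H1_sqr u : H1norm u ^+ 2 = H1ip u u.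
Proof. by rewrite (H1norm_hnorm u) (hnorm_sqr (H1ip_semi_inner oOmega)). Qed.

Lemma cl2_flux_lower_order i u v :
  `|cl2 leb Omega (H1grad u i) (flux i v) -
    cl2 leb Omega (H1grad u i) (fun x => a i x ^+ 2 *: H1grad v i x)| <=
  2 * `|Sc s| * (N (H1grad u i) * asup i) * N v +
  N (H1grad u i) * Brow i * (CS * H1norm v).
Proof.
have g2 := H1grad_L2 u i.
have [d2 dle] := drift_L2 i v; have [s2 sle] := singular_L2 i v.
have gN : cl2 leb Omega (H1grad u i) (H1grad u i) <= N (H1grad u i) ^+ 2.
  by rewrite (sqr_sqrtr (cl2_ge0 leb Omega _)) lexx.
have N0 (f : V -> Cl) : 0 <= N f := sqrtr_ge0 _.
have dy : 0 <= asup i * N v by rewrite mulr_ge0 // asup_ge0.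
have sy : 0 <= Brow i * (CS * H1norm v).
  by rewrite !mulr_ge0 ?sqrtr_ge0.
have h1 := cl2_le mO g2 d2 (N0 _) dy gN dle.
have h2 := cl2_le mO g2 s2 (N0 _) sy gN sle.
rewrite cl2_flux.
set p := cl2 leb Omega _ (fun x => a i x ^+ 2 *: _).
set q := cl2 leb Omega _ _ in h1 *; set r := cl2 leb Omega _ _ in h2 *.
rewrite (_ : p + 2 * Sc s * q - r - p = 2 * Sc s * q - r); last by ring.
apply: le_trans (ler_normB _ _) _; apply: lerD.
  rewrite !normrM (ger0_norm (ler0n _ 2)) -!mulrA ler_wpM2l // ler_wpM2l //.
by rewrite -[leRHS]mulrA.
Qed.

Lemma robin_bounded : exists C, forall u v,
  `|robin u v| <= C * hnorm (@H1ip _ _ _ oOmega) u * hnorm (@H1ip _ _ _ oOmega) v.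
Proof.
pose t := trace_norm tau; have t0 : 0 <= t := trace_norm_ge0 oOmega tauP.
pose K := \sum_i (asup i ^+ 2 + 2 * `|Sc s| * asup i + Brow i * CS).
exists (K + cnorm s ^+ 2 + bsup * t ^+ 2) => u v.
rewrite -(H1norm_hnorm u) -(H1norm_hnorm v).
have U0 : 0 <= H1norm u := H1norm_ge0 _; have V0 : 0 <= H1norm v := H1norm_ge0 _.
have N0 (f : V -> Cl) : 0 <= N f := sqrtr_ge0 _.
have NN (f : V -> Cl) : cl2 leb Omega f f <= N f ^+ 2.
  by rewrite (sqr_sqrtr (cl2_ge0 leb Omega _)) lexx.
rewrite !mulrDl; apply: le_trans (ler_normD _ _) _; apply: lerD.
  apply: le_trans (ler_normD _ _) _; apply: lerD.
    rewrite /K !mulr_suml; apply: le_trans (ler_norm_sum _ _ _) _; apply: ler_sum => i _.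
    have [p2 ple] := principal_L2 i v.
    have py : 0 <= asup i ^+ 2 * N (H1grad v i) := mulr_ge0 (sqr_ge0 _) (N0 _).
    have h2 := cl2_le mO (H1grad_L2 u i) p2 (N0 _) py (NN _) ple.
    exact: (lower_order_bound (N0 (H1grad u i)) (N0 (H1grad v i)) (N0 v)
      (asup_ge0 i) (sqrtr_ge0 _) CS_ge0 (normr_ge0 _) (grad_le_H1 u i)
      (grad_le_H1 v i) (L2_le_H1 v) (cl2_flux_lower_order i u v) h2).
  rewrite normrM ger0_norm ?sqr_ge0 // -mulrA; apply: ler_wpM2l; first exact: sqr_ge0.
  apply: le_trans (ip_le_hnorm (L2ip_semi_inner oOmega) u v) _.
  exact: (ler_pM (hnorm_ge0 _ u) (hnorm_ge0 _ v) (L2_le_H1 u) (L2_le_H1 v)).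
have [bt2 btle] := btau_L2 u.
have E (x y p q : R) : x * y ^+ 2 * p * q = (x * (y * p)) * (y * q) by ring.
rewrite E.
have tU0 : 0 <= t * H1norm u := mulr_ge0 t0 U0.
have tV0 : 0 <= t * H1norm v := mulr_ge0 t0 V0.
apply: (cl2_le mB bt2 (trace_L2 tauP v) (mulr_ge0 bsup_ge0 tU0) tV0).
  apply: le_trans btle _; rewrite exprMn; apply: ler_wpM2l; first exact: sqr_ge0.
  by rewrite exprMn; exact: trace_norm_bound.
by rewrite exprMn; exact: trace_norm_bound.
Qed.

(** Garding's inequality with the constants of the problem: the ellipticity constant is
    the square of the infimum of the [a_i], and only the negative part of [b] counts. *)
Lemma robin_coercive u :
  min_eigen (ma ^+ 2 - Dab a b tau CS) (cnorm s ^+ 2 - Dab a b tau CS)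
    (Ma ^+ 2 * Sc s ^+ 2) * H1ip u u <= robin u u.
Proof.
pose t := trace_norm tau.
pose gd := hnorm (@gradip _ _ _ oOmega) u; pose l := hnorm (@L2ip _ _ _ oOmega) u.
pose h := H1norm u.
have gd2 : gd ^+ 2 = gradip u u := hnorm_sqr (gradip_semi_inner oOmega) u.
have l2 : l ^+ 2 = L2ip u u := hnorm_sqr (L2ip_semi_inner oOmega) u.
have hE : h ^+ 2 = gd ^+ 2 + l ^+ 2 by rewrite l2 gd2 [LHS]H1_sqr /H1ip addrC.
have gE : \sum_i N (H1grad u i) ^+ 2 = gd ^+ 2.
  rewrite gd2; apply: eq_bigr => i _; exact: (sqr_sqrtr (cl2_ge0 leb Omega _)).
have ma0 : 0 <= ma by rewrite fine_ge0 // ltW.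
have elliptic i : ma ^+ 2 * N (H1grad u i) ^+ 2 <=
    cl2 leb Omega (H1grad u i) (fun x => a i x ^+ 2 *: H1grad u i x).
  rewrite (sqr_sqrtr (cl2_ge0 leb Omega _)).
  apply: (cl2_weight_ge mO _ (H1grad_L2 u i) (a_sqr_bounded i)).
    by apply: measurable_funX; exact: a_measurable.
  apply: aeW => x Ox; rewrite ler_sqr ?nnegrE ?(ltW (a_gt0 _ Ox)) //.
  exact: coef_min_le.
have bdry : - (bneg * t ^+ 2 * h ^+ 2) <= cl2 surf bd (fun x => b x *: tau u x) (tau u).
  rewrite cl2C.
  apply: le_trans (cl2_weight_ge mB (b_Linfty.1) (trace_L2 tauP u) b_bounded b_lower).
  rewrite mulNr lerN2 -mulrA; apply: ler_wpM2l; first exact: bneg_ge0.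
  exact: trace_norm_bound.
have -> : H1ip u u = gd ^+ 2 + l ^+ 2 by rewrite -hE; exact: esym (H1_sqr u).
have -> : Ma ^+ 2 * Sc s ^+ 2 = (Ma * `|Sc s|) ^+ 2 by rewrite exprMn real_normK ?num_real.
rewrite /robin -l2.
exact: (garding_inequality (cnorm s ^+ 2) (fun i => sqrtr_ge0 _) asup_ge0 (fun i => sqrtr_ge0 _)
  gE (esym Ma_sqr) (esym Ma'_sqr) (sqrtr_ge0 _) (sqrtr_ge0 _) (H1norm_ge0 _)
  Ma_ge0 Ma'_ge0 CS_ge0 (normr_ge0 _) hE elliptic
  (fun i => cl2_flux_lower_order i u u) bdry).
Qed.

Theorem robin_weak_solution (f : V -> Cl) :
  Dab a b tau CS < ma ^+ 2 ->
  Ma ^+ 2 * Sc s ^+ 2 / (ma ^+ 2 - Dab a b tau CS) + Dab a b tau CS < cnorm s ^+ 2 ->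
  L2 leb Omega f ->
  exists u : H1 Omega,
    [/\ forall v : H1 Omega, qR a b tau s u v = L2inner leb Omega f v,
        forall w : H1 Omega,
          (forall v : H1 Omega, qR a b tau s w v = L2inner leb Omega f v) ->
          {ae leb, forall x, Omega x -> w x = u x}
      & H1norm u <= 2 * L2norm leb Omega f
          / (cnorm s ^+ 2 + ma ^+ 2 - 2 * Dab a b tau CS
             - Num.sqrt ((cnorm s ^+ 2 - ma ^+ 2) ^+ 2 + 4 * Ma ^+ 2 * Sc s ^+ 2))].
Proof.
move=> gap s_large f2.
set D := Dab a b tau CS in gap s_large *.
pose lam := min_eigen (ma ^+ 2 - D) (cnorm s ^+ 2 - D) (Ma ^+ 2 * Sc s ^+ 2).
have lam0 : 0 < lam.
  apply: min_eigen_gt0; first by rewrite subr_gt0.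
    by rewrite mulr_ge0 ?sqr_ge0.
  by rewrite ltrBrDr.
have coer u : lam * H1ip u u <= robin u u := robin_coercive u.
pose F (v : H) := cl2 leb Omega f v.
have F_le v : `|F v| <= L2norm leb Omega f * hnorm (@L2ip _ _ _ oOmega) v.
  apply: (cl2_le mO f2 (H1fun_L2 v) (sqrtr_ge0 _) (sqrtr_ge0 _)).
    by rewrite (L2norm_sqr mO f2) lexx.
  by rewrite (sqr_sqrtr (cl2_ge0 leb Omega _)) lexx.
have F_bd v : `|F v| <= L2norm leb Omega f * hnorm (@H1ip _ _ _ oOmega) v.
  apply: le_trans (F_le v) _; apply: ler_wpM2l; first exact: sqrtr_ge0.
  by rewrite -(H1norm_hnorm v); exact: L2_le_H1.
have F_lin c u v : F (c *: u + v) = c * F u + F v.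
  by rewrite /F sobolev_lin_fun; exact: (cl2Pr mO c (H1fun_L2 u) (H1fun_L2 v) f2).
have [C robin_le] := robin_bounded.
have [u uE] := lax_milgram (H1ip_semi_inner oOmega) (@H1ip_complete _ _ _ oOmega)
  robin_linl robin_linr robin_le lam0 coer F_lin F_bd.
have solE (w : H) : (forall v : H, robin w v = F v) <->
    forall v : H1 Omega, qR a b tau s w v = L2inner leb Omega f v.
  split=> h v.
    apply/ffunP => A; rewrite (qR_coef w v A) h.
    exact: (esym (L2inner_coef mO A f2 (H1fun_L2 v))).
  have := congr1 (fun x : Cl => x finset.set0) (h v).
  have E : csign R (finset.set0 : {set 'I_n}) finset.set0 = 1 :> R by exact: csign0l.
  rewrite /= (qR_coef w v finset.set0) (L2inner_coef mO finset.set0 f2 (H1fun_L2 v)).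
  rewrite E !mul1r -[cbasis R finset.set0]/(1 : Cl) H1mulr1 => ->.
  by congr (cl2 _ _ _ _); apply/funext => x; rewrite mulr1.
exists u; split.
- exact: (solE u).1 uE.
- move=> w /(solE w).2 wE; pose z : H := (w : H) - u.
  have zz : robin z z = 0.
    have := robin_linl (-1) u w z; rewrite scaleN1r addrC -/z => ->.
    by rewrite wE uE mulN1r addNr.
  have z0 : H1ip z z = 0.
    apply/eqP; rewrite eq_le (ip_ge0 (H1ip_semi_inner oOmega)) andbT.
    by rewrite -(pmulr_rle0 _ lam0) -zz coer.
  have l0 : L2ip z z = 0.
    apply/eqP; rewrite eq_le (ip_ge0 (L2ip_semi_inner oOmega)) andbT -z0.
    exact: L2ip_le_H1ip.
  apply: ae_mono (cl2_eq0 mO (H1fun_L2 z) l0) _ => x h /h.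
  by rewrite sobolev_sub_fun => /eqP; rewrite subr_eq0 => /eqP.
have norm_le : lam * H1norm u <= L2norm leb Omega f.
  have [u0|u_neq0] := eqVneq (H1norm u) 0; first by rewrite u0 mulr0 sqrtr_ge0.
  have u_gt0 : 0 < H1norm u by rewrite lt_def u_neq0 H1norm_ge0.
  rewrite -(ler_pM2r u_gt0) -mulrA -expr2 H1_sqr; apply: le_trans (coer u) _.
  by rewrite uE; apply: le_trans (ler_norm _) _; rewrite (H1norm_hnorm u); exact: F_bd.
set den := (X in _ / X).
have denE : den = 2 * lam.
  rewrite /den /lam /min_eigen [RHS]mulrC divfK ?pnatr_eq0 //.
  rewrite (_ : ma ^+ 2 - D - (cnorm s ^+ 2 - D) = - (cnorm s ^+ 2 - ma ^+ 2)); last by ring.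
  by rewrite sqrrN mulrA; ring.
have den0 : 0 < den by rewrite denE mulr_gt0.
rewrite ler_pdivlMr // denE mulrC -mulrA.
by apply: ler_wpM2l; [exact: ler0n|exact: norm_le].
Qed.

End RobinForm.

(* The dimension is n.+1. *)
Theorem theorem4p2 (R : realType) (n : nat) (n_ge3 : (3 <= n.+1)%N)
    (Omega : set 'rV[R]_n.+1) (Omega_smooth : minimally_smooth Omega)
    (tau : H1 Omega -> 'rV[R]_n.+1 -> clifford R n.+1)
    (tau_trace : dirichlet_trace tau)
    (b : 'rV[R]_n.+1 -> R)
    (b_Linfty : Linfty (surface R n.+1) (boundary Omega) b)
    (a : 'I_n.+1 -> 'rV[R]_n.+1 -> R)
    (a_gt0 : forall i x, closure Omega x -> 0 < a i x)
    (a_C1 : forall i, C1_closure Omega (a i))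
    (ma_gt0 : (0 < coef_min Omega a)%E)
    (Ma_fin : (coef_max Omega a < +oo)%E)
    (Ma'_fin : (coef_max' Omega a < +oo)%E)
    (CS : R) (CS_ge0 : 0 <= CS)
    (CS_sobolev : forall u : H1 Omega,
      (Lpnorm (lebesgue_rV R n.+1) Omega
         (2 * n.+1%:R / (n.+1%:R - 2))%:E (fun x => cnorm (u x))
       <= (CS * H1norm u)%:E)%E)
    (ma_gtD : Dab a b tau CS < fine (coef_min Omega a) ^+ 2)
    (s : clifford R n.+1) (s_para : paravector s)
    (s_large : fine (coef_max Omega a) ^+ 2 * Sc s ^+ 2
                 / (fine (coef_min Omega a) ^+ 2 - Dab a b tau CS)
               + Dab a b tau CS < cnorm s ^+ 2)
    (f : 'rV[R]_n.+1 -> clifford R n.+1)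
    (f_L2 : L2 (lebesgue_rV R n.+1) Omega f) :
  exists u : H1 Omega,
    [/\ forall v : H1 Omega,
          qR a b tau s u v = L2inner (lebesgue_rV R n.+1) Omega f v,
        forall w : H1 Omega,
          (forall v : H1 Omega,
             qR a b tau s w v = L2inner (lebesgue_rV R n.+1) Omega f v) ->
          {ae lebesgue_rV R n.+1, forall x, Omega x -> w x = u x}
      & H1norm u <=
          2 * L2norm (lebesgue_rV R n.+1) Omega f
          / (cnorm s ^+ 2 + fine (coef_min Omega a) ^+ 2
             - 2 * Dab a b tau CS
             - Num.sqrt ((cnorm s ^+ 2 - fine (coef_min Omega a) ^+ 2) ^+ 2
                         + 4 * fine (coef_max Omega a) ^+ 2 * Sc s ^+ 2))].
Proof.
have [oOmega _ _ _] := Omega_smooth.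
apply: (@robin_weak_solution _ _ _ oOmega) => // i x Ox.
by apply: a_gt0; exact: subset_closure.
Qed.
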